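(* Let $f$ and $\sigma$ satisfy conditions (A) and (B) of the context, let $F(x)=\int_0^x f(z)\,dz$ for $x\ge 0$, and let $S_T$, $S^n_T$, $Z^n_T$ be as in the context. Then there exists a constant $C$ not depending on $n$ such that for all $n\ge 1$ $$\left|\mathrm{E} f(S_T)-\mathrm{E}\left(\frac{F(S^n_T)}{S^n_T}\left(1+\frac{Z^n_T}{T}\right)\right)\right|\le C\,n^{-rH},$$ where $r\in(0,1]$ is the Hölder exponent of $\sigma$ in condition (B)(iii) and $H$ is the Hurst index.
   Context: Model. Fix $T>0$, $H\in(\tfrac12,1)$, $b\in\mathbb{R}$, $\alpha>0$ and deterministic $S_0>0$, $Y_0\in\mathbb{R}$. $W=\{W_t\}_{t\in[0,T]}$ is a standard Wiener process and $B^H=\{B^H_t\}_{t\in[0,T]}$ is a fractional Brownian motion with Hurst index $H$ (centered Gaussian, covariance $\frac12(s^{2H}+t^{2H}-|t-s|^{2H})$, with continuous paths), independent of $W$. The processes $S,Y$ solve $dS_t=bS_t\,dt+\sigma(Y_t)S_t\,dW_t$, $dY_t=-\alpha Y_t\,dt+dB^H_t$, $t\in[0,T]$, i.e. $Y_t=Y_0e^{-\alpha t}+\int_0^te^{-\alpha(t-s)}dB^H_s$ and $S_t=S_0\exp\{bt+\int_0^t\sigma(Y_s)dW_s-\frac12\int_0^t\sigma^2(Y_s)ds\}$. Put $X_t=\log S_t$, $X_0=\log S_0$. Condition (A), on $f:\mathbb{R}^+\to\mathbb{R}^+$: (i) $f$ is measurable and $f(x)\le C_f(1+x^p)$, $x\ge0$,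 for some constants $C_f>0$, $p>0$; (ii) $f$ is locally Riemann integrable, possibly having discontinuities of the first kind. Condition (B), on $\sigma:\mathbb{R}\to\mathbb{R}$: there is $C_\sigma>0$ such that (i) $\sigma(x)\ge\sigma_{\min}>0$ for all $x$; (ii) there is $q\in(0,1)$ with $\sigma(x)\le C_\sigma(1+|x|^q)$, $x\in\mathbb{R}$; (iii) there is $r\in(0,1]$ with $|\sigma(x)-\sigma(y)|\le C_\sigma|x-y|^r$, $x,y\in\mathbb{R}$; (iv) $\sigma\in C(\mathbb{R})$ is differentiable Lebesgue-a.e. and there is $q'>0$ with $|\sigma'(x)|\le C_\sigma(1+|x|^{q'})$ for Lebesgue-a.e. $x$. Discretization. For $n\in\mathbb{N}$ let $t_i=iT/n$, $i=0,\dots,n$, $\Delta B^H_i=B^H_{t_{i+1}}-B^H_{t_i}$, and $$Y^n_{t_j}=Y_0e^{-\alpha t_j}+e^{-\alpha t_{j-1}}\sum_{i=0}^{j-1}e^{\alpha t_i}\Delta B^H_i$$ (so $Y^n_{0}=Y_0$), with $Y^n_s=Y^n_{t_i}$ for $s\in[t_i,t_{i+1})$. Set $$X^n_{t_j}=X_0+bt_j-\frac12\int_0^{t_j}\sigma^2(Y^n_s)ds+\int_0^{t_j}\sigma(Y^n_s)dW_s,\quad S^n_{t_j}=\exp\{X^n_{t_j}\},\quad Z^n_T=\int_0^T\frac{1}{\sigma(Y^n_s)}dW_s.$$ *)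

(* Defs.v *)
From mathcomp Require Import all_boot all_order all_algebra.
From mathcomp Require Import all_classical all_reals all_analysis.

Set Implicit Arguments.
Unset Strict Implicit.
Unset Printing Implicit Defensive.

Import Order.TTheory GRing.Theory Num.Theory.
Import numFieldNormedType.Exports.

Local Open Scope classical_set_scope.
Local Open Scope ring_scope.

Section RiemannStieltjes.
Context {R : realType}.
Implicit Types (f g : R -> R) (a b l : R).

(* [l] is the limit, as the mesh tends to 0, of the sums
   f(xi_i) (g(x_{i+1}) - g(x_i)) over all tagged partitions of [a, b]. *)
Definition is_RS_integral f g a b l : Prop :=
  forall eps : R, 0 < eps -> exists2 delta : R, 0 < delta &
    forall (m : nat) (x xi : nat -> R), x 0%N = a -> x m = b ->
      (forall i, (i < m)%N -> x i <= xi i <= x i.+1 /\ x i.+1 - x i < delta) ->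
      `| \sum_(i < m) f (xi i) * (g (x i.+1) - g (x i)) - l | < eps.

Definition Riemann_integrable f a b : Prop :=
  exists l, is_RS_integral f id a b l.

End RiemannStieltjes.

Section Conditions.
Context {R : realType}.

(* Functions on [0, +oo[ are represented by functions on R whose values at
   negative arguments are irrelevant. *)
Record condition_A (f : R -> R) (Cf p : R) : Prop := {
  condA_ge0 : forall x : R, 0 <= x -> 0 <= f x ;
  condA_Cf_gt0 : 0 < Cf ;
  condA_p_gt0 : 0 < p ;
  condA_measurable : measurable_fun (`[0%R, +oo[ : set R) f ;
  condA_growth : forall x : R, 0 <= x -> f x <= Cf * (1 + x `^ p) ;
  (* jumps are allowed: continuity of f is not assumed *)
  condA_riemann : forall a : R, 0 <= a -> Riemann_integrable f 0 a
}.

Record condition_B (sigma : R -> R) (Csigma smin q r q' : R) : Prop := {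
  condB_C_gt0 : 0 < Csigma ;
  condB_smin_gt0 : 0 < smin ;
  condB_ge_smin : forall x : R, smin <= sigma x ;
  condB_q : 0 < q < 1 ;
  condB_growth : forall x : R, sigma x <= Csigma * (1 + `|x| `^ q) ;
  condB_r : 0 < r <= 1 ;
  condB_holder : forall x y : R, `|sigma x - sigma y| <= Csigma * `|x - y| `^ r ;
  condB_continuous : continuous sigma ;
  condB_q' : 0 < q' ;
  condB_derivative : {ae (@lebesgue_measure R), forall x : R,
    derivable sigma x 1 /\ `|derive1 sigma x| <= Csigma * (1 + `|x| `^ q')}
}.

End Conditions.

Section Processes.
Context {R : realType} {d : measure_display} {Omega : measurableType d}.
Variable P : probability Omega R.

(* A process is indexed by all of R; only its values on [0, T] matter. *)
Implicit Types (W B X Y : R -> Omega -> R) (T t : R).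

Definition has_law (X : Omega -> R) (mu : set R -> \bar R) : Prop :=
  forall U : set R, measurable U -> P (X @^-1` U) = mu U.

(* [normal_prob m s] is a normal law with standard deviation s only when
   s != 0; the degenerate Gaussian laws are Dirac masses. *)
Definition is_gaussian (X : Omega -> R) : Prop :=
  (exists m s : R, 0 < s /\ has_law X (normal_prob m s)) \/
  (exists m : R, has_law X (\d_m)).

Definition increment X s t : Omega -> R := X t \- X s.

Record is_wiener T W : Prop := {
  wiener_measurable : forall t, 0 <= t <= T -> measurable_fun setT (W t) ;
  wiener0 : {ae P, forall w, W 0 w = 0} ;
  wiener_continuous : forall w, {within `[0, T], continuous (W ^~ w)} ;
  wiener_increment : forall s t : R, 0 <= s -> s < t -> t <= T ->
    has_law (increment W s t) (normal_prob 0 (Num.sqrt (t - s))) ;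
  wiener_independent_increments :
    forall (m : nat) (t : nat -> R) (U : nat -> set R),
      0 <= t 0%N -> t m <= T ->
      (forall i, (i < m)%N -> t i <= t i.+1) -> (forall i, measurable (U i)) ->
      P (\bigcap_(i in `I_m) (increment W (t i) (t i.+1) @^-1` U i)) =
      (\prod_(i < m) P (increment W (t i) (t i.+1) @^-1` U i))%E
}.

Record is_fbm T (H : R) B : Prop := {
  fbm_measurable : forall t, 0 <= t <= T -> measurable_fun setT (B t) ;
  fbm_continuous : forall w, {within `[0, T], continuous (B ^~ w)} ;
  fbm_gaussian : forall (m : nat) (t a : nat -> R),
    (forall i, (i < m)%N -> 0 <= t i <= T) ->
    is_gaussian (fun w => \sum_(i < m) a i * B (t i) w) ;
  fbm_centered : forall t, 0 <= t <= T -> ('E_P[B t] = 0)%E ;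
  fbm_covariance : forall s t : R, 0 <= s <= T -> 0 <= t <= T ->
    covariance P (B s) (B t) =
    (2^-1 * (s `^ (2 * H) + t `^ (2 * H) - `|t - s| `^ (2 * H)))%:E
}.

Definition sigma_upto X t : set (set Omega) :=
  <<s [set A | exists (s : R) (U : set R),
         [/\ 0 <= s <= t, measurable U & A = X s @^-1` U] ] >>.

Definition independent_processes T X Y : Prop :=
  forall A A' : set Omega, sigma_upto X T A -> sigma_upto Y T A' ->
    P (A `&` A') = (P A * P A')%E.

Definition joint_filtration X Y t : set (set Omega) :=
  <<s sigma_upto X t `|` sigma_upto Y t >>.

(* The step process with value [sp_value i] on [sp_time i, sp_time i.+1[,
   for i < sp_size. *)
Record step_process := StepProcess {
  sp_size : nat ;
  sp_time : nat -> R ;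
  sp_value : nat -> Omega -> R
}.

Definition step_eval (h : step_process) (s : R) (w : Omega) : R :=
  \sum_(i < sp_size h)
    sp_value h i w * \1_(`[sp_time h i, sp_time h i.+1[) s.

Definition step_integral W (h : step_process) (w : Omega) : R :=
  \sum_(i < sp_size h)
    sp_value h i w * (W (sp_time h i.+1) w - W (sp_time h i) w).

Definition step_adapted (F : R -> set (set Omega)) t (h : step_process) : Prop :=
  [/\ sp_time h 0%N = 0, sp_time h (sp_size h) = t,
      forall i, (i < sp_size h)%N -> sp_time h i <= sp_time h i.+1 &
      forall i, (i < sp_size h)%N -> forall U : set R, measurable U ->
        F (sp_time h i) (sp_value h i @^-1` U)].

Definition step_approximation (F : R -> set (set Omega)) (phi : R -> Omega -> R)
    t (h : nat -> step_process) : Prop :=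
  (forall k, step_adapted F t (h k)) /\
  forall eps : R, 0 < eps ->
    P [set w | (eps%:E <=
        \int[lebesgue_measure]_(s in `[0%R, t])
          ((step_eval (h k) s w - phi s w) ^+ 2)%:E)%E] @[k --> \oo] --> 0%E.

Definition cvg_in_probability (X : nat -> Omega -> R) (X' : Omega -> R) : Prop :=
  forall eps : R, 0 < eps ->
    P [set w | eps <= `|X k w - X' w| ] @[k --> \oo] --> 0%E.

(* [I] is (a version of) the Ito integral of [phi] over [0, t] with respect to
   [W] and the filtration [F]: the limit in probability of the integrals of
   adapted step processes approximating [phi], whichever the approximation. *)
Record is_ito_integral (F : R -> set (set Omega)) W (phi : R -> Omega -> R) t
    (I : Omega -> R) : Prop := {
  ito_integrand_measurable :
    measurable_fun (`[0, t] `*` setT) (fun z : R * Omega => phi z.1 z.2) ;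
  ito_measurable : measurable_fun setT I ;
  ito_integrand_approx : exists h, step_approximation F phi t h ;
  ito_limit : forall h, step_approximation F phi t h ->
    cvg_in_probability (fun k => step_integral W (h k)) I
}.

(* The integral with respect to B of the smooth function exp(- alpha (t - s))
   is a pathwise Riemann-Stieltjes integral. *)
Definition is_fractional_OU T (alpha Y0 : R) B Y : Prop :=
  forall (t : R) (w : Omega), 0 <= t <= T ->
    is_RS_integral (fun s => expR (- alpha * (t - s))) (B ^~ w) 0 t
      (Y t w - Y0 * expR (- alpha * t)).

Definition is_price T (S0 b : R) (sigma : R -> R) W B Y
    (S : R -> Omega -> R) : Prop :=
  exists I : R -> Omega -> R, forall t, 0 <= t <= T ->
    is_ito_integral (joint_filtration W B) W (fun s w => sigma (Y s w)) t (I t) /\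
    forall w, S t w = S0 * expR (b * t + I t w -
      2^-1 * \int[lebesgue_measure]_(s in `[0, t]) (sigma (Y s w) ^+ 2)).

End Processes.

Section Discretization.
Context {R : realType} {d : measure_display} {Omega : measurableType d}.
Variables (T alpha S0 Y0 b : R) (sigma : R -> R) (W B : R -> Omega -> R).
Variable n : nat.

Definition grid (i : nat) : R := i%:R * T / n%:R.

(* For j = 0 the sum is empty, so the junk value [0.-1 = 0] is harmless. *)
Definition Yn_grid (j : nat) (w : Omega) : R :=
  Y0 * expR (- alpha * grid j) +
  expR (- alpha * grid j.-1) *
    \sum_(i < j) expR (alpha * grid i) * (B (grid i.+1) w - B (grid i) w).

(* [Num.truncn] is the integer part: the index is i for s in [t_i, t_{i+1}[. *)
Definition Yn (s : R) (w : Omega) : R := Yn_grid (Num.truncn (s * n%:R / T)) w.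

(* The process s |-> g (Yn s) on [0, grid j], as a step process. *)
Definition Yn_step (g : R -> R) (j : nat) : @step_process R d Omega :=
  StepProcess j grid (fun i w => g (Yn_grid i w)).

Definition Xn (j : nat) (w : Omega) : R :=
  ln S0 + b * grid j
  - 2^-1 * \int[lebesgue_measure]_(s in `[0, grid j]) (sigma (Yn s w) ^+ 2)
  + step_integral W (Yn_step sigma j) w.

Definition Sn (j : nat) (w : Omega) : R := expR (Xn j w).

Definition Zn (w : Omega) : R :=
  step_integral W (Yn_step (fun y => (sigma y)^-1) n) w.

End Discretization.

Definition primitive {R : realType} (f : R -> R) (x : R) : R :=
  \int[lebesgue_measure]_(z in `[0, x]) f z.

(* Main.v *)
(* Conditionally on B^H the log-prices X_T and X^n_T are Gaussian with means
   m - V/2, m - V^n/2 and variances V = int_0^T sigma^2(Y_s) ds,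
   V^n = int_0^T sigma^2(Y^n_s) ds, where m = log S_0 + b T.  Hence E f(S_T) = E psi(V)
   and E f(S^n_T) = E psi(V^n), where psi(v) = E f(exp(m - v/2 + sqrt v N)), N standard
   Gaussian.  Away from v = 0 (here v >= sigma_min^2 T) psi is differentiable in v even
   when f is not continuous, with a locally Lipschitz bound of exponential growth, so the
   error is at most C E |V - V^n| e^{c (V + V^n)}.  This is O(n^{-rH}), because
   Y_s - Y^n_s is a centered Gaussian variable of variance O(n^{-2H}) plus a deterministic
   error, sigma is r-Hoelder, and sigma^2 grows more slowly than x^2, so that all
   exponential moments of sigma^2(Y) are finite.

   The formula E f(S^n_T) = E (F(S^n_T)/S^n_T (1 + Z^n_T/T)) is an integration by parts
   in each increment of W separately: with G(x) = F(e^x) e^{-x} one has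
   f(e^x) = G'(x) + G(x).

   For the identity E f(S_T) = E psi(V) no conditional law of the Ito integral is needed:
   X^n_T -> X_T in probability and E 1_{X^n_T > a} -> E psi_{1_{x > a}}(V) by the error
   bound above, which identifies the law of X_T on rays. *)
Require Import Defs.
From HB Require Import structures.
From mathcomp Require Import all_boot all_order all_algebra.
From mathcomp Require Import all_classical all_reals all_analysis.
From mathcomp Require Import measurable_realfun.
From mathcomp Require Import ring lra.
Import Order.TTheory GRing.Theory Num.Theory.
Import numFieldNormedType.Exports.
Local Open Scope classical_set_scope.
Local Open Scope ring_scope.
Set Implicit Arguments.
Unset Strict Implicit.
Unset Printing Implicit Defensive.

(** * Changes of variables and Gaussian integrals *)

(** Three obstacles shape the proof. The process Y is only a limit of Riemann-Stieltjes sums, so its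
    Gaussian laws are not carried along: every value of a process is controlled by a bound E
    e^{Z^2/(4K)} <= 2 with explicit K, which weighted sums of increments of B^H satisfy.

    The difference |V - V^n| times an exponential of V or V^n is dominated by one functional: the
    integral over [0, T] of N^2 (sigma^2(Y) - sigma^2(Y^n))^2 + e^{l sigma^2(Y)} + e^{l
    sigma^2(Y^n)}, divided by N = n^{rH}. Its expectation is bounded uniformly in n, by Tonelli and
    moment bounds at fixed times, and Markov's inequality applied to it also gives X^n_T -> X_T in
    probability.

    Finiteness of the expectations is not known beforehand. Hence the price estimates are one-sided
    inequalities x <= y + error between nonnegative extended integrals, and in the integration by
    parts the positive and negative parts of the weight stand on opposite sides; prices are
    subtracted only once they are known to be finite. *)

Section density.
Import HBNNSimple.
Local Open Scope ereal_scope.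
Context d1 d2 (X : measurableType d1) (Y : measurableType d2) (R : realType).
Variables (mu : {measure set X -> \bar R}) (theta : X -> Y) (g : X -> R).

(** The image under [theta] of the measure with density [g] with respect to [mu]. The proofs are
    arguments so that the measure structure can be attached to the term. *)
Definition push_density (mtheta : measurable_fun setT theta)
    (mg : measurable_fun setT g) (g0 : forall x, (0 <= g x)%R) (A : set Y) :=
  \int[mu]_(x in theta @^-1` A) (g x)%:E.

Section push_density_measure.
Variables (mtheta : measurable_fun setT theta)
    (mg : measurable_fun setT g) (g0 : forall x, (0 <= g x)%R).
Local Notation pd := (push_density mtheta mg g0).

Let pd0 : pd set0 = 0.
Proof. by rewrite /push_density preimage_set0 integral_set0. Qed.

Let pd_ge0 A : 0 <= pd A.
Proof. by apply: integral_ge0 => x _; rewrite lee_fin. Qed.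

Let pd_sigma_additive : semi_sigma_additive pd.
Proof.
move=> F mF tF mUF.
rewrite /push_density preimage_bigcup ge0_integral_bigcup//=.
- apply: is_cvg_ereal_nneg_natsum_cond => n _ _.
  by apply: integral_ge0 => x _; rewrite lee_fin.
- by move=> k; rewrite -[_ @^-1` _]setTI; exact: mtheta.
- by apply: measurable_funTS; apply/measurable_EFinP.
- by move=> x _; rewrite lee_fin.
- move=> i j _ _ [x [Fi Fj]]; apply: (tF i j I I); by exists (theta x).
Qed.

HB.instance Definition _ := isMeasure.Build _ _ _ pd pd0 pd_ge0 pd_sigma_additive.
End push_density_measure.

(** Equality on sets extends to simple functions by linearity and to [h] by monotone convergence.
    The one formula serves for substitutions on the line, for laws with a density ([theta] the
    identity) and for image laws ([g] equal to 1). *)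
Lemma ge0_integral_push_density (nu : {measure set Y -> \bar R})
    (mtheta : measurable_fun setT theta) (mg : measurable_fun setT g)
    (g0 : forall x, (0 <= g x)%R) :
  (forall A, measurable A -> nu A = \int[mu]_(x in theta @^-1` A) (g x)%:E) ->
  forall h : Y -> \bar R, measurable_fun [set: Y] h -> (forall y, 0 <= h y) ->
  \int[nu]_y h y = \int[mu]_x (h (theta x) * (g x)%:E).
Proof.
move=> nuE h mh h0.
pose h_ := nnsfun_approx measurableT mh.
transitivity (limn (fun n => \int[nu]_x (h_ n x)%:E)).
  rewrite -monotone_convergence//.
  - apply: eq_integral => y _; apply/esym/cvg_lim => //.
    exact: cvg_nnsfun_approx.
  - by move=> n; exact/measurable_EFinP/measurable_funP.
  - by move=> n y _; rewrite lee_fin.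
  - by move=> y _ m n mn; rewrite lee_fin; exact/lefP/nd_nnsfun_approx.
transitivity (limn (fun n => \int[mu]_x ((h_ n (theta x))%:E * (g x)%:E))); last first.
  rewrite -monotone_convergence//.
  - apply: eq_integral => x _; apply/cvg_lim => //.
    by apply: cvgeZr => //; exact: cvg_nnsfun_approx.
  - move=> n; apply: emeasurable_funM; apply/measurable_EFinP => //.
    by apply: measurableT_comp.
  - by move=> n x _; rewrite mule_ge0// lee_fin.
  - move=> x _ m n mn; rewrite lee_wpmul2r ?lee_fin//.
    exact/lefP/nd_nnsfun_approx.
congr (limn _); apply/funext => n.
have mhn r : measurable (h_ n @^-1` [set r]) by exact: measurable_funPTI.
have mthn r : measurable (theta @^-1` (h_ n @^-1` [set r])).
  by rewrite -[_ @^-1` (_ @^-1` _)]setTI; exact: mtheta.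
transitivity (\sum_(k \in range (h_ n)) k%:E * nu (h_ n @^-1` [set k])).
  under eq_integral do rewrite fimfunE -fsumEFin//.
  rewrite ge0_integral_fsum//.
  - by apply: eq_fsbigr => r _; rewrite integralZl_indic_nnsfun// integral_indic// setIT.
  - by move=> y; exact/measurable_EFinP/measurable_funM.
  - by move=> y x _; rewrite nnfun_muleindic_ge0.
transitivity (\int[mu]_x (\sum_(k \in range (h_ n))
    ((k * \1_(h_ n @^-1` [set k]) (theta x))%:E * (g x)%:E))); last first.
  apply: eq_integral => x _; rewrite fimfunE -fsumEFin// ge0_mule_fsuml//.
  by move=> k; exact: nnfun_muleindic_ge0.
rewrite ge0_integral_fsum//.
- apply: eq_fsbigr => r /[!inE] -[y _ <-].
  rewrite nuE//.
  under [RHS]eq_integral do rewrite EFinM -muleA.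
  rewrite ge0_integralZl ?lee_fin//.
  + congr (_ * _); rewrite integral_mkcond; apply: eq_integral => x _.
    rewrite patchE indicE (_ : (x \in _ @^-1` _) = (theta x \in h_ n @^-1` [set h_ n y])); last first.
      by apply/idP/idP; rewrite !inE.
    by case: ifPn => /=; rewrite ?mul1e ?mul0e.
  + apply: emeasurable_funM; apply/measurable_EFinP => //.
    by apply: measurableT_comp.
  + by move=> x _; rewrite mule_ge0// lee_fin.
- move=> r; apply/measurable_EFinP; do 2 apply: measurable_funM => //.
  by apply: measurableT_comp.
- move=> r x _; rewrite mule_ge0// ?lee_fin//; exact: nnfun_muleindic_ge0.
Qed.

End density.

Lemma measurable_inv_gt0 d (X : measurableType d) (R : realType) (g : X -> R) :
  measurable_fun setT g -> (forall x, 0 < g x) -> measurable_fun setT (fun x => (g x)^-1).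
Proof.
move=> mg g0; rewrite (_ : (fun _ => _) = fun x => expR (- ln (g x))).
  by do 2 apply: measurableT_comp => //; exact: measurableT_comp.
by apply/funext => x; rewrite expRN lnK// posrE.
Qed.

Section lebesgue_transfer.
Local Open Scope ereal_scope.
Context {R : realType}.
Notation mu := (@lebesgue_measure R).

(** Lebesgue measure is determined by its values on half-open intervals, so a substitution has only
    to be checked on []a, b]]. *)
Lemma ge0_lebesgue_transfer (theta g : R -> R)
    (mtheta : measurable_fun setT theta) (mg : measurable_fun setT g)
    (g0 : forall x, (0 <= g x)%R) :
  (forall a b, (a < b)%R ->
    \int[mu]_(x in theta @^-1` `]a, b]) (g x)%:E = (b - a)%:E) ->
  forall h : R -> \bar R, measurable_fun [set: R] h -> (forall y, 0 <= h y) ->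
  \int[mu]_y h y = \int[mu]_x (h (theta x) * (g x)%:E).
Proof.
move=> H; apply: (@ge0_integral_push_density _ _ (measurableTypeR R) (measurableTypeR R) R mu theta g mu mtheta mg g0) => //.
move=> A mA.
change (mu A = @push_density _ _ (measurableTypeR R) (measurableTypeR R) R mu theta g mtheta mg g0 A).
apply: lebesgue_measure_unique => //.
move=> _ [[a b]] _ <- /=; rewrite /push_density.
have [ab|ba] := ltP a b; first by rewrite H// lebesgue_measure_itv/= lte_fin ab EFinB.
by rewrite set_itv_ge ?bnd_simp -?leNgt// preimage_set0 integral_set0 measure0.
Qed.

Lemma ge0_integral_affine (m a : R) : (0 < a)%R ->
  forall h : R -> \bar R, measurable_fun [set: R] h -> (forall y, 0 <= h y) ->
  \int[mu]_y h y = \int[mu]_x (h (m + a * x)%R * a%:E).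
Proof.
move=> a0; apply: ge0_lebesgue_transfer => //.
- by apply: measurable_funD => //; exact: measurable_funM.
- by move=> _; exact: ltW.
move=> c d cd.
have -> : (fun x => m + a * x)%R @^-1` `]c, d] = `]((c - m) / a)%R, ((d - m) / a)%R]%classic.
  apply/seteqP; split => x /=; rewrite !in_itv/= ltr_pdivrMr// ler_pdivlMr// [(a * _)%R]mulrC; lra.
rewrite integral_cst//= lebesgue_measure_itv/= lte_fin ltr_pM2r ?invr_gt0// ltrD2r cd.
rewrite -EFinM; congr (_ %:E).
rewrite -mulrBl mulrC divfK ?gt_eqF//. lra.
Qed.

Lemma measurable_inv_itv (a : R) : (0 < a)%R ->
  measurable_fun (`]0%R, +oo[%classic : set R) (fun z : R => (a * z)^-1)%R.
Proof.
move=> a0; apply: subspace_continuous_measurable_fun => //.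
apply: continuous_in_subspaceT => z; rewrite inE/= in_itv/= andbT => z0.
apply: (@continuousV _ _ (fun z => a * z)%R); first by rewrite mulf_neq0 ?gt_eqF.
by apply: continuousM => //; exact: cvg_cst.
Qed.

Lemma ge0_integral_log (m a : R) : (0 < a)%R ->
  forall h : R -> \bar R, measurable_fun [set: R] h -> (forall y, 0 <= h y) ->
  \int[mu]_y h y =
  \int[mu]_(z in `]0%R, +oo[) (h ((ln z - m) / a)%R * ((a * z)^-1)%:E).
Proof.
move=> a0 h mh h0.
(* [ln] takes a default value for z <= 0; the cutoff gives these points no mass. *)
pose g (z : R) := ((a * z)^-1 * \1_(`]0%R, +oo[%classic : set R) z)%R.
have mln : measurable_fun setT (fun z : R => (ln z - m) / a)%R.
  by apply: measurable_funM => //; apply: measurable_funB => //; exact: measurable_ln.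
have minv := measurable_inv_itv a0.
rewrite (@ge0_lebesgue_transfer (fun z : R => (ln z - m) / a)%R g _ _ _)//.
- rewrite [RHS]integral_mkcond; apply: eq_integral => z _.
  by rewrite patchE /g indicE; case: ifPn => _; rewrite ?mulr1// mulr0 mule0.
- rewrite (_ : g = (fun z : R => (a * z)^-1)%R \_ (`]0%R, +oo[%classic : set R)).
    by apply/(measurable_restrictT _ _).1.
  by apply/funext => z; rewrite /g patchE indicE; case: ifPn => _; rewrite ?mulr1 ?mulr0.
- move=> z; rewrite /g indicE; case: (boolP (z \in _)) => [|_]; last by rewrite mulr0.
  by rewrite inE/= in_itv/= andbT mulr1 => z0; rewrite invr_ge0 mulr_ge0// ltW.
move=> c d cd.
pose e1 := expR (m + a * c); pose e2 := expR (m + a * d).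
have e10 : (0 < e1)%R by exact: expR_gt0.
have e12 : (e1 < e2)%R by rewrite ltr_expR ltrD2l ltr_pM2l.
transitivity (\int[mu]_(x in `]e1, e2]) ((a * x)^-1)%:E).
  rewrite integral_mkcond [RHS]integral_mkcond; apply: eq_integral => z _.
  rewrite !patchE /g indicE.
  have [z0|z0] := ltP 0%R z; last first.
    rewrite (_ : z \in `]0%R, +oo[%classic = false); last first.
      by apply/negbTE; rewrite notin_setE/= in_itv/= andbT; apply/negP; rewrite -leNgt.
    rewrite (_ : z \in `]e1, e2]%classic = false) ?mulr0 ?if_same//.
    apply/negbTE; rewrite notin_setE/= in_itv/= => /andP[]; lra.
  rewrite [z \in `]0%R, +oo[%classic]mem_set ?mulr1/=; last by rewrite in_itv/= z0.
  have E1 : (e1 < z)%R = (m + a * c < ln z)%R by rewrite -[RHS]ltr_expR lnK.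
  have E2 : (z <= e2)%R = (ln z <= m + a * d)%R by rewrite -[RHS]ler_expR lnK.
  congr (if _ then _ else _); apply/idP/idP; rewrite !inE/= !in_itv/= ltr_pdivlMr// ler_pdivrMr// E1 E2 ![(_ * a)%R]mulrC; lra.
rewrite integral_itv_obnd_cbnd; last first.
  apply/measurable_EFinP; apply: measurable_funS minv => // x /=; rewrite !in_itv/= andbT => /andP[+ _].
  exact: lt_trans.
have dln (z : R) : (0 < z)%R -> is_derive z 1%R (fun y : R => (ln y / a)%R : R) (a * z)^-1%R.
    move=> z0; have dl := is_derive1_ln z0; apply: is_derive_eq.
    by rewrite scaler0 add0r invfM.
rewrite (@continuous_FTC2 _ _ (fun z => ln z / a)%R)//.
- rewrite -EFinB; congr (_%:E); rewrite /e1 /e2 !expRK; field; lra.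
- apply: continuous_in_subspaceT => z; rewrite inE/= in_itv/= => /andP[z0 _].
  apply: (@continuousV _ _ (fun z => a * z)%R); first by rewrite mulf_neq0 ?gt_eqF//; lra.
  by apply: continuousM => //; exact: cvg_cst.
- split.
  + by move=> z; rewrite in_itv/= => /andP[z0 _]; have [] := dln z (lt_trans e10 z0).
  + apply: cvg_at_right_filter.
    by apply: cvgM; [exact: continuous_ln|exact: cvg_cst].
  + apply: cvg_at_left_filter.
    by apply: cvgM; [exact: (continuous_ln (lt_trans e10 e12))|exact: cvg_cst].
- move=> z; rewrite in_itv/= => /andP[z0 _].
  by rewrite derive1E (@derive_val _ _ _ _ _ _ _ (dln _ (lt_trans e10 z0))).
Qed.
End lebesgue_transfer.

Section gaussian.
Local Open Scope ereal_scope.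
Context {R : realType}.
Notation mu := (@lebesgue_measure R).
Implicit Types (m s a c v x y z : R) (h : R -> \bar R).

Lemma normal_pdf_expR m s x : (0 < s)%R ->
  normal_pdf m s x =
  ((s * Num.sqrt (pi *+ 2))^-1 * expR (- ((x - m) ^+ 2 / (2 * s ^+ 2))))%R.
Proof.
move=> s0; rewrite /normal_pdf (gt_eqF s0) /normal_peak /normal_fun.
rewrite -mulrnAr sqrtrM ?sqr_ge0// sqrtr_sqr gtr0_norm//.
by rewrite mulNr [(2 * _)%R]mulr_natl.
Qed.

Lemma sqrt_2pi_gt0 : (0 < Num.sqrt (pi *+ 2) :> R)%R.
Proof. by rewrite sqrtr_gt0 mulrn_wgt0// pi_gt0. Qed.

Lemma ge0_integral_normal m s h : measurable_fun [set: R] h -> (forall y, 0 <= h y) ->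
  \int[normal_prob m s]_y h y = \int[mu]_y (h y * (normal_pdf m s y)%:E).
Proof.
have mi : measurable_fun [set: measurableTypeR R] (id : measurableTypeR R -> measurableTypeR R) by [].
apply: (@ge0_integral_push_density _ _ (measurableTypeR R) (measurableTypeR R) R
  mu id (normal_pdf m s) (normal_prob m s) mi) => //.
- exact: measurable_normal_pdf.
- exact: normal_pdf_ge0.
Qed.

Lemma ge0_integral_normal_std m s h : (0 < s)%R ->
  measurable_fun [set: R] h -> (forall y, 0 <= h y) ->
  \int[normal_prob m s]_y h y = \int[normal_prob 0 1]_z h (m + s * z)%R.
Proof.
move=> s0 mh h0.
have maff : measurable_fun [set: R] (fun z => m + s * z)%R.
  by apply: measurable_funD => //; exact: measurable_funM.
apply: (etrans (ge0_integral_normal m s mh h0)); apply: esym.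
apply: (etrans (@ge0_integral_normal 0 1 (fun z => h (m + s * z)%R) (measurableT_comp mh maff) _)); first by [].
apply: esym.
rewrite (ge0_integral_affine m s0).
- apply: eq_integral => z _; rewrite -muleA; congr (_ * _).
  rewrite -EFinM; congr (_%:E).
  rewrite !normal_pdf_expR// [(m + _)%R]addrC addrK subr0 expr1n mulr1 mul1r.
  have -> : ((s * z) ^+ 2 / (2 * s ^+ 2) = z ^+ 2 / 2)%R by field; lra.
  have := sqrt_2pi_gt0 => ?; field; apply/andP; split; lra.
- apply: emeasurable_funM => //; apply/measurable_EFinP.
  exact: measurable_normal_pdf.
- by move=> y; rewrite mule_ge0// lee_fin normal_pdf_ge0.
Qed.

(** The joint density of a Gaussian pair, conditioned in either order: [z] is standard and [x] has
    mean [c * z] given [z]; equivalently [x] has standard deviation [tau], and [z] has mean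
    [c * x / tau ^+ 2] given [x]. *)
Lemma normal_pdf_mul c t x z : (0 < t)%R -> let tau := Num.sqrt (c ^+ 2 + t ^+ 2) in
  (normal_pdf (c * z) t x * normal_pdf 0 1 z =
   normal_pdf 0 tau x * normal_pdf (c * x / tau ^+ 2) (t / tau) z)%R.
Proof.
move=> t0 tau.
have tau2 : (tau ^+ 2 = c ^+ 2 + t ^+ 2)%R by rewrite sqr_sqrtr// addr_ge0 ?sqr_ge0.
have tau0 : (0 < tau)%R by rewrite sqrtr_gt0 ltr_wpDl ?sqr_ge0// exprn_gt0.
rewrite !normal_pdf_expR ?divr_gt0//.
have := sqrt_2pi_gt0; set k := Num.sqrt _ => k0.
rewrite mulrACA [in RHS]mulrACA -!expRD; congr (_ * expR _)%R.
  field; rewrite !gt_eqF//.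
have tauK : (tau ^- 2 = (c ^+ 2 + t ^+ 2)^-1)%R by rewrite tau2.
rewrite exprMn exprVn tau2; field.
by rewrite -tau2 !gt_eqF// exprn_gt0.
Qed.

(** After Tonelli, [normal_pdf_mul] turns the inner integral over [z] into that of a Gaussian
    density, of total mass 1. The case [v = 0] is included because it starts the induction over the
    increments. *)
Lemma normal_convolution v a s h : (0 <= v)%R -> (0 < a)%R -> (0 < s)%R ->
  measurable_fun [set: R] h -> (forall y, 0 <= h y) ->
  \int[normal_prob 0 1]_z \int[normal_prob 0 s]_y h (Num.sqrt v * z + a * y)%R =
  \int[normal_prob 0 1]_z h (Num.sqrt (v + a ^+ 2 * s ^+ 2) * z)%R.
Proof.
move=> v0 a0 s0 mh h0.
have as0 : (0 < a * s)%R by exact: mulr_gt0.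
set c := Num.sqrt v.
have maff k l : measurable_fun [set: R] (fun z => k + l * z)%R.
  by apply: measurable_funD => //; exact: measurable_funM.
transitivity (\int[normal_prob 0 1]_z \int[normal_prob (c * z)%R (a * s)%R]_y h y).
  apply: eq_integral => z _.
  apply: esym; apply: (etrans (ge0_integral_normal_std (c * z) as0 mh h0)); apply: esym.
  apply: (etrans (@ge0_integral_normal_std 0 s (fun y => h (c * z + a * y)%R) s0 (measurableT_comp mh (maff _ _)) _)); first by [].
  by apply: eq_integral => y _; congr h; ring.
have mpdf2 : measurable_fun [set: R * R] (fun xz : R * R => normal_pdf (c * xz.1)%R (a * s)%R xz.2).
  rewrite (_ : (fun _ => _) = fun xz : R * R => (((a * s) * Num.sqrt (pi *+ 2))^-1 *
     expR (- ((xz.2 - c * xz.1) ^+ 2 / (2 * (a * s) ^+ 2))))%R); last first.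
    by apply/funext => xz; rewrite normal_pdf_expR.
  apply: measurable_funM => //; apply: measurableT_comp => //.
  apply: measurableT_comp => //; apply: measurable_funM => //.
  apply: measurable_funX; apply: measurable_funB => //.
  by apply: measurable_funM.
have mint : measurable_fun [set: R] (fun z => \int[mu]_y (h y * (normal_pdf (c * z) (a * s) y)%:E)).
  apply: (@measurable_fun_fubini_tonelli_F _ _ _ _ _ mu (fun xz : R * R => h xz.2 * (normal_pdf (c * xz.1) (a * s) xz.2)%:E)).
    apply: emeasurable_funM; first exact: (measurableT_comp mh).
    exact/measurable_EFinP.
  by move=> xz; rewrite mule_ge0// lee_fin normal_pdf_ge0.
under eq_integral do rewrite (ge0_integral_normal _ _ mh h0).
rewrite (ge0_integral_normal 0 1 mint); last first.
  by move=> z; apply: integral_ge0 => y _; rewrite mule_ge0// lee_fin normal_pdf_ge0.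
set tau := Num.sqrt (v + _).
have tauE : tau = Num.sqrt (c ^+ 2 + (a * s) ^+ 2) by rewrite /tau /c sqr_sqrtr// exprMn.
have tau0 : (0 < tau)%R by rewrite sqrtr_gt0 -exprMn ltr_wpDl// exprn_gt0.
transitivity (\int[mu]_z \int[mu]_y (h y * (normal_pdf 0 tau y)%:E *
   (normal_pdf (c * y / tau ^+ 2) (a * s / tau) z)%:E)).
  apply: eq_integral => z _; rewrite -ge0_integralZr.
  - apply: eq_integral => y _; rewrite -!muleA; congr (_ * _).
    by rewrite -!EFinM normal_pdf_mul// tauE.
  - by [].
  - apply: emeasurable_funM => //; apply/measurable_EFinP; exact: measurable_normal_pdf.
  - by move=> y _; rewrite mule_ge0// lee_fin normal_pdf_ge0.
  - by rewrite lee_fin normal_pdf_ge0.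
apply: (etrans (@fubini_tonelli _ _ _ _ _ mu mu (fun zy : R * R => h zy.2 * (normal_pdf 0 tau zy.2)%:E *
   (normal_pdf (c * zy.2 / tau ^+ 2) (a * s / tau) zy.1)%:E) _ _)).
- apply: emeasurable_funM; first apply: emeasurable_funM.
  + exact: (measurableT_comp mh).
  + apply/measurable_EFinP; apply: measurableT_comp => //; exact: measurable_normal_pdf.
  + apply/measurable_EFinP.
    rewrite (_ : (fun _ => _) = fun xz : R * R => (((a * s / tau) * Num.sqrt (pi *+ 2))^-1 *
     expR (- ((xz.1 - c * xz.2 / tau ^+ 2) ^+ 2 / (2 * (a * s / tau) ^+ 2))))%R); last first.
      by apply/funext => xz; rewrite normal_pdf_expR// divr_gt0.
    apply: measurable_funM => //; apply: measurableT_comp => //.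
    apply: measurableT_comp => //; apply: measurable_funM => //.
    apply: measurable_funX; apply: measurable_funB => //.
    by apply: measurable_funM => //; apply: measurable_funM.
- by move=> zy; rewrite !mule_ge0// lee_fin normal_pdf_ge0.
transitivity (\int[normal_prob 0 tau]_y h y); last first.
  rewrite (ge0_integral_normal_std 0 tau0 mh h0); apply: eq_integral => z _; by rewrite add0r.
rewrite (ge0_integral_normal 0 tau mh h0); apply: eq_integral => y _ /=.
rewrite ge0_integralZl//=.
- by rewrite integral_normal_pdf mule1.
- apply/measurable_EFinP; exact: measurable_normal_pdf.
- by move=> z _; rewrite lee_fin normal_pdf_ge0.
- by rewrite mule_ge0// lee_fin normal_pdf_ge0.
Qed.

End gaussian.

(** The exponential lies above its tangent at [a]. The error carries the weight [expR a] only, so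
    two densities written as exponentials are compared with an error proportional to one of them. *)
Lemma expR_le_add (R : realType) (a b : R) : expR a <= expR b + `|a - b| * expR a.
Proof.
have h : expR a * (1 + (b - a)) <= expR b.
  have -> : expR b = expR a * expR (b - a) by rewrite -expRD; congr expR; ring.
  by rewrite ler_wpM2l ?expR_ge0// expR_ge1Dx.
have : (a - b) * expR a <= `|a - b| * expR a by rewrite ler_wpM2r ?expR_ge0// ler_norm.
lra.
Qed.

Lemma ln_le_subr1 (R : realType) (x : R) : 0 < x -> ln x <= x - 1.
Proof. by move=> x0; have := expR_ge1Dx (ln x); rewrite lnK ?posrE//; lra. Qed.

Lemma ln_lipschitz (R : realType) (e x y : R) : 0 < e -> e <= x -> e <= y ->
  `|ln x - ln y| <= `|x - y| / e.
Proof.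
move=> e0.
wlog : x y / y <= x => [wl|yx] ex ey.
  have [/wl|/ltW xy] := leP y x; first exact.
  by rewrite distrC [X in _ <= X / _]distrC wl.
have y0 : 0 < y by lra.
have x0 : 0 < x by lra.
rewrite !ger0_norm ?subr_ge0 ?ler_ln ?posrE//.
rewrite -ln_div ?posrE//.
apply: le_trans (ln_le_subr1 _) _; first exact: divr_gt0.
have -> : x / y - 1 = (x - y) / y by field; lra.
by rewrite ler_wpM2l ?subr_ge0// lef_pV2.
Qed.

Section extended_primitive.
Local Open Scope ereal_scope.
Context {R : realType}.
Variable f : R -> R.

(** An extended-real version of F, meaningful before any growth of [f] is assumed; [primitiveE]
    later identifies it with [primitive]. *)
Definition iprimitive (y : R) : \bar R :=
  \int[@lebesgue_measure R]_(z in `]0%R, y]) (f z)%:E.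

(** Presents F as a partial integral of a jointly measurable function: Tonelli then gives the
    measurability of F and, later, the exchange of the integrals over log-returns and prices. *)
Definition iprimitive_kernel (yz : R * R) : R :=
  (f yz.2 * \1_(`]0%R, +oo[%classic : set R) yz.2 * (if (yz.2 <= yz.1)%R then 1 else 0))%R.

Lemma iprimitiveE y : iprimitive y = \int[@lebesgue_measure R]_z (iprimitive_kernel (y, z))%:E.
Proof.
rewrite /iprimitive integral_mkcond; apply: eq_integral => z _.
rewrite patchE /iprimitive_kernel/= indicE.
case: ifPn; rewrite ?notin_setE ?inE/= in_itv/=.
  by case/andP => z0 ze; rewrite ze mem_set ?mulr1//= in_itv/= z0.
case: (boolP (z \in _)); last by rewrite mulr0 !mul0r.
rewrite inE/= in_itv/= andbT => ->/= /negP/negbTE ->.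
by rewrite mulr0.
Qed.

Hypotheses (mf : measurable_fun [set: R] f) (f0 : forall x, (0 <= f x)%R).

Lemma iprimitive_ge0 y : 0 <= iprimitive y.
Proof. by apply: integral_ge0 => z _; rewrite lee_fin. Qed.

Lemma iprimitive_kernel_ge0 yz : (0 <= iprimitive_kernel yz)%R.
Proof. by rewrite /iprimitive_kernel !mulr_ge0//; case: ifP. Qed.

Lemma measurable_iprimitive_kernel : measurable_fun [set: R * R] iprimitive_kernel.
Proof.
apply: measurable_funM; first apply: measurable_funM.
- exact: measurableT_comp mf measurable_snd.
- by apply: measurableT_comp measurable_snd; exact: measurable_indic.
- by apply: measurable_fun_ifT => //; exact: measurable_fun_ler.
Qed.

Lemma measurable_iprimitive : measurable_fun [set: R] iprimitive.
Proof.
rewrite (_ : iprimitive = fubini_F (@lebesgue_measure R) (EFin \o iprimitive_kernel)); last first.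
  by apply/funext => y; exact: iprimitiveE.
apply: measurable_fun_fubini_tonelli_F => [|z]; last by rewrite lee_fin iprimitive_kernel_ge0.
by apply/measurable_EFinP; exact: measurable_iprimitive_kernel.
Qed.

End extended_primitive.

(** * Integration by parts against a Gaussian increment *)

Section gaussian_ibp.
Local Open Scope ereal_scope.
Context {R : realType}.
Notation mu := (@lebesgue_measure R).
Variables (r a s : R).
Hypotheses (a0 : (0 < a)%R) (s0 : (0 < s)%R).

(** At the log-price x = r + a y, [k] is e^{-x} times the weight y / a + s^2 times the Gaussian
    density. It changes sign only at [y0], and K' = -k, so [K] is the tail integral of [k]. *)
Let k (y : R) : R := (expR (- (r + a * y)) * (y / a + s ^+ 2) * normal_pdf 0 s y)%R.
Let K (y : R) : R := (s ^+ 2 / a * (expR (- (r + a * y)) * normal_pdf 0 s y))%R.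
Let y0 : R := (- (a * s ^+ 2))%R.

Let k_ge0 (y : R) : (y0 <= y)%R -> (0 <= k y)%R.
Proof.
move=> y0y; rewrite /k !mulr_ge0 ?expR_ge0 ?normal_pdf_ge0//.
have -> : (y / a + s ^+ 2 = (y - y0) / a)%R by rewrite /y0; field; rewrite gt_eqF.
by rewrite divr_ge0 ?subr_ge0// ltW.
Qed.

Let k_le0 (y : R) : (y <= y0)%R -> (k y <= 0)%R.
Proof.
move=> y0y; rewrite /k mulr_le0_ge0 ?normal_pdf_ge0// mulr_ge0_le0 ?expR_ge0//.
have -> : (y / a + s ^+ 2 = (y - y0) / a)%R by rewrite /y0; field; rewrite gt_eqF.
by rewrite mulr_le0_ge0 ?subr_le0// invr_ge0 ltW.
Qed.

Let NKE : (fun y => - K y)%R = (fun y : R => - (s ^+ 2 / a) *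
  ((s * Num.sqrt (pi *+ 2))^-1 * expR (- (r + a * y) - y ^+ 2 / (2 * s ^+ 2))))%R.
Proof.
apply/funext => y; rewrite /K normal_pdf_expR// subr0 expRD; ring.
Qed.

Let derive_K (y : R) : is_derive y 1%R (fun y : R => (- K y)%R : R) (k y).
Proof.
rewrite NKE; apply: is_derive_eq.
rewrite /k normal_pdf_expR// subr0 expRD /GRing.scale/=.
have := @sqrt_2pi_gt0 R => q0; field.
by rewrite !gt_eqF.
Qed.

Let continuous_k : continuous k.
Proof.
move=> y.
have -> : k = (fun y : R => expR (- (r + a * y)) * (y / a + s ^+ 2) *
  ((s * Num.sqrt (pi *+ 2))^-1 * expR (- (y ^+ 2 / (2 * s ^+ 2)))))%R.
  by apply/funext => z; rewrite /k normal_pdf_expR// subr0.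
apply/differentiable_continuous/derivable1_diffP; exact: ex_derive.
Qed.

Let cvg_NK : (- K y)%R @[y --> +oo%R] --> (0:R)%R.
Proof.
rewrite NKE.
have -> : (0 : R)%R = (- (s ^+ 2 / a) * ((s * Num.sqrt (pi *+ 2))^-1 * 0))%R by rewrite !mulr0.
apply: cvgM; first exact: cvg_cst.
apply: cvgM; first exact: cvg_cst.
have ea : (expR (- r) * expR (- (y * a)))%R @[y --> +oo%R] --> (0:R)%R.
  rewrite -[X in _ --> X](mulr0 (expR (- r))); apply: cvgM; first exact: cvg_cst.
  apply: (cvg_comp (fun y => y * a)%R (fun y => expR (- y))%R _ (@cvgr_expR R)).
  by apply/gt0_cvgMly.
apply: (squeeze_cvgr _ (cvg_cst (0:R)%R) ea).
near=> y; rewrite expR_ge0 -expRD ler_expR/= [(y * a)%R]mulrC opprD lerBlDr lerDl.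
by rewrite divr_ge0 ?sqr_ge0// mulr_ge0// sqr_ge0.
Unshelve. all: by end_near. Qed.

Let cvg_K (y : R) : (- K z)%R @[z --> y] --> (- K y)%R.
Proof.
have h := @ex_derive _ _ _ _ _ _ _ (derive_K y).
by move/derivable1_diffP/differentiable_continuous : h.
Qed.

Let derive_K' (y : R) : is_derive y 1%R (K : R -> R) (- k y)%R.
Proof.
rewrite (_ : K = (fun y : R => - (- K y))%R); last by apply/funext => z; rewrite opprK.
exact: (is_deriveN (derive_K y)).
Qed.

Let cvg_K' (y : R) : K z @[z --> y] --> K y.
Proof.
have h := @ex_derive _ _ _ _ _ _ _ (derive_K' y).
by move/derivable1_diffP/differentiable_continuous : h.
Qed.

(** The tail identity for [k], with its negative part moved to the other side. The fundamental
    theorem of calculus on a half-line is applied from [y0] on, where [k >= 0]; what lies between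
    [eta] and [y0] is a bounded interval on which [k <= 0]. *)
Lemma integral_k_tail (eta : R) :
  \int[mu]_(y in `[eta, +oo[) (Num.max (k y) 0)%:E =
  \int[mu]_(y in `[eta, +oo[) (Num.max (- k y) 0)%:E + (K eta)%:E.
Proof.
have tail (x : R) : (y0 <= x)%R -> \int[mu]_(y in `[x, +oo[) (k y)%:E = (K x)%:E.
  move=> y0x; rewrite (@ge0_continuous_FTC2y _ k (fun y => - K y)%R x 0%R).
  - by rewrite sub0e -EFinN opprK.
  - by move=> y xy; apply: k_ge0; lra.
  - by apply: continuous_subspaceT; exact: continuous_k.
  - exact: cvg_NK.
  - by move=> y _; exact: (@ex_derive _ _ _ _ _ _ _ (derive_K y)).
  - by apply: cvg_at_right_filter; exact: cvg_K.
  - by move=> y _; rewrite derive1E (@derive_val _ _ _ _ _ _ _ (derive_K y)).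
have [eta0|eta0] := leP y0 eta.
  rewrite -(tail _ eta0) [X in _ = X + _]integral0_eq ?add0e.
    apply: eq_integral => y; rewrite inE/= in_itv/= andbT => ey.
    by rewrite max_l// k_ge0//; lra.
  move=> y/=; rewrite in_itv/= andbT => ey.
  by rewrite max_r// oppr_le0 k_ge0//; lra.
transitivity (\int[mu]_(y in `[y0, +oo[) (k y)%:E).
  rewrite integral_mkcond [RHS]integral_mkcond; apply: eq_integral => y _.
  rewrite !patchE; case: ifPn; case: ifPn; rewrite ?notin_setE ?inE/= !in_itv/= ?andbT//.
  - by move=> y0y _; rewrite max_l// k_ge0.
  - by move=> /negP; rewrite -ltNge => y0y _; rewrite max_r// k_le0// ltW.
  - by move=> y0y /negP; rewrite -ltNge => ?; exfalso; lra.
rewrite tail//.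
transitivity (\int[mu]_(y in `[eta, y0]) (- k y)%:E + (K eta)%:E).
  rewrite (@continuous_FTC2 _ (fun y => - k y)%R (fun y => K y)%R eta y0)//.
  - by rewrite subeK.
  - apply: continuous_subspaceT => y; apply: cvgN; exact: continuous_k.
  - split.
    + by move=> y _; have := @ex_derive _ _ _ _ _ _ _ (derive_K' y).
    + by apply: cvg_at_right_filter; exact: cvg_K'.
    + by apply: cvg_at_left_filter; exact: cvg_K'.
  - by move=> y _; rewrite derive1E (@derive_val _ _ _ _ _ _ _ (derive_K' y)).
congr (_ + _).
rewrite integral_mkcond [RHS]integral_mkcond; apply: eq_integral => y _.
rewrite !patchE; case: ifPn; case: ifPn; rewrite ?notin_setE ?inE/= !in_itv/= ?andbT//.
- by move=> ? /andP[_ yy0]; rewrite max_l// oppr_ge0 k_le0.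
- by move=> ney /andP[? _]; exfalso; apply: ney.
- move=> ey /negP; rewrite ey/= -ltNge => yy0; rewrite max_r// oppr_le0 k_ge0//; exact: ltW.
Qed.

Variable f : R -> R.
Hypotheses (mf : measurable_fun [set: R] f) (f0 : forall x, (0 <= f x)%R).

Let F := iprimitive f.

Let g (yz : R * R) : R := iprimitive_kernel f (expR (r + a * yz.1), yz.2).

Let mexp1 : measurable_fun [set: R] (fun y => expR (r + a * y))%R.
Proof.
by apply: measurableT_comp => //; apply: measurable_funD => //; exact: measurable_funM.
Qed.

Let mg : measurable_fun [set: R * R] g.
Proof.
apply: measurableT_comp (measurable_iprimitive_kernel mf) _.
apply: measurable_fun_pair; last exact: measurable_snd.
exact: measurableT_comp mexp1 measurable_fst.
Qed.

Let g0 yz : (0 <= g yz)%R. Proof. exact: iprimitive_kernel_ge0. Qed.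

Let FE y : F (expR (r + a * y)) = \int[mu]_z (g (y, z))%:E.
Proof. exact: iprimitiveE. Qed.

Let mF : measurable_fun [set: R] (fun y => F (expR (r + a * y))).
Proof. exact: measurableT_comp (measurable_iprimitive mf f0) mexp1. Qed.

Let F0 y : 0 <= F y.
Proof. exact: iprimitive_ge0. Qed.

Let slice (l : R -> R) z : measurable_fun [set: R] l -> (forall y, (0 <= l y)%R) ->
  (0 < z)%R ->
  \int[mu]_y (g (y, z) * l y)%:E =
  (f z)%:E * \int[mu]_(y in `[((ln z - r) / a)%R, +oo[) (l y)%:E.
Proof.
move=> ml l0 z0; rewrite -ge0_integralZl.
- rewrite [RHS]integral_mkcond; apply: eq_integral => y _; rewrite /g/iprimitive_kernel/= indicE mem_set ?mulr1/=; last by rewrite in_itv/= z0.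
  rewrite patchE.
  have -> : (y \in `[((ln z - r) / a)%R, +oo[%classic) = (z <= expR (r + a * y))%R.
    rewrite mem_setE/= in_itv/= andbT ler_pdivrMr// -[in RHS](@lnK _ z) ?posrE// ler_expR.
    by rewrite [(y * _)%R]mulrC lerBlDl.
  by case: ifP; rewrite ?mulr1 ?mulr0 ?mul0r ?EFinM.
- exact: measurable_itv.
- by apply: measurable_funTS; exact/measurable_EFinP.
- by move=> y _; rewrite lee_fin.
- by rewrite lee_fin.
Qed.

Let mgl (l : R -> R) : measurable_fun [set: R] l ->
  measurable_fun [set: R * R] (fun yz : R * R => (g yz * l yz.1)%:E).
Proof.
move=> ml; apply/measurable_EFinP; apply: measurable_funM => //; exact: measurableT_comp.
Qed.

(** F(e^{r + a y}) integrates f(z) over z <= e^{r + a y}; read in the other order, f(z) is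
    multiplied by the tail of [l] beyond (ln z - r) / a. All differentiation thus falls on the
    Gaussian tail, and none on F. *)
Let swap (l : R -> R) : measurable_fun [set: R] l -> (forall y, (0 <= l y)%R) ->
  measurable_fun (`]0%R, +oo[%classic : set R)
    (fun z => (f z)%:E * \int[mu]_(y in `[((ln z - r) / a)%R, +oo[) (l y)%:E) /\
  \int[mu]_y (F (expR (r + a * y)) * (l y)%:E) =
  \int[mu]_(z in `]0%R, +oo[) ((f z)%:E * \int[mu]_(y in `[((ln z - r) / a)%R, +oo[) (l y)%:E).
Proof.
move=> ml l0; split.
  apply: (eq_measurable_fun (fun z => \int[mu]_y (g (y, z) * l y)%:E)).
    by move=> z; rewrite inE/= in_itv/= andbT => z0; rewrite slice.
  apply: measurable_funTS.
  apply: (@measurable_fun_fubini_tonelli_G _ _ _ _ _ mu (fun yz : R * R => (g yz * l yz.1)%:E)).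
    exact: mgl.
  by move=> yz; rewrite lee_fin mulr_ge0.
transitivity (\int[mu]_y \int[mu]_z (g (y, z) * l y)%:E).
  apply: eq_integral => y _; rewrite FE -ge0_integralZr.
  - by apply: eq_integral => z _; rewrite EFinM.
  - by [].
  - apply/measurable_EFinP; apply: measurableT_comp => //.
  - by move=> z _; rewrite lee_fin.
  - by rewrite lee_fin.
apply: (etrans (@fubini_tonelli _ _ _ _ _ mu mu (fun yz => (g yz * l yz.1)%:E) (mgl ml) _)).
  by move=> yz; rewrite lee_fin mulr_ge0.
rewrite [RHS]integral_mkcond; apply: eq_integral => z _; rewrite patchE.
case: ifPn; rewrite ?notin_setE ?inE/= in_itv/= andbT => z0; first exact: slice.
rewrite integral0_eq// => y _; rewrite /g/iprimitive_kernel/= indicE memNset ?mulr0 ?mul0r//=.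
by rewrite in_itv/= andbT.
Qed.

Let mk : measurable_fun [set: R] k.
Proof. exact: continuous_measurable_fun. Qed.

(* The weight [y / a + s ^+ 2] changes sign; splitting it into its positive and
   negative parts gives an identity between nonnegative integrals, valid without
   any integrability assumption. *)
Lemma gaussian_ibp :
  \int[normal_prob 0 s]_y (F (expR (r + a * y)) *
     (expR (- (r + a * y)) * Num.max (y / a + s ^+ 2) 0)%:E) =
  \int[normal_prob 0 s]_y (F (expR (r + a * y)) *
     (expR (- (r + a * y)) * Num.max (- (y / a + s ^+ 2)) 0)%:E) +
  (s ^+ 2)%:E * \int[normal_prob 0 s]_y (f (expR (r + a * y)))%:E.
Proof.
have mexpN : measurable_fun [set: R] (fun y => expR (- (r + a * y)))%R.
  apply: measurableT_comp => //; apply: measurableT_comp => //.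
  by apply: measurable_funD => //; exact: measurable_funM.
have mlin : measurable_fun [set: R] (fun y => y / a + s ^+ 2)%R.
  by apply: measurable_funD => //; exact: measurable_funM.
have convert (u : R -> R) : measurable_fun [set: R] u ->
    \int[normal_prob 0 s]_y (F (expR (r + a * y)) * (expR (- (r + a * y)) * Num.max (u y) 0)%:E) =
    \int[mu]_y (F (expR (r + a * y)) *
      (Num.max (expR (- (r + a * y)) * u y * normal_pdf 0 s y) 0)%:E).
  move=> mu_; apply: (etrans (@ge0_integral_normal _ 0 s (fun y =>
    F (expR (r + a * y)) * (expR (- (r + a * y)) * Num.max (u y) 0)%:E) _ _)).
  - apply: emeasurable_funM => //; apply/measurable_EFinP; apply: measurable_funM => //.
    exact: measurable_maxr.
  - by move=> y; rewrite mule_ge0// lee_fin mulr_ge0 ?expR_ge0// le_max lexx orbT.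
  apply: eq_integral => y _; rewrite -muleA; congr (_ * _); rewrite -EFinM; congr (_%:E).
  by rewrite maxr_pMr ?expR_ge0// maxr_pMl ?normal_pdf_ge0// !mulr0 mul0r.
rewrite (convert (fun y => y / a + s ^+ 2)%R mlin).
rewrite (convert (fun y => - (y / a + s ^+ 2))%R (measurableT_comp (@oppr_measurable _ _) mlin)).
have kE : (fun y => F (expR (r + a * y)) * (Num.max (expR (- (r + a * y)) * - (y / a + s ^+ 2) * normal_pdf 0 s y) 0)%:E) =
   (fun y => F (expR (r + a * y)) * (Num.max (- k y) 0)%:E).
  by apply/funext => y; rewrite mulrN mulNr.
rewrite kE.
have mpos : measurable_fun [set: R] (fun y => Num.max (k y) 0%R) by exact: measurable_maxr.
have mneg : measurable_fun [set: R] (fun y => Num.max (- k y)%R 0%R).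
  by apply: measurable_maxr => //; exact: measurableT_comp.
have pos0 (u : R -> R) y : (0 <= Num.max (u y) 0)%R by rewrite le_max lexx orbT.
have [_ ->] := swap mpos (pos0 k).
have [mI ->] := swap mneg (pos0 (fun y => - k y)%R).
have K0 y : (0 <= K y)%R.
  by rewrite /K !mulr_ge0 ?expR_ge0 ?normal_pdf_ge0 ?invr_ge0 ?(ltW a0) ?(ltW s0).
have mK : measurable_fun [set: R] K.
  apply: measurable_funM => //; apply: measurable_funM => //; exact: measurable_normal_pdf.
transitivity (\int[mu]_(z in `]0%R, +oo[) ((f z)%:E *
    (\int[mu]_(y in `[((ln z - r) / a)%R, +oo[) (Num.max (- k y) 0)%:E) +
    (f z)%:E * (K ((ln z - r) / a)%R)%:E)).
  apply: eq_integral => z _; rewrite integral_k_tail ge0_muleDr//.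
    by apply: integral_ge0 => y _; rewrite lee_fin.
  by rewrite lee_fin.
rewrite ge0_integralD; last 5 first.
- exact: measurable_itv.
- move=> z _; rewrite mule_ge0 ?lee_fin//.
  by apply: integral_ge0 => y _; rewrite lee_fin.
- exact: mI.
- by move=> z _; rewrite mule_ge0 ?lee_fin.
- apply: measurable_funTS; apply: emeasurable_funM; apply/measurable_EFinP => //.
  apply: measurableT_comp => //; apply: measurable_funM => //.
  by apply: measurable_funB => //; exact: measurable_ln.
congr (_ + _); apply: esym.
have mfe : measurable_fun [set: R] (fun y => (f (expR (r + a * y)))%:E).
  by apply/measurable_EFinP; exact: measurableT_comp.
rewrite (ge0_integral_normal 0 s mfe); last by move=> y; rewrite lee_fin.
rewrite (ge0_integral_log r a0); last 2 first.
- apply: emeasurable_funM => //; apply/measurable_EFinP; exact: measurable_normal_pdf.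
- by move=> y; rewrite mule_ge0// lee_fin// normal_pdf_ge0.
have minv := measurable_inv_itv a0.
rewrite -ge0_integralZl; last 4 first.
- exact: measurable_itv.
- apply: emeasurable_funM; last exact/measurable_EFinP.
  have mln : measurable_fun [set: R] (fun z : R => (ln z - r) / a)%R.
    by apply: measurable_funM => //; apply: measurable_funB => //; exact: measurable_ln.
  apply: measurable_funTS; apply: emeasurable_funM; first exact: (measurableT_comp mfe mln).
  apply/measurable_EFinP; apply: measurableT_comp => //; exact: measurable_normal_pdf.
- move=> z; rewrite /= in_itv/= andbT => z0; rewrite !mule_ge0// lee_fin// ?normal_pdf_ge0//.
  by rewrite invr_ge0 mulr_ge0// ltW.
- by rewrite lee_fin sqr_ge0.
apply: eq_integral => z; rewrite inE/= in_itv/= andbT => z0.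
have -> : (r + a * ((ln z - r) / a) = ln z)%R by field; rewrite gt_eqF.
rewrite lnK ?posrE// muleCA -!muleA; congr (_ * _); rewrite -!EFinM; congr (_%:E).
(* At this boundary point e^{-(r + a y)} = 1 / z, so [K] contains exactly the Jacobian 1 / (a z) of
   the substitution z = e^{r + a y}. *)
have -> : K ((ln z - r) / a)%R = (s ^+ 2 / a * (z^-1 * normal_pdf 0 s ((ln z - r) / a)))%R.
  rewrite /K; congr (_ * (_ * _))%R; rewrite expRN; congr (_^-1)%R.
  by rewrite -[RHS]lnK ?posrE//; congr expR; field; rewrite gt_eqF.
by field; rewrite !gt_eqF.
Qed.
End gaussian_ibp.

(** * Regularity in the total variance *)

Section gaussian_smoothing.
Local Open Scope ereal_scope.
Context {R : realType}.
Notation mu := (@lebesgue_measure R).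

(* E h(m - v/2 + sqrt v N(0, 1)): the expectation of [h] at the log-price, given
   the total variance [v]. *)
Definition smoothing (m : R) (h : R -> R) (v : R) : \bar R :=
  \int[normal_prob 0 1]_z (h (m - v / 2 + Num.sqrt v * z))%:E.

(** The term in |x - m| is bounded by the sum over both signs, and each sign is a shifted Gaussian
    density after completing the square: this gives d^2 / 2. The additional 1 in the exponent pays
    for the normalization, through sqrt M <= e^M. *)
Lemma ge0_integral_exp_quad (m d M : R) : (0 < M)%R ->
  \int[mu]_x (expR (d * `|x - m| - (x - m) ^+ 2 / (2 * M)))%:E <=
  (2 * Num.sqrt (pi *+ 2) * expR ((d ^+ 2 / 2 + 1) * M))%:E.
Proof.
move=> M0; have k0 := @sqrt_2pi_gt0 R; set k := Num.sqrt (pi *+ 2) in k0 *.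
have sM0 : (0 < Num.sqrt M)%R by rewrite sqrtr_gt0.
have sM2 : (Num.sqrt M ^+ 2 = M)%R by rewrite sqr_sqrtr// ltW.
have pdfE e x : (expR (e * (x - m) - (x - m) ^+ 2 / (2 * M)) =
    Num.sqrt M * k * expR (e ^+ 2 / 2 * M) * normal_pdf (m + e * M) (Num.sqrt M) x)%R.
  rewrite normal_pdf_expR// -/k mulrACA mulfV ?gt_eqF ?mulr_gt0// mul1r -expRD sM2; congr expR.
  by field; rewrite gt_eqF.
have mq e : measurable_fun [set: R] (fun x : R =>
   (Num.sqrt M * k * expR (e ^+ 2 / 2 * M) * normal_pdf (m + e * M) (Num.sqrt M) x)%:E).
  apply/measurable_EFinP; apply: measurable_funM => //; exact: measurable_normal_pdf.
have q0 e x : 0 <= (Num.sqrt M * k * expR (e ^+ 2 / 2 * M) * normal_pdf (m + e * M) (Num.sqrt M) x)%:E.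
  by rewrite lee_fin mulr_ge0 ?normal_pdf_ge0// !mulr_ge0 ?expR_ge0// ltW.
apply: (@le_trans _ _ (\int[mu]_x (
   (Num.sqrt M * k * expR (d ^+ 2 / 2 * M) * normal_pdf (m + d * M) (Num.sqrt M) x)%:E +
   (Num.sqrt M * k * expR ((- d) ^+ 2 / 2 * M) * normal_pdf (m + - d * M) (Num.sqrt M) x)%:E))).
  apply: ge0_le_integral.
  - by [].
  - by move=> x _; rewrite lee_fin expR_ge0.
  - apply/measurable_EFinP; apply: measurableT_comp => //; apply: measurable_funB.
      apply: measurable_funM => //; apply: measurableT_comp => //; exact: measurable_funB.
    by apply: measurable_funM => //; apply: measurable_funX; exact: measurable_funB.
  - by apply: emeasurable_funD; exact: mq.
  move=> x _; rewrite -EFinD lee_fin -!pdfE.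
  have [xm|xm] := leP 0%R (x - m)%R.
    by rewrite ger0_norm// lerDl expR_ge0.
  by rewrite ltr0_norm// mulrN -mulNr lerDr expR_ge0.
rewrite ge0_integralD//; [|exact: mq|exact: mq].
have intq e : \int[mu]_x (Num.sqrt M * k * expR (e ^+ 2 / 2 * M) * normal_pdf (m + e * M) (Num.sqrt M) x)%:E =
   (Num.sqrt M * k * expR (e ^+ 2 / 2 * M))%:E.
  under eq_integral do rewrite EFinM.
  rewrite ge0_integralZl.
  - by rewrite integral_normal_pdf mule1.
  - by [].
  - apply/measurable_EFinP; exact: measurable_normal_pdf.
  - by move=> x _; rewrite lee_fin normal_pdf_ge0.
  - by rewrite lee_fin !mulr_ge0 ?expR_ge0// ltW.
rewrite !intq -EFinD lee_fin sqrrN.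
have -> : ((d ^+ 2 / 2 + 1) * M = d ^+ 2 / 2 * M + M)%R by ring.
rewrite expRD.
have sM : (Num.sqrt M <= expR M)%R.
  have := expR_ge1Dx M; have : (Num.sqrt M <= 1 + M)%R; last lra.
  have := sqr_ge0 (Num.sqrt M - 1)%R; rewrite sqrrB sM2 expr1n mulr1; lra.
have kE : (0 <= k * expR (d ^+ 2 / 2 * M))%R by rewrite mulr_ge0 ?expR_ge0// ltW.
by have := ler_wpM2r kE sM; lra.
Qed.

(** The density of N(m - v/2, v) with all dependence on [v], including the factor 1 / sqrt v, in a
    single exponent, so that varying [v] means varying that exponent. *)
Let q (m v x : R) : R := ((Num.sqrt (pi *+ 2))^-1 *
  expR (- (ln v / 2) - (x - m) ^+ 2 / (2 * v) - (x - m) / 2 - v / 8))%R.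

Let sqrt_expR (v : R) : (0 < v)%R -> Num.sqrt v = expR (ln v / 2).
Proof.
move=> v0; rewrite -{1}(@lnK _ v) ?posrE//.
have -> : expR (ln v) = (expR (ln v / 2) ^+ 2)%R.
  by rewrite -expRM_natl; congr expR; field.
by rewrite sqrtr_sqr ger0_norm ?expR_ge0.
Qed.

Let normal_pdfq m v x : (0 < v)%R -> normal_pdf (m - v / 2)%R (Num.sqrt v) x = q m v x.
Proof.
move=> v0; have sv0 : (0 < Num.sqrt v)%R by rewrite sqrtr_gt0.
rewrite normal_pdf_expR// invfM sqr_sqrtr ?ltW// sqrt_expR// -expRN.
rewrite /q [(expR _ * _)%R]mulrC -mulrA -expRD; congr (_ * expR _)%R.
by field; rewrite gt_eqF.
Qed.

Let mq m v : measurable_fun [set: R] (q m v).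
Proof.
apply: measurable_funM => //; apply: measurableT_comp => //.
apply: measurable_funB => //; apply: measurable_funB; last first.
  by apply: measurable_funM => //; exact: measurable_funB.
apply: measurable_funB => //; apply: measurable_funM => //.
by apply: measurable_funX; exact: measurable_funB.
Qed.

Let q_ge0 m v x : (0 <= q m v x)%R.
Proof. by rewrite mulr_ge0 ?expR_ge0// invr_ge0. Qed.

Lemma smoothing_density (m : R) (h : R -> R) (v : R) : (0 < v)%R -> measurable_fun [set: R] h ->
  (forall x, (0 <= h x)%R) ->
  smoothing m h v = \int[mu]_x (h x * q m v x)%:E.
Proof.
move=> v0 mh h0; rewrite /smoothing.
have sv0 : (0 < Num.sqrt v)%R by rewrite sqrtr_gt0.
have mh' : measurable_fun [set: R] (fun x => (h x)%:E) by exact/measurable_EFinP.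
apply: (etrans (esym (ge0_integral_normal_std (m - v / 2)%R sv0 mh' _))).
  by move=> x; rewrite lee_fin.
apply: (etrans (ge0_integral_normal (m - v / 2)%R (Num.sqrt v) mh' _)).
  by move=> x; rewrite lee_fin.
by apply: eq_integral => x _; rewrite normal_pdfq// EFinM.
Qed.

(** The variation in [v] falls on the density, whose exponent is Lipschitz on [v0, +oo[ with a
    constant of order e^{|x - m|}. The function [h] enters through its envelope alone, so [L] and
    [c'] are chosen before it. *)
Lemma smoothing_lipschitz (m A c v0 : R) : (0 < v0)%R -> (0 <= A)%R -> (0 <= c)%R ->
  exists L c' : R, [/\ (0 <= L)%R, (0 <= c')%R & forall h : R -> R,
    measurable_fun [set: R] h ->
    (forall x, (0 <= h x <= A * expR (c * `|x - m|))%R) ->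
    (forall v, (v0 <= v)%R -> smoothing m h v <= (L * expR (c' * v))%:E) /\
    (forall v v', (v0 <= v)%R -> (v0 <= v')%R ->
      smoothing m h v <= smoothing m h v' + (L * `|v - v'| * expR (c' * v))%:E)].
Proof.
move=> v00 A0 c0; set k : R := Num.sqrt (pi *+ 2).
have k0 : (0 < k)%R := @sqrt_2pi_gt0 R.
(* In [d], c is the growth of [h], 1/2 comes from the term (x - m) / 2 of the density, and 1 is kept
   in reserve for the Lipschitz constant of order e^{|x - m|}. [c'] is the exponent given by
   [ge0_integral_exp_quad]. *)
pose d : R := (c + 3 / 2)%R; pose c' : R := (d ^+ 2 / 2 + 1)%R.
pose K2 : R := (k^-1 * expR (- (ln v0 / 2)))%R.
(* The Lipschitz constants on [v0, +oo[ of ln v / 2, 1 / (2 v) and v / 8, the [v]-dependent terms of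
   the exponent. The 2 in front of [K1] below comes from (x - m)^2 <= 2 e^{|x - m|}. *)
pose K1 : R := ((2 * v0)^-1 + (2 * v0 ^+ 2)^-1 + 1 / 8)%R.
have K20 : (0 <= K2)%R by rewrite mulr_ge0 ?expR_ge0// invr_ge0 ltW.
have i1 : (0 <= (2 * v0)^-1)%R by rewrite invr_ge0 mulr_ge0// ltW.
have i2 : (0 <= (2 * v0 ^+ 2)^-1)%R by rewrite invr_ge0 mulr_ge0// sqr_ge0.
have K10 : (0 <= K1)%R by rewrite /K1; lra.
pose L : R := ((1 + 2 * K1) * A * K2 * (2 * k))%R.
have X0 : (0 <= A * K2 * (2 * k))%R.
  by apply: mulr_ge0; [exact: mulr_ge0|apply: mulr_ge0 => //; exact: ltW].
have KX0 : (0 <= K1 * (A * K2 * (2 * k)))%R by exact: mulr_ge0.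
have L1 : (A * K2 * (2 * k) <= L)%R by rewrite /L; lra.
have L2 : (2 * K1 * A * K2 * (2 * k) <= L)%R by rewrite /L; lra.
exists L, c'; split.
- by lra.
- by rewrite /c'; have := sqr_ge0 d; lra.
move=> h mh hb.
have h0 x : (0 <= h x)%R by have /andP[] := hb x.
pose e (v x : R) : R := expR (d * `|x - m| - (x - m) ^+ 2 / (2 * v))%R.
have me v : measurable_fun [set: R] (e v).
  apply: measurableT_comp => //; apply: measurable_funB.
    apply: measurable_funM => //; apply: measurableT_comp => //; exact: measurable_funB.
  by apply: measurable_funM => //; apply: measurable_funX; exact: measurable_funB.
have mhq v : measurable_fun [set: R] (fun x => (h x * q m v x)%:E).
  by apply/measurable_EFinP; apply: measurable_funM; [exact: mh|exact: mq].
have mCe C v : measurable_fun [set: R] (fun x => (C * e v x)%:E).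
  by apply/measurable_EFinP; apply: measurable_funM => //; exact: me.
have inte C v : (0 <= C)%R -> (v0 <= v)%R ->
    \int[mu]_x (C * e v x)%:E <= (C * (2 * k) * expR (c' * v))%:E.
  move=> C0 v0v; under eq_integral do rewrite EFinM.
  rewrite ge0_integralZl//; last 2 first.
  - by apply/measurable_EFinP; exact: me.
  - by move=> x _; rewrite lee_fin expR_ge0.
  rewrite -mulrA EFinM; apply: lee_wpmul2l; first by rewrite lee_fin.
  by apply: ge0_integral_exp_quad; lra.
(* The spare factor e^{-|x - m|} cancels the e^{|x - m|} of [ll] below; in the growth bound it is
   estimated by 1. *)
have hq v x : (v0 <= v)%R -> (h x * q m v x <= A * K2 * expR (- (1 * `|x - m|)) * e v x)%R.
  move=> v0v; have /andP[_ hx] := hb x.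
  have qx : (q m v x <= K2 * expR (`|x - m| / 2 - (x - m) ^+ 2 / (2 * v)))%R.
    rewrite /q /K2 -[leRHS]mulrA -[in leRHS]expRD ler_wpM2l ?invr_ge0 ?(ltW k0)// ler_expR.
    have : (ln v0 <= ln v)%R by rewrite ler_ln ?posrE//; lra.
    have : (- (x - m) <= `|x - m|)%R by rewrite -normrN ler_norm.
    by lra.
  apply: (@le_trans _ _ ((A * expR (c * `|x - m|)) * (K2 * expR (`|x - m| / 2 - (x - m) ^+ 2 / (2 * v))))%R).
    by apply: ler_pM.
  rewrite mulrACA -[leRHS]mulrA; apply: ler_wpM2l; first exact: mulr_ge0.
  rewrite /e -!expRD ler_expR /d; lra.
split.
  move=> v v0v; rewrite smoothing_density//; last lra.
  apply: (@le_trans _ _ (\int[mu]_x (A * K2 * e v x)%:E)).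
    apply: ge0_le_integral.
    - by [].
    - by move=> x _; rewrite lee_fin mulr_ge0.
    - exact: mhq.
    - exact: mCe.
    move=> x _; rewrite lee_fin; apply: le_trans (hq v x v0v) _.
    apply: ler_wpM2r; first exact: expR_ge0.
    apply: ler_piMr; first exact: mulr_ge0.
    by rewrite expR_le1 mul1r oppr_le0; exact: normr_ge0.
  apply: le_trans (inte _ _ _ v0v) _; first exact: mulr_ge0.
  by rewrite lee_fin ler_wpM2r ?expR_ge0.
move=> v v' v0v v0v'.
rewrite smoothing_density//; last lra.
rewrite smoothing_density//; last lra.
apply: (@le_trans _ _ (\int[mu]_x ((h x * q m v' x)%:E + (2 * K1 * A * K2 * `|v - v'| * e v x)%:E))).
  apply: ge0_le_integral.
  - by [].
  - by move=> x _; rewrite lee_fin mulr_ge0.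
  - exact: mhq.
  - by apply: emeasurable_funD; [exact: mhq|exact: mCe].
  move=> x _; rewrite -EFinD lee_fin.
  set l := (fun u : R => - (ln u / 2) - (x - m) ^+ 2 / (2 * u) - (x - m) / 2 - u / 8)%R.
  have vv' : (v > 0 /\ v' > 0)%R by split; lra.
  have ll : (`|l v - l v'| <= `|v - v'| * (2 * K1 * expR `|x - m|))%R.
    have -> : (l v - l v' = - ((ln v - ln v') / 2) + (v - v') * ((x - m) ^+ 2 / (2 * (v * v'))) - (v - v') / 8)%R.
      by rewrite /l; field; rewrite !gt_eqF//; lra.
    have a1 := ln_lipschitz v00 v0v v0v'.
    have a2 : (`|(v - v') * ((x - m) ^+ 2 / (2 * (v * v')))| <= `|v - v'| * ((x - m) ^+ 2 / (2 * v0 ^+ 2)))%R.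
      rewrite normrM ler_wpM2l// ger0_norm; last by rewrite divr_ge0 ?sqr_ge0// !mulr_ge0//; lra.
      rewrite ler_wpM2l ?sqr_ge0// lef_pV2 ?posrE ?mulr_gt0 ?exprn_gt0//; try lra.
      by rewrite ler_wpM2l// expr2; apply: ler_pM => //; lra.
    have a3 : (1 + `|x - m| ^+ 2 / 2 <= expR `|x - m|)%R by have := expR_ge1Dxn 1 (normr_ge0 (x - m)%R).
    have b1 := ler_normD (- ((ln v - ln v') / 2) + (v - v') * ((x - m) ^+ 2 / (2 * (v * v'))))%R (- ((v - v') / 8))%R.
    have b2 := ler_normD (- ((ln v - ln v') / 2))%R ((v - v') * ((x - m) ^+ 2 / (2 * (v * v'))))%R.
    rewrite !normrN in b1 b2.
    have n2 : (`|(ln v - ln v') / 2| = `|ln v - ln v'| / 2)%R by rewrite normrM [(`|2^-1|)%R]ger0_norm.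
    have n8 : (`|(v - v') / 8| = `|v - v'| / 8)%R by rewrite normrM [(`|8^-1|)%R]ger0_norm.
    rewrite n2 in b2; rewrite n8 in b1.
    rewrite real_normK ?num_real// in a3.
    have d0 := normr_ge0 (v - v')%R.
    apply: (@le_trans _ _ (`|v - v'| * ((2 * v0)^-1 + (x - m) ^+ 2 * (2 * v0 ^+ 2)^-1 + 1 / 8))%R).
      have -> : ((2 * v0)^-1 = v0^-1 / 2)%R by rewrite invfM mulrC.
      by lra.
    rewrite ler_wpM2l// /K1.
    have := ler_wpM2r i1 a3; have := ler_wpM2r i2 a3.
    have := mulr_ge0 (sqr_ge0 (x - m)%R) i1.
    have := mulr_ge0 (sqr_ge0 (x - m)%R) i2.
    have := sqr_ge0 (x - m)%R.
    by lra.
  have qq : (q m v x <= q m v' x + `|v - v'| * (2 * K1 * expR `|x - m|) * q m v x)%R.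
    have := expR_le_add (l v) (l v'); rewrite -(@ler_pM2l _ k^-1) ?invr_gt0//.
    move=> /le_trans; apply; rewrite /q -/(l v) -/(l v') mulrDr lerD2l.
    rewrite mulrCA ler_wpM2r// mulr_ge0 ?expR_ge0// invr_ge0; exact: ltW.
  apply: le_trans (ler_wpM2l (h0 x) qq) _.
  rewrite mulrDr lerD2l mulrCA.
  apply: le_trans (ler_wpM2l _ (hq v x v0v)) _.
    by rewrite !mulr_ge0// expR_ge0.
  rewrite mul1r expRN le_eqVlt; apply/orP; left; apply/eqP.
  by field; rewrite gt_eqF// expR_gt0.
have K1p : (0 <= 2 * K1 * A * K2 * `|v - v'|)%R.
  apply: mulr_ge0; last exact: normr_ge0.
  by apply: mulr_ge0 => //; apply: mulr_ge0 => //; apply: mulr_ge0.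
rewrite ge0_integralD.
- rewrite leeD2l//; apply: le_trans (inte _ _ K1p v0v) _. rewrite lee_fin; apply: ler_wpM2r; first exact: expR_ge0.
  have := ler_wpM2r (normr_ge0 (v - v')%R) L2; lra.
- by [].
- by move=> x _; rewrite lee_fin mulr_ge0.
- exact: mhq.
- by move=> x _; rewrite lee_fin; apply: mulr_ge0; [exact: K1p|exact: expR_ge0].
- exact: mCe.
Qed.

End gaussian_smoothing.

(** * Square-exponential moments of fractional Brownian increments *)

Section normal_quad.
Local Open Scope ereal_scope.
Context {R : realType}.
Notation mu := (@lebesgue_measure R).
Implicit Types (m s l y K : R).

(** Completing the square divides the variance by [D]. Both signs of [l] occur later: [l > 0] for a
    Laplace transform, [l < 0] with [D > 0] for a square-exponential moment. *)
Lemma normal_pdf_quad m s l y : (0 < s)%R -> let D := (1 + 2 * l * s ^+ 2)%R in (0 < D)%R ->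
  (expR (- (l * y ^+ 2)) * normal_pdf m s y =
   (Num.sqrt D)^-1 * expR (- (l * m ^+ 2 / D)) * normal_pdf (m / D) (s / Num.sqrt D) y)%R.
Proof.
move=> s0 D D0.
have sD0 : (0 < Num.sqrt D)%R by rewrite sqrtr_gt0.
have sD2 : (Num.sqrt D ^+ 2 = D)%R by rewrite sqr_sqrtr// ltW.
rewrite !normal_pdf_expR ?divr_gt0//.
have := @sqrt_2pi_gt0 R; set k := Num.sqrt (pi *+ 2) => k0.
rewrite mulrCA -expRD mulrACA -expRD; congr (_ * expR _)%R.
  by field; rewrite !gt_eqF.
rewrite expr_div_n sD2 /D; field.
by rewrite -/D !gt_eqF.
Qed.

Lemma normal_expR_quad m s l : (0 < s)%R -> let D := (1 + 2 * l * s ^+ 2)%R in (0 < D)%R ->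
  \int[normal_prob m s]_y (expR (- (l * y ^+ 2)))%:E =
  ((Num.sqrt D)^-1 * expR (- (l * m ^+ 2 / D)))%:E.
Proof.
move=> s0 D D0.
have me : measurable_fun [set: R] (fun y => (expR (- (l * y ^+ 2)))%:E).
  apply/measurable_EFinP; apply: measurableT_comp => //; apply: measurableT_comp => //.
  by apply: measurable_funM => //; exact: measurable_funX.
apply: (etrans (@ge0_integral_normal _ m s (fun y => (expR (- (l * y ^+ 2)))%:E) me _)).
  by move=> y; rewrite lee_fin expR_ge0.
under eq_integral do rewrite -EFinM normal_pdf_quad// EFinM.
rewrite ge0_integralZl.
- by rewrite integral_normal_pdf mule1.
- by [].
- by apply/measurable_EFinP; exact: measurable_normal_pdf.
- by move=> y _; rewrite lee_fin normal_pdf_ge0.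
- by rewrite lee_fin mulr_ge0 ?expR_ge0// invr_ge0.
Qed.

(** The second moment is read off the Laplace transform of y^2 near 0: it is at least 1 - l K, and
    by its explicit value at most e^{-l q / D} with q = m^2 + s^2. Comparing first orders in [l]
    gives the bound. *)
Lemma normal_second_moment_le m s K : (0 < s)%R ->
  \int[normal_prob m s]_y (y ^+ 2)%:E <= K%:E -> (m ^+ 2 + s ^+ 2 <= K)%R.
Proof.
move=> s0 hK.
have mX l : measurable_fun [set: R] (fun y => l * y ^+ 2)%R.
  by apply: measurable_funM => //; exact: measurable_funX.
have me l : measurable_fun [set: R] (fun y => expR (- (l * y ^+ 2)))%R.
  by apply: measurableT_comp => //; exact: measurableT_comp.
have K0 : (0 <= K)%R.
  rewrite -lee_fin; apply: le_trans hK; apply: integral_ge0 => y _.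
  by rewrite lee_fin sqr_ge0.
set q := (m ^+ 2 + s ^+ 2)%R.
have q0 : (0 <= q)%R by rewrite addr_ge0 ?sqr_ge0.
have key l : (0 < l)%R -> (q <= K + l * (2 * K * s ^+ 2 + K * q))%R.
  move=> l0; set D := (1 + 2 * l * s ^+ 2)%R.
  have ls0 : (0 <= l * s ^+ 2)%R by rewrite mulr_ge0 ?sqr_ge0// ltW.
  have D0 : (0 < D)%R by rewrite /D; lra.
  have sD0 : (0 < Num.sqrt D)%R by rewrite sqrtr_gt0.
  have h1 : (1 - l * K <= (Num.sqrt D)^-1 * expR (- (l * m ^+ 2 / D)))%R.
    rewrite lerBlDr -lee_fin EFinD.
    rewrite -(normal_expR_quad m s0 D0).
    apply: (@le_trans _ _ (\int[normal_prob m s]_y ((expR (- (l * y ^+ 2)))%:E + (l * y ^+ 2)%:E))).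
      rewrite -[X in X <= _](@probability_setT _ _ _ (normal_prob m s)) -[X in X <= _]mul1e.
      rewrite -integral_cst; last exact: measurableT.
      apply: ge0_le_integral.
      - exact: measurableT.
      - by [].
      - exact: measurable_cst.
      - by apply: emeasurable_funD; apply/measurable_EFinP; [exact: me|exact: mX].
      - move=> y _; rewrite -EFinD lee_fin; have := expR_ge1Dx (- (l * y ^+ 2))%R; lra.
    rewrite ge0_integralD; last 5 first.
    - exact: measurableT.
    - by move=> y _; rewrite lee_fin expR_ge0.
    - by apply/measurable_EFinP; exact: me.
    - by move=> y _; rewrite lee_fin mulr_ge0 ?sqr_ge0// ltW.
    - by apply/measurable_EFinP; exact: mX.
    apply: leeD2l.
    under eq_integral do rewrite EFinM.
    rewrite ge0_integralZl; last 4 first.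
    - exact: measurableT.
    - by apply/measurable_EFinP; exact: measurable_funX.
    - by move=> y _; rewrite lee_fin sqr_ge0.
    - by rewrite lee_fin ltW.
    by rewrite EFinM; apply: lee_wpmul2l => //; rewrite lee_fin ltW.
  set x := (l * q / D)%R.
  have x0 : (0 <= x)%R by rewrite /x !mulr_ge0// ?invr_ge0 ltW.
  have h2 : ((Num.sqrt D)^-1 * expR (- (l * m ^+ 2 / D)) <= expR (- x))%R.
    have -> : (- x = - (l * s ^+ 2 / D) + - (l * m ^+ 2 / D))%R by rewrite /x /q; field; rewrite gt_eqF.
    rewrite expRD ler_wpM2r ?expR_ge0//.
    have -> : ((Num.sqrt D)^-1 = expR (- (ln D / 2)))%R.
      rewrite expRN -{1}(@lnK _ D) ?posrE//; congr (_^-1)%R.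
      have -> : expR (ln D) = (expR (ln D / 2) ^+ 2)%R.
        by rewrite -expRM_natl; congr expR; field.
      by rewrite sqrtr_sqr ger0_norm ?expR_ge0.
    rewrite ler_expR lerN2.
    have := @ln_le_subr1 _ (D^-1)%R; rewrite invr_gt0 lnV ?posrE// => /(_ D0).
    have -> : (l * s ^+ 2 / D = (1 - D^-1) / 2)%R by rewrite /D; field; rewrite -/D gt_eqF.
    lra.
  have h3 : ((1 - l * K) * (1 + x) <= 1)%R.
    apply: (@le_trans _ _ (expR (- x) * (1 + x))%R).
      by apply: ler_wpM2r; [lra|exact: le_trans h1 h2].
    rewrite -[leRHS](@expRxMexpNx_1 _ x) mulrC ler_wpM2r ?expR_ge0//.
    exact: expR_ge1Dx.
  have := ler_wpM2r (ltW D0) h3; rewrite mul1r.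
  have -> : ((1 - l * K) * (1 + x) * D = (1 - l * K) * (D + l * q))%R.
    by rewrite /x; field; rewrite gt_eqF.
  move=> h4.
  have : (l * q <= l * (K + l * (2 * K * s ^+ 2 + K * q)))%R by rewrite /D in h4; lra.
  by rewrite ler_pM2l.
rewrite leNgt; apply/negP => Kq.
set c := (2 * K * s ^+ 2 + K * q)%R in key.
have c0 : (0 <= c)%R.
  apply: addr_ge0; apply: mulr_ge0 => //; last exact: sqr_ge0.
  exact: mulr_ge0.
(* With this [l] the second-order error l c is at most half of the supposed gap q - K, a
   contradiction. *)
have := key ((q - K) / (2 * (c + 1)))%R.
rewrite divr_gt0 ?subr_gt0//; last lra.
move=> /(_ isT).
have -> : ((q - K) / (2 * (c + 1)) * c = (q - K) / 2 * (c / (c + 1)))%R by field; lra.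
have : ((q - K) / 2 * (c / (c + 1)) <= (q - K) / 2)%R.
  apply: ler_piMr; first by apply: divr_ge0 => //; rewrite subr_ge0 ltW.
  by rewrite ler_pdivrMr; lra.
lra.
Qed.

End normal_quad.

Section subgaussian.
Local Open Scope ereal_scope.
Context {R : realType} {d : measure_display} {Omega : measurableType d}.
Variable P : probability Omega R.
Implicit Types (Z : Omega -> R) (K : R).

(* Unlike the property of being Gaussian, this is preserved under pointwise limits
   by Fatou's lemma, hence passes from Riemann-Stieltjes sums to the integral. *)
Definition subgaussian K Z : Prop := measurable_fun setT Z /\
  \int[P]_w (expR (Z w ^+ 2 / (4 * K)))%:E <= 2%:E.

Lemma measurable_expR_sqr K Z : measurable_fun setT Z ->
  measurable_fun setT (fun w => (expR (Z w ^+ 2 / (4 * K)))%:E).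
Proof.
move=> mZ; apply/measurable_EFinP; apply: measurableT_comp => //.
by apply: measurable_funM => //; exact: measurable_funX.
Qed.

Lemma ge0_integral_has_law Z (mu : {measure set (measurableTypeR R) -> \bar R}) (h : R -> \bar R) :
  measurable_fun setT Z -> has_law P Z mu ->
  measurable_fun [set: R] h -> (forall y, 0 <= h y) ->
  \int[P]_w h (Z w) = \int[mu]_y h y.
Proof.
move=> mZ law mh h0.
have mZ' : measurable_fun [set: Omega] (Z : Omega -> measurableTypeR R) by [].
apply: esym.
rewrite (@ge0_integral_push_density _ _ Omega (measurableTypeR R) R P Z (cst 1%R) mu mZ')//.
  by apply: eq_integral => w _; rewrite mule1.
move=> A mA; rewrite -(law A mA) -[LHS]mul1e -(@integral_cst _ _ _ P)//.
by rewrite -[_ @^-1` _]setTI; exact: mZ'.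
Qed.

(** The moment is D^{-1/2} e^{m^2 / (4 K D)} with D = 1 - s^2 / (2K). From m^2 + s^2 <= K one gets D
    >= 1/2 and m^2 <= K D, so it is at most sqrt 2 e^{1/4} <= 2; this fixes the constants 4 and 2 of
    the definition. The Dirac case has only the factor e^{1/4}. *)
Lemma gaussian_subgaussian Z K : (0 < K)%R -> measurable_fun setT Z -> is_gaussian P Z ->
  \int[P]_w (Z w ^+ 2)%:E <= K%:E -> subgaussian K Z.
Proof.
move=> K0 mZ gZ ZK; split => //.
have mX : measurable_fun [set: R] (fun y : R => (y ^+ 2)%:E).
  by apply/measurable_EFinP; exact: measurable_funX.
have me : measurable_fun [set: R] (fun y : R => (expR (y ^+ 2 / (4 * K)))%:E).
  apply/measurable_EFinP; apply: measurableT_comp => //.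
  by apply: measurable_funM => //; exact: measurable_funX.
have e4 : (expR (1 / 4) ^+ 2 <= 2 :> R)%R.
  rewrite -expRM_natl -ler_pV2 ?inE ?unitfE ?gt_eqF ?expR_gt0//; last by rewrite ltr0n.
  by rewrite -expRN; have := expR_ge1Dx (- (1 / 4 *+ 2) : R)%R; rewrite -mulr_natl; lra.
have e4' : (expR (1 / 4) <= 2 :> R)%R.
  have := expR_gt0 (1 / 4 : R); move: e4; set e := expR _; nra.
case: gZ => [[m [s [s0 law]]]|[m law]]; last first.
  pose dm : {measure set (measurableTypeR R) -> \bar R} := \d_(m : measurableTypeR R).
  have lawm : has_law P Z dm by exact: law.
  rewrite (ge0_integral_has_law mZ lawm mX) in ZK; last by move=> y; rewrite lee_fin sqr_ge0.
  rewrite integral_dirac ?diracE ?in_setT ?mul1e//= in ZK.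
  rewrite (ge0_integral_has_law mZ lawm me); last by move=> y; rewrite lee_fin expR_ge0.
  rewrite integral_dirac ?diracE ?in_setT ?mul1e//=.
  rewrite lee_fin in ZK *; apply: le_trans e4'; rewrite ler_expR.
  by rewrite ler_pdivrMr ?mulr_gt0//; lra.
rewrite (ge0_integral_has_law mZ law mX) in ZK; last by move=> y; rewrite lee_fin sqr_ge0.
rewrite (ge0_integral_has_law mZ law me); last by move=> y; rewrite lee_fin expR_ge0.
have msK := normal_second_moment_le s0 ZK.
pose l : R := (- (4 * K)^-1)%R.
have -> : (fun y : R => (expR (y ^+ 2 / (4 * K)))%:E) = (fun y : R => (expR (- (l * y ^+ 2)))%:E).
  by apply/funext => y; rewrite /l mulNr opprK mulrC.
set D := (1 + 2 * l * s ^+ 2)%R.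
have DE : (D = 1 - s ^+ 2 / (2 * K))%R by rewrite /D /l; field; rewrite gt_eqF.
have sK : (s ^+ 2 / (2 * K) <= 1 / 2)%R.
  by rewrite ler_pdivrMr ?mulr_gt0//; have := sqr_ge0 m; lra.
have D0 : (1 / 2 <= D)%R by rewrite DE; lra.
rewrite normal_expR_quad//; last by rewrite -/D; lra.
rewrite -/D lee_fin.
have sD0 : (0 < Num.sqrt D)%R by rewrite sqrtr_gt0; lra.
have e5 : (expR (- (l * m ^+ 2 / D)) <= expR (1 / 4))%R.
  rewrite ler_expR /l mulNr mulNr opprK.
  have Dgt0 : (0 < D)%R by lra.
  rewrite ler_pdivrMr// mulrC ler_pdivrMr ?mulr_gt0//.
  have -> : (1 / 4 * D * (4 * K) = D * K)%R by field.
  have -> : (D * K = K - s ^+ 2 / 2)%R by rewrite DE; field; rewrite gt_eqF.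
  by have := sqr_ge0 m; have := sqr_ge0 s; lra.
rewrite ler_pdivrMl//; apply: le_trans e5 _.
rewrite -ler_sqr ?nnegrE ?expR_ge0//.
by apply: le_trans e4 _; rewrite exprMn sqr_sqrtr; lra.
Qed.

Lemma subgaussian_lim K (Z_ : nat -> Omega -> R) Z :
  (forall k, subgaussian K (Z_ k)) -> (forall w, Z_ k w @[k --> \oo] --> Z w) ->
  subgaussian K Z.
Proof.
move=> sZ cZ.
have mZ : measurable_fun setT Z.
  by apply: (@measurable_fun_cvg _ _ _ _ Z_) => [k|w _]; [have [] := sZ k|exact: cZ].
split=> //.
have me k : measurable_fun setT (fun w => (expR (Z_ k w ^+ 2 / (4 * K)))%:E).
  by apply: measurable_expR_sqr; have [] := sZ k.
apply: (@le_trans _ _ (\int[P]_w limn_einf (fun k => (expR (Z_ k w ^+ 2 / (4 * K)))%:E))).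
  rewrite le_eqVlt; apply/orP; left; apply/eqP.
  apply: eq_integral => w _; apply: esym; apply: (cvg_limn_einf_sup _).1.
  apply: cvg_EFin; first exact: nearW.
  apply: (cvg_comp (fun k => Z_ k w ^+ 2 / (4 * K))%R expR); last exact: continuous_expR.
  by apply: cvgM; [apply: cvgM; exact: cZ|exact: cvg_cst].
apply: (le_trans (fatou P measurableT me _)).
  by move=> k w _; rewrite lee_fin expR_ge0.
rewrite limn_einf_lim; apply: lime_le; first exact: is_cvg_einfs.
apply: nearW => k; apply: le_trans (ereal_inf_lbound _) _; last exact: (sZ k).2.
by exists k => //=.
Qed.

Lemma subgaussian_cst K c : (0 < K)%R -> (c ^+ 2 <= 2 * K)%R -> subgaussian K (cst c).
Proof.
move=> K0 cK; split; first exact: measurable_cst.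
have PT : P setT = 1 := probability_setT P.
have -> : \int[P]_w (expR (cst c w ^+ 2 / (4 * K)))%:E = (expR (c ^+ 2 / (4 * K)))%:E.
  transitivity (\int[P]_w cst (expR (c ^+ 2 / (4 * K)))%:E w); first by [].
  by rewrite integral_cst// -[RHS]mule1; congr (_ * _); exact: PT.
rewrite lee_fin.
have e2 : (expR (1 / 2) <= 2 :> R)%R.
  have h1 := expR_ge1Dx (- (1 / 2) : R)%R; have h2 := expRxMexpNx_1 (1 / 2 : R).
  have := expR_gt0 (1 / 2 : R); nra.
apply: le_trans e2; rewrite ler_expR ler_pdivrMr ?mulr_gt0//; lra.
Qed.

Lemma subgaussianW K K' Z : (0 < K)%R -> (K <= K')%R -> subgaussian K Z -> subgaussian K' Z.
Proof.
move=> K0 KK' [mZ hZ]; split; first exact: mZ.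
apply: le_trans hZ; apply: ge0_le_integral => //.
- exact: measurable_expR_sqr.
- exact: measurable_expR_sqr.
move=> w _; rewrite lee_fin ler_expR ler_wpM2l ?sqr_ge0// lef_pV2 ?posrE ?mulr_gt0//; lra.
Qed.

(** The summands may be dependent: (Z + Z')^2 <= 2 (Z^2 + Z'^2), and e^{(a + b)/2} <= (e^a + e^b)/2.
    The first inequality gives one factor 2 of the parameter, the halving in the second gives the
    other. *)
Lemma subgaussianD K Z Z' : (0 < K)%R -> subgaussian K Z -> subgaussian K Z' ->
  subgaussian (4 * K) (fun w => Z w + Z' w)%R.
Proof.
move=> K0 [mZ hZ] [mZ' hZ'].
have mZZ : measurable_fun setT (fun w => Z w + Z' w)%R by exact: measurable_funD.
split; first exact: mZZ.
pose e (X : Omega -> R) w := (expR (X w ^+ 2 / (4 * K)))%:E.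
apply: (@le_trans _ _ (\int[P]_w ((1 / 2)%:E * (e Z w + e Z' w)))).
  apply: ge0_le_integral => //.
  - exact: measurable_expR_sqr.
  - by apply: emeasurable_funM => //; apply: emeasurable_funD; exact: measurable_expR_sqr.
  move=> w _; rewrite -EFinD -EFinM lee_fin.
  set a := (Z w ^+ 2 / (4 * K))%R; set b := (Z' w ^+ 2 / (4 * K))%R.
  apply: (@le_trans _ _ (expR (a / 2) * expR (b / 2))%R).
    rewrite -expRD ler_expR.
    have -> : (a / 2 + b / 2 = (2 * (Z w ^+ 2 + Z' w ^+ 2)) / (4 * (4 * K)))%R.
      by rewrite /a /b; field; rewrite gt_eqF.
    apply: ler_wpM2r; first by rewrite invr_ge0 !mulr_ge0// ltW.
    by have := sqr_ge0 (Z w - Z' w)%R; rewrite sqrrB sqrrD; lra.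
  have ea : expR a = (expR (a / 2) ^+ 2)%R by rewrite -expRM_natl; congr expR; field.
  have eb : expR b = (expR (b / 2) ^+ 2)%R by rewrite -expRM_natl; congr expR; field.
  by rewrite ea eb; have := sqr_ge0 (expR (a / 2) - expR (b / 2))%R; rewrite sqrrB; lra.
rewrite ge0_integralZl; last 4 first.
- by [].
- by apply: emeasurable_funD; exact: measurable_expR_sqr.
- by move=> w _; rewrite adde_ge0// lee_fin expR_ge0.
- by rewrite lee_fin.
rewrite ge0_integralD; last 5 first.
- by [].
- by move=> w _; rewrite lee_fin expR_ge0.
- exact: measurable_expR_sqr.
- by move=> w _; rewrite lee_fin expR_ge0.
- exact: measurable_expR_sqr.
apply: (@le_trans _ _ ((1 / 2)%:E * (2%:E + 2%:E))).
  by apply: lee_wpmul2l; [rewrite lee_fin|exact: leeD].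
by rewrite -EFinD -EFinM lee_fin; lra.
Qed.

End subgaussian.

Section fbm_increments.
Local Open Scope ereal_scope.
Context {R : realType} {d : measure_display} {Omega : measurableType d}.
Variable P : probability Omega R.
Variables (T H : R) (B : R -> Omega -> R).
Hypotheses (hB : is_fbm P T H B) (H12 : (2^-1 < H < 1)%R).

Let r (s t : R) : R := (2^-1 * (s `^ (2 * H) + t `^ (2 * H) - `|t - s| `^ (2 * H)))%R.

Let cov s t : (0 <= s <= T)%R -> (0 <= t <= T)%R ->
  \int[P]_w (B s w * B t w)%:E = (r s t)%:E.
Proof.
move=> hs ht; rewrite -(fbm_covariance hB hs ht) covariance.unlock.
rewrite (fbm_centered hB hs) (fbm_centered hB ht) expectation.unlock.
apply: eq_integral => w _; congr (_%:E).
by change (B s w * B t w = (B s w - 0) * (B t w - 0))%R; rewrite !subr0.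
Qed.

Let sqr_integrable t : (0 <= t <= T)%R -> P.-integrable setT (fun w => (B t w ^+ 2)%:E).
Proof.
move=> ht; have mB := fbm_measurable hB ht.
apply/integrableP; split; first by apply/measurable_EFinP; exact: measurable_funX.
under eq_integral do rewrite gee0_abs ?lee_fin ?sqr_ge0// expr2.
by rewrite cov// ltry.
Qed.

Let mul_integrable s t : (0 <= s <= T)%R -> (0 <= t <= T)%R ->
  P.-integrable setT (fun w => (B s w * B t w)%:E).
Proof.
move=> hs ht.
apply: (@le_integrable _ _ _ P _ measurableT _ (fun w => (B s w ^+ 2)%:E + (B t w ^+ 2)%:E)).
- by apply/measurable_EFinP; apply: measurable_funM; apply: fbm_measurable hB _ _.
- move=> w _; rewrite -EFinD !abse_EFin lee_fin [leRHS]ger0_norm ?addr_ge0 ?sqr_ge0//.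
  rewrite normrM -(real_normK (num_real (B s w))) -(real_normK (num_real (B t w))).
  have := sqr_ge0 (`|B s w| - `|B t w|)%R; rewrite sqrrB.
  have := sqr_ge0 `|B s w|%R; have := sqr_ge0 `|B t w|%R; lra.
- by apply: integrableD => //; exact: sqr_integrable.
Qed.

(** The covariance of the increments of [B] over [a, b] and [c, e]. *)
Let rho (a b c e : R) : R := (r b e - r b c - r a e + r a c)%R.

Let incr_mul a b c e : (0 <= a <= T)%R -> (0 <= b <= T)%R -> (0 <= c <= T)%R -> (0 <= e <= T)%R ->
  P.-integrable setT (fun w => ((B b w - B a w) * (B e w - B c w))%:E) /\
  \int[P]_w ((B b w - B a w) * (B e w - B c w))%:E = (rho a b c e)%:E.
Proof.
move=> ha hb hc he.
have E : (fun w => ((B b w - B a w) * (B e w - B c w))%:E) =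
    (fun w => (((B b w * B e w)%:E - (B b w * B c w)%:E) - (B a w * B e w)%:E) + (B a w * B c w)%:E).
  by apply/funext => w; rewrite -!EFinB -EFinD; congr (_%:E); ring.
have i1 := mul_integrable hb he; have i2 := mul_integrable hb hc.
have i3 := mul_integrable ha he; have i4 := mul_integrable ha hc.
have i12 : P.-integrable setT (fun w => (B b w * B e w)%:E - (B b w * B c w)%:E) by exact: integrableB.
have i123 : P.-integrable setT (fun w => (B b w * B e w)%:E - (B b w * B c w)%:E - (B a w * B e w)%:E).
  exact: integrableB.
rewrite E; split; first exact: integrableD.
rewrite integralD// integralB// integralB// !cov//.
Qed.

(** Convexity of x -> x^{2H}: the lengths u and v lie between x and y with u + v = x + y, so u^{2H}
    + v^{2H} <= x^{2H} + y^{2H}. [t] is the weight of y in v, and of x in u. *)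
Let rho_ge0 a b c e : (a <= b)%R -> (b <= c)%R -> (c <= e)%R -> (0 <= rho a b c e)%R.
Proof.
move=> ab bc ce; have /andP[H1 H2] := H12.
have p1 : (1 <= 2 * H)%R by lra.
pose x := (c - b)%R; pose y := (e - a)%R; pose u := (c - a)%R; pose v := (e - b)%R.
have -> : rho a b c e = ((x `^ (2 * H) + y `^ (2 * H) - u `^ (2 * H) - v `^ (2 * H)) / 2)%R.
  have -> : x = `|c - b|%R by rewrite ger0_norm// subr_ge0.
  have -> : y = `|e - a|%R by rewrite ger0_norm// subr_ge0; lra.
  have -> : u = `|c - a|%R by rewrite ger0_norm// subr_ge0; lra.
  have -> : v = `|e - b|%R by rewrite ger0_norm// subr_ge0; lra.
  by rewrite /rho /r; field.
have x0 : (0 <= x)%R by rewrite /x; lra.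
have [yx|yx] := leP y x.
  have [-> ->] : u = x /\ v = x by rewrite /u /v /x /y in yx *; split; lra.
  have -> : y = x by rewrite /x /y in yx *; lra.
  by rewrite (_ : (_ + _ - _ - _ = 0)%R) ?mul0r//; ring.
pose t := ((v - x) / (y - x))%R.
have yx0 : (0 < y - x)%R by rewrite subr_gt0.
have t0 : (0 <= t)%R by rewrite divr_ge0 ?subr_ge0// ?(ltW yx)// /v /x; lra.
have t1 : (t <= 1)%R by rewrite ler_pdivrMr// mul1r /v /x /y; lra.
have xin : x \in `[0%R, +oo[%classic by rewrite inE/= in_itv/= x0.
have yin : y \in `[0%R, +oo[%classic by rewrite inE/= in_itv/= andbT; lra.
pose ti : {i01 R} := Itv01 t0 t1.
have c1 := convex_powR p1 ti xin yin; have c2 := convex_powR p1 ti yin xin.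
rewrite !convRE/= /unstable.onem in c1 c2.
have e1 : (t * x + (1 - t) * y = u)%R.
  have -> : u = (x + y - v)%R by rewrite /u /v /x /y; ring.
  by rewrite /t; field; rewrite gt_eqF.
have e2 : (t * y + (1 - t) * x = v)%R.
  by rewrite /t; field; rewrite gt_eqF.
have f1 : conv ti (x : R^o) (y : R^o) = u by rewrite -e1; exact: convRE.
have f2 : conv ti (y : R^o) (x : R^o) = v by rewrite -e2; exact: convRE.
have c1' : (u `^ (2 * H) <= t * x `^ (2 * H) + (1 - t) * y `^ (2 * H))%R by rewrite -f1; exact: c1.
have c2' : (v `^ (2 * H) <= t * y `^ (2 * H) + (1 - t) * x `^ (2 * H))%R by rewrite -f2; exact: c2.
lra.
Qed.

Let rhoC a b c e : rho a b c e = rho c e a b.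
Proof.
have rC s t : r s t = r t s by rewrite /r distrC [(s `^ _ + _)%R]addrC.
by rewrite /rho (rC b e) (rC b c) (rC a e) (rC a c); ring.
Qed.

Let rho_diag a b : (a <= b)%R -> rho a b a b = ((b - a) `^ (2 * H))%R.
Proof.
have /andP[H1 H2] := H12.
move=> ab; rewrite /rho /r !subrr normr0 (ger0_norm (_ : 0 <= b - a)%R) ?subr_ge0//.
rewrite distrC (ger0_norm (_ : 0 <= b - a)%R) ?subr_ge0//.
by rewrite powR0; [lra|rewrite gt_eqF//; lra].
Qed.

Variables (m : nat) (x : nat -> R).
Hypotheses (x0 : (0 <= x 0%N)%R) (xm : (x m <= T)%R)
  (xx : forall k, (k < m)%N -> (x k <= x k.+1)%R).

Let x_mono i j : (i <= j)%N -> (j <= m)%N -> (x i <= x j)%R.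
Proof.
elim: j => [|j IH]; first by rewrite leqn0 => /eqP ->.
rewrite leq_eqVlt => /predU1P[->//|]; rewrite ltnS => ij jm.
by apply: le_trans (IH ij (ltnW jm)) (xx jm).
Qed.

Let x_itv k : (k <= m)%N -> (0 <= x k <= T)%R.
Proof.
move=> km; rewrite (le_trans x0 (x_mono (leq0n k) km))/=.
exact: le_trans (x_mono km (leqnn m)) xm.
Qed.

Definition incr_sum (c : nat -> R) (w : Omega) : R :=
  (\sum_(k < m) c k * (B (x k.+1) w - B (x k) w))%R.

Let rhokl (k l : nat) := rho (x k) (x k.+1) (x l) (x l.+1).

Let rhokl_ge0 k l : (k < m)%N -> (l < m)%N -> (0 <= rhokl k l)%R.
Proof.
move=> km lm; rewrite /rhokl.
have [kl|lk|->] := ltngtP k l.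
- by apply: rho_ge0; [exact: xx|apply: x_mono => //; exact: ltnW|exact: xx].
- by rewrite rhoC; apply: rho_ge0; [exact: xx|apply: x_mono => //; exact: ltnW|exact: xx].
- by rewrite rho_diag ?powR_ge0//; exact: xx.
Qed.

Let incr_sum_sqr c : \int[P]_w (incr_sum c w ^+ 2)%:E =
  (\sum_(k < m) \sum_(l < m) c k * c l * rhokl k l)%:E.
Proof.
transitivity (\int[P]_w (\sum_(k < m) \sum_(l < m) (c k * c l)%:E *
    ((B (x k.+1) w - B (x k) w) * (B (x l.+1) w - B (x l) w))%:E)).
  apply: eq_integral => w _; rewrite expr2 /incr_sum big_distrlr/=.
  rewrite -sumEFin; apply: eq_bigr => k _; rewrite -sumEFin; apply: eq_bigr => l _.
  by rewrite -EFinM; congr (_%:E); ring.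
have im (k l : 'I_m) := incr_mul (x_itv (ltnW (ltn_ord k))) (x_itv (ltn_ord k))
   (x_itv (ltnW (ltn_ord l))) (x_itv (ltn_ord l)).
have iZ (k l : 'I_m) : P.-integrable setT (fun w => (c k * c l)%:E *
    ((B (x k.+1) w - B (x k) w) * (B (x l.+1) w - B (x l) w))%:E).
  by apply: integrableZl => //; exact: (im k l).1.
rewrite integral_sum//; last by move=> k; apply: integrable_sum.
rewrite -sumEFin; apply: eq_bigr => k _.
rewrite integral_sum// -sumEFin; apply: eq_bigr => l _.
by rewrite integralZl ?(im k l).2 ?EFinM//; exact: (im k l).1.
Qed.

Let measurable_incr_sum c : measurable_fun setT (incr_sum c).
Proof.
suff : measurable_fun setT (fun w => \sum_(k <- index_enum 'I_m) c k * (B (x k.+1) w - B (x k) w))%R by [].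
apply: measurable_sum => k; apply: measurable_funM => //; apply: measurable_funB; apply: fbm_measurable hB _ _.
  by apply: x_itv.
by apply: x_itv; exact: ltnW.
Qed.

Let incr_sum_sqr_le c M : (forall k, (k < m)%N -> `|c k| <= M)%R ->
  \int[P]_w (incr_sum c w ^+ 2)%:E <= (M ^+ 2 * (x m - x 0%N) `^ (2 * H))%:E.
Proof.
move=> cM; rewrite incr_sum_sqr lee_fin.
apply: (@le_trans _ _ (M ^+ 2 * \sum_(k < m) \sum_(l < m) 1 * 1 * rhokl k l)%R).
  rewrite mulr_sumr; apply: ler_sum => k _; rewrite mulr_sumr; apply: ler_sum => l _.
  rewrite !mul1r; apply: ler_wpM2r; first exact: rhokl_ge0.
  apply: le_trans (ler_norm _) _; rewrite normrM expr2.
  by apply: ler_pM => //; exact: cM.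
suff -> : (\sum_(k < m) \sum_(l < m) 1 * 1 * rhokl k l)%R = ((x m - x 0%N) `^ (2 * H))%R by [].
apply: EFin_inj; rewrite -(incr_sum_sqr (fun=> 1%R)).
have h0 : (0 <= x 0%N <= T)%R by exact: x_itv.
have hm : (0 <= x m <= T)%R by exact: x_itv.
rewrite -(rho_diag (x_mono (leq0n m) (leqnn m))) -(incr_mul h0 hm h0 hm).2.
apply: eq_integral => w _; rewrite expr2.
have -> // : incr_sum (fun=> 1%R) w = (B (x m) w - B (x 0%N) w)%R.
rewrite /incr_sum -(telescope_sumr (fun k => B (x k) w)) // big_mkord.
by apply: eq_bigr => k _; rewrite mul1r.
Qed.

(* For H > 1/2 the increments are nonnegatively correlated, so the variance of a
   weighted sum of increments is at most that of the sum with all weights [M]. *)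
Lemma fbm_incr_sum_subgaussian c M K : (0 < K)%R ->
  (forall k, (k < m)%N -> `|c k| <= M)%R ->
  (M ^+ 2 * (x m - x 0%N) `^ (2 * H) <= K)%R ->
  subgaussian P K (incr_sum c).
Proof.
move=> K0 cM MK; apply: gaussian_subgaussian => //; last first.
  by apply: le_trans (incr_sum_sqr_le cM) _; rewrite lee_fin.
(* Summation by parts: the weighted increments become a linear combination of the values B(x_i), the
   form in which [fbm_gaussian] is stated. The two conditionals remove the missing neighbours at i =
   0 and i = m. *)
pose a i := ((if i is k.+1 then c k else 0) - (if (i < m)%N then c i else 0))%R.
have -> : incr_sum c = (fun w => \sum_(i < m.+1) a i * B (x i) w)%R.
  apply/funext => w; rewrite /a.
  under [RHS]eq_bigr do rewrite mulrBl.
  rewrite sumrB /incr_sum big_ord_recl/= mul0r add0r [X in (_ - X)%R]big_ord_recr/= ltnn mul0r addr0.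
  rewrite -sumrB; apply: eq_bigr => i _; rewrite /bump/= add1n ltn_ord mulrBr//.
by apply: (fbm_gaussian hB) => i; rewrite ltnS; exact: x_itv.
Qed.

End fbm_increments.

Lemma expRN_lipschitz (R : realType) (u v : R) : 0 <= u -> 0 <= v ->
  `|expR (- u) - expR (- v)| <= `|u - v|.
Proof.
wlog uv : u v / u <= v => [wl|] u0 v0.
  have [uv|/ltW vu] := leP u v; first exact: wl.
  by rewrite distrC [leRHS]distrC; exact: wl.
rewrite ger0_norm ?subr_ge0 ?ler_expR ?lerN2// distrC ger0_norm ?subr_ge0//.
have -> : expR (- v) = expR (- u) * expR (- (v - u)).
  by rewrite -expRD; congr expR; ring.
have h1 := expR_ge1Dx (- (v - u)).
have h2 : expR (- u) <= 1 by rewrite expR_le1 oppr_le0.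
have h3 := expR_ge0 (- u).
have : expR (- u) * (1 - expR (- (v - u))) <= 1 * (v - u).
  have [h4|h4] := leP 0 (1 - expR (- (v - u))); last by nra.
  by apply: ler_pM => //; lra.
lra.
Qed.

(** * The fractional Ornstein-Uhlenbeck process and its discretization *)

Section fractional_OU.
Local Open Scope ereal_scope.
Context {R : realType} {d : measure_display} {Omega : measurableType d}.
Variable P : probability Omega R.
Variables (T H alpha Y0 : R) (B Y : R -> Omega -> R).
Hypotheses (T_gt0 : (0 < T)%R) (H12 : (2^-1 < H < 1)%R) (alpha_gt0 : (0 < alpha)%R).
Hypotheses (hB : is_fbm P T H B) (hY : is_fractional_OU T alpha Y0 B Y).

Let Hge0 : (0 <= 2 * H)%R. Proof. by have /andP[] := H12; lra. Qed.

Let KT : R := T `^ (2 * H).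
Let KT0 : (0 < KT)%R. Proof. exact: powR_gt0. Qed.

Let powR_le x y : (0 <= x)%R -> (x <= y)%R -> (x `^ (2 * H) <= y `^ (2 * H))%R.
Proof.
by move=> x0 xy; apply: ge0_ler_powR => //; rewrite nnegrE//; exact: le_trans xy.
Qed.

(** The uniform partition of [0, T] into N pieces, stopped at [s]: the index range is independent of
    [s], at the price of repeated points at the end. When N is a multiple of n it contains the grid
    points up to [s]. *)
Let part (N : nat) (s : R) (k : nat) : R := Num.min s (k%:R * T / N%:R)%R.

Let part0 N s : (0 <= s)%R -> part N s 0 = 0%R.
Proof. by move=> s0; rewrite /part !mul0r min_r. Qed.

Let part_last N s : (0 < N)%N -> (s <= T)%R -> part N s N = s.
Proof.
by move=> N0 sT; rewrite /part mulrAC divff ?mul1r ?min_l// pnatr_eq0 -lt0n.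
Qed.

Let knot_le N i j : (i <= j)%N -> (i%:R * T / N%:R <= j%:R * T / N%:R :> R)%R.
Proof.
move=> ij; rewrite ler_wpM2r ?invr_ge0//; apply: ler_wpM2r; first exact: ltW.
by rewrite ler_nat.
Qed.

Let part_le N s i j : (i <= j)%N -> (part N s i <= part N s j)%R.
Proof.
move=> ij; rewrite /part le_min ge_min lexx/= ge_min.
by rewrite knot_le// orbT.
Qed.

Let part_mesh N s k : (part N s k.+1 - part N s k <= T / N%:R)%R.
Proof.
rewrite /part -natr1 mulrDl mul1r mulrDl; set a := (k%:R * T / N%:R)%R.
have h : (0 <= T / N%:R)%R by rewrite divr_ge0// ltW.
by have [|] := leP s a; have [|] := leP s (a + T / N%:R)%R; lra.
Qed.

Let part_ub N s k : (part N s k <= s)%R.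
Proof. by rewrite /part ge_min lexx. Qed.

Let wt (s t : R) : R := expR (- alpha * (s - t)).

Let wt_le1 s t : (t <= s)%R -> (`|wt s t| <= 1)%R.
Proof.
move=> ts; rewrite ger0_norm ?expR_ge0// expR_le1 mulNr oppr_le0 mulr_ge0 ?subr_ge0//.
exact: ltW.
Qed.

Let RS N s := incr_sum B N (part N s) (fun k => wt s (part N s k)).

Let RS_cvg n s w : (0 < n)%N -> (0 <= s <= T)%R ->
  RS (n * m.+1) s w @[m --> \oo] --> (Y s w - Y0 * expR (- alpha * s))%R.
Proof.
move=> n0 hs; apply/cvgrPdist_lt => e e0.
have [del del0 h] := hY w hs e0; near=> m.
rewrite distrC.
have hs0 : (0 <= s)%R by have /andP[] := hs.
have hsT : (s <= T)%R by have /andP[] := hs.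
apply: (h (n * m.+1)%N (part (n * m.+1) s) (part (n * m.+1) s)).
- exact: part0.
- by apply: part_last => //; rewrite muln_gt0 n0.
move=> i _; split; first by rewrite lexx part_le.
apply: le_lt_trans (part_mesh _ _ _) _.
have N0 : (0 < (n * m.+1)%:R :> R)%R by rewrite ltr0n muln_gt0 n0.
rewrite ltr_pdivrMr// mulrC -ltr_pdivrMr//.
apply: (@lt_le_trans _ _ (m%:R)%R); last first.
  by rewrite ler_nat (leq_trans (leqnSn m))// leq_pmull.
by near: m; exact: nbhs_infty_gtr.
Unshelve. all: by end_near. Qed.

Let KT_mono s : (0 <= s <= T)%R -> (s `^ (2 * H) <= KT)%R.
Proof. by move=> /andP[s0 sT]; exact: powR_le. Qed.

Let Yc_subgaussian s : (0 <= s <= T)%R ->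
  subgaussian P KT (fun w => Y s w - Y0 * expR (- alpha * s))%R.
Proof.
move=> hs; have /andP[s0 sT] := hs.
apply: (subgaussian_lim (Z_ := fun m => RS (1 * m.+1) s)) => [m|w]; last exact: RS_cvg.
apply: (@fbm_incr_sum_subgaussian _ _ _ _ _ _ _ hB H12 _ _ _ _ _ _ 1%R) => //.
- by rewrite part0.
- by rewrite part_last.
- by move=> k _; exact: part_le.
- by move=> k _; apply: wt_le1; exact: part_ub.
- by rewrite expr1n mul1r part_last// part0// subr0 KT_mono.
Qed.

(** T^{2H} bounds the second moment of the centered part and Y0^2 that of the mean; the factor 4 is
    the cost of [subgaussianD]. *)
Definition ou_var : R := (4 * (KT + Y0 ^+ 2))%R.

Let KTY0 : (0 < KT + Y0 ^+ 2)%R. Proof. by rewrite ltr_wpDr// sqr_ge0. Qed.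

Lemma ou_var_gt0 : (0 < ou_var)%R.
Proof. by rewrite mulr_gt0. Qed.

Let mean_subgaussian t : (0 <= t)%R ->
  subgaussian P (KT + Y0 ^+ 2) (cst (Y0 * expR (- alpha * t)))%R.
Proof.
move=> t0; apply: subgaussian_cst => //.
have e1 : (expR (- alpha * t) ^+ 2 <= 1)%R.
  by rewrite expr_le1 ?expR_ge0// expR_le1 mulNr oppr_le0 mulr_ge0// ltW.
have := ler_wpM2l (sqr_ge0 Y0) e1; rewrite mulr1 -exprMn.
have := KT0; have := sqr_ge0 Y0; lra.
Qed.

Lemma OU_subgaussian s : (0 <= s <= T)%R -> subgaussian P ou_var (Y s).
Proof.
move=> hs; have /andP[s0 sT] := hs.
have -> : Y s = (fun w => (Y s w - Y0 * expR (- alpha * s)) + cst (Y0 * expR (- alpha * s)) w)%R.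
  by apply/funext => w; rewrite /cst subrK.
apply: subgaussianD => //; last exact: mean_subgaussian.
by apply: subgaussianW (Yc_subgaussian hs) => //; rewrite lerDl sqr_ge0.
Qed.

Variable n : nat.
Hypothesis n0 : (0 < n)%N.

Let t := grid T n.
Let nR0 : (0 < n%:R :> R)%R. Proof. by rewrite ltr0n. Qed.

Lemma grid_ge0 i : (0 <= grid T n i)%R.
Proof. by rewrite /grid divr_ge0// mulr_ge0// ltW. Qed.

Lemma grid_le i j : (i <= j)%N -> (grid T n i <= grid T n j)%R.
Proof. exact: knot_le. Qed.

Lemma grid_last : grid T n n = T.
Proof. by rewrite /grid mulrAC divff ?mul1r// gt_eqF. Qed.

Lemma grid_itv i : (i <= n)%N -> (0 <= grid T n i <= T)%R.
Proof. by move=> i_n; rewrite grid_ge0/= -[leRHS]grid_last grid_le. Qed.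

Lemma gridS i : (grid T n i.+1 = grid T n i + T / n%:R)%R.
Proof. by rewrite /grid -natr1 mulrDl mul1r mulrDl. Qed.

(** The weight of the i-th increment in [Yn_grid j]. It is at most 1 because i < j means i <= j - 1,
    the index at which the scheme freezes the exponential. *)
Let bc (j : nat) (i : nat) : R := (expR (- alpha * t j.-1) * expR (alpha * t i))%R.

Let bcE j i : (bc j i = expR (- (alpha * (t j.-1 - t i))))%R.
Proof. by rewrite /bc -expRD; congr expR; ring. Qed.

Let bc_le1 j i : (i < j)%N -> (`|bc j i| <= 1)%R.
Proof.
move=> ij; rewrite bcE ger0_norm ?expR_ge0// expR_le1 oppr_le0 mulr_ge0 ?subr_ge0 ?(ltW alpha_gt0)//.
by apply: grid_le; rewrite -ltnS prednK// (leq_ltn_trans _ ij).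
Qed.

Let Yn_gridE j w : Yn_grid T alpha Y0 B n j w =
  (Y0 * expR (- alpha * t j) + incr_sum B j t (bc j) w)%R.
Proof.
rewrite /Yn_grid /incr_sum mulr_sumr; congr (_ + _)%R.
by apply: eq_bigr => i _; rewrite mulrA.
Qed.

Lemma Yn_grid_subgaussian j : (j <= n)%N ->
  subgaussian P ou_var (Yn_grid T alpha Y0 B n j).
Proof.
move=> jn.
have -> : Yn_grid T alpha Y0 B n j =
  (fun w => incr_sum B j t (bc j) w + cst (Y0 * expR (- alpha * t j)) w)%R.
  by apply/funext => w; rewrite Yn_gridE addrC.
apply: subgaussianD => //; last by apply: mean_subgaussian; exact: grid_ge0.
apply: (@fbm_incr_sum_subgaussian _ _ _ _ _ _ _ hB H12 _ _ _ _ _ _ 1%R) => //.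
- exact: grid_ge0.
- by have /andP[] := grid_itv jn.
- by move=> k _; exact: grid_le.
- by move=> k kj; exact: bc_le1.
rewrite expr1n mul1r [X in (_ - X)%R]/t /grid !mul0r subr0.
apply: (@le_trans _ _ KT); last by rewrite lerDl sqr_ge0.
by apply: KT_mono; exact: grid_itv.
Qed.

(* Writes a sum over the coarse grid as one over the partition used for [Y s], so
   that their difference is again a weighted sum of increments. *)
Let refine s m j (g : nat -> R) w : (t j <= s)%R ->
  (\sum_(i < j) g i * (B (t i.+1) w - B (t i) w) =
   \sum_(k < j * m.+1) g (k %/ m.+1)%N *
     (B (part (n * m.+1) s k.+1) w - B (part (n * m.+1) s k) w))%R.
Proof.
have partE i : (t i <= s)%R -> part (n * m.+1) s (i * m.+1) = t i.
  move=> tis; rewrite /part min_r.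
    by rewrite /t /grid !natrM; field; rewrite !gt_eqF// ltr0n.
  apply: le_trans tis; rewrite /t /grid !natrM le_eqVlt; apply/orP; left; apply/eqP.
  by field; rewrite !gt_eqF// ltr0n.
elim: j => [|j IH] tj; first by rewrite mul0n !big_ord0.
have tj' : (t j <= s)%R by apply: le_trans tj; exact: grid_le.
rewrite big_ord_recr/= IH// mulSn addnC big_split_ord/=; congr (_ + _)%R.
under [RHS]eq_bigr => l _ do rewrite divnMDl// divn_small ?addn0//.
rewrite -mulr_sumr; congr (_ * _)%R.
rewrite -(partE j.+1)// -(partE j)//.
have -> : (j.+1 * m.+1 = j * m.+1 + m.+1)%N by rewrite mulSn addnC.
rewrite -(big_mkord xpredT (fun l => B (part (n * m.+1) s (j * m.+1 + l).+1) w - B (part (n * m.+1) s (j * m.+1 + l)) w)%R).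
under eq_bigr do rewrite -addnS.
by rewrite (telescope_sumr (fun l => B (part (n * m.+1) s (j * m.+1 + l)) w))// addn0.
Qed.

Let nu : R := n%:R `^ (- (2 * H)).
Let nu0 : (0 < nu)%R. Proof. exact: powR_gt0. Qed.

Let nu_powR : ((T / n%:R) `^ (2 * H) = KT * nu)%R.
Proof.
have := powRM (2 * H) (ltW (divr_gt0 T_gt0 nR0)) (ltW nR0).
rewrite divfK ?gt_eqF// -/KT => ->; rewrite /nu powRN -mulrA divff ?mulr1//.
by rewrite gt_eqF// powR_gt0.
Qed.

(** Because H < 1, errors of order 1/n in the mean and in the weights are absorbed by n^{-2H}. *)
Let nu_sqr : (n%:R ^- 2 <= nu)%R.
Proof.
have /andP[H1 H2] := H12.
have -> : (n%:R ^- 2 = n%:R `^ (- 2) :> R)%R by rewrite powRN powR_mulrn// ltW.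
apply: ler_powR; first by rewrite ler1n.
by rewrite lerN2; lra.
Qed.

(** 16 is the cost of two uses of [subgaussianD]. Inside, T^{2H} is due to the last partial step, 9
    (alpha T)^2 T^{2H} to the perturbed weights on the earlier steps, and Y0^2 (alpha T)^2 to the
    mean. *)
Definition ou_err : R := (16 * (KT * (1 + 9 * (alpha * T) ^+ 2) + Y0 ^+ 2 * (alpha * T) ^+ 2))%R.

Let K1 : R := (KT * (1 + 9 * (alpha * T) ^+ 2) + Y0 ^+ 2 * (alpha * T) ^+ 2)%R.

Let K10 : (0 < K1)%R.
Proof.
have := sqr_ge0 (alpha * T)%R; set q := (_ ^+ 2)%R => q0.
have := mulr_ge0 (sqr_ge0 Y0) q0; have := mulr_ge0 (ltW KT0) q0; have := KT0.
rewrite /K1 -/q; lra.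
Qed.

Lemma ou_err_gt0 : (0 < ou_err)%R.
Proof. by rewrite mulr_gt0. Qed.

(** The error splits into a deterministic mean, a sum over [0, t_j] whose weights differ by O(1/n),
    and a sum over [t_j, s] with weights at most 1. The last one, of variance at most (T/n)^{2H},
    decides the rate. *)
Lemma OU_error_subgaussian s j : (0 <= s <= T)%R -> (j <= n)%N ->
  (grid T n j <= s <= grid T n j.+1)%R ->
  subgaussian P (ou_err * n%:R `^ (- (2 * H)))
    (fun w => Y s w - Yn_grid T alpha Y0 B n j w)%R.
Proof.
move=> hs jn /andP[tjs stj1]; have /andP[s0 sT] := hs.
have a0 := ltW alpha_gt0; have Tn0 : (0 <= T / n%:R)%R by rewrite divr_ge0// ltW.
have stj : (s - t j <= T / n%:R)%R by rewrite gridS in stj1; rewrite /t; lra.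
have stj' : (s - t j.-1 <= 2 * (T / n%:R))%R.
  case: {jn tjs stj1} j stj => [|j] /=; first by lra.
  by rewrite {1}/t gridS -/t; lra.
set mean := (Y0 * expR (- alpha * s) - Y0 * expR (- alpha * t j))%R.
have hmean : (mean ^+ 2 <= 2 * (4 * (K1 * nu)))%R.
  have h1 : (`|mean| <= `|Y0| * (alpha * T / n%:R))%R.
    rewrite /mean -mulrBr normrM ler_wpM2l// !mulNr.
    apply: le_trans (expRN_lipschitz _ _) _; try by rewrite mulr_ge0// grid_ge0.
    rewrite -mulrBr normrM ger0_norm// ger0_norm ?subr_ge0// -mulrA.
    exact: ler_wpM2l.
  have h2 : (mean ^+ 2 <= Y0 ^+ 2 * (alpha * T) ^+ 2 * n%:R ^- 2)%R.
    rewrite -(real_normK (num_real mean)) -(real_normK (num_real Y0)).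
    rewrite -exprMn -exprVn -exprMn -mulrA ler_sqr ?nnegrE ?normr_ge0//.
    by rewrite mulr_ge0// mulr_ge0 ?invr_ge0// mulr_ge0// ltW.
  have q0 : (0 <= Y0 ^+ 2 * (alpha * T) ^+ 2)%R by rewrite mulr_ge0 ?sqr_ge0.
  have h3 := ler_wpM2l q0 nu_sqr.
  have h4 : (Y0 ^+ 2 * (alpha * T) ^+ 2 * nu <= K1 * nu)%R.
    rewrite ler_pM2r// /K1 lerDr mulr_ge0 ?(ltW KT0)// addr_ge0// mulr_ge0 ?sqr_ge0//.
  have := mulr_gt0 K10 nu0; lra.
have K1nu := mulr_gt0 K10 nu0.
have -> : (fun w => Y s w - Yn_grid T alpha Y0 B n j w)%R =
  (fun w => ((Y s w - Y0 * expR (- alpha * s)) - incr_sum B j t (bc j) w) + cst mean w)%R.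
  by apply/funext => w; rewrite Yn_gridE /cst /mean; ring.
have -> : (ou_err * n%:R `^ (- (2 * H)) = 4 * (4 * (K1 * nu)))%R by rewrite /ou_err -/K1 /nu; ring.
apply: subgaussianD; first (by rewrite mulr_gt0); last first.
  by apply: subgaussian_cst => //; rewrite mulr_gt0.
apply: (subgaussian_lim (Z_ := fun m w => RS (n * m.+1) s w - incr_sum B j t (bc j) w)%R) => [m|w]; last first.
  by apply: cvgB; [exact: RS_cvg|exact: cvg_cst].
pose N := (n * m.+1)%N; pose J := (j * m.+1)%N.
have JN : (J <= N)%N by rewrite leq_mul2r jn orbT.
pose x := part N s.
have N0 : (0 < N)%N by rewrite muln_gt0 n0.
have xJ : x J = t j.
  rewrite /x /part min_r.
    by rewrite /t /grid !natrM; field; rewrite !gt_eqF// ltr0n.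
  apply: le_trans tjs; rewrite /grid !natrM le_eqVlt; apply/orP; left; apply/eqP.
  by field; rewrite !gt_eqF// ltr0n.
(* [k %/ m.+1] is the coarse step containing the k-th fine step; up to index [J], that is up to t_j,
   both sums use the same increments. *)
have -> : (fun w => RS N s w - incr_sum B j t (bc j) w)%R =
  (fun w => incr_sum B J x (fun k => wt s (x k) - bc j (k %/ m.+1)) w +
            incr_sum B (N - J) (fun k => x (J + k)%N) (fun k => wt s (x (J + k)%N)) w)%R.
  apply/funext => w; rewrite [X in (_ - X)%R]/incr_sum (refine m (bc j) w tjs) -/N -/J -/x.
  rewrite /RS /incr_sum -/x.
  rewrite -[in LHS](subnKC JN) big_split_ord/=.
  under [in RHS]eq_bigr do rewrite mulrBl.
  rewrite sumrB addrAC; congr (_ + _)%R.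
  by apply: eq_bigr => k _; rewrite addnS.
apply: subgaussianD => //.
(* The two exponents differ by alpha times (s - t_{j-1}) - (x_k - t_i), where the terms are at most
   2 T / n and T / n: hence the 3. *)
- apply: (@fbm_incr_sum_subgaussian _ _ _ _ _ _ _ hB H12 _ _ _ _ _ _ (3 * (alpha * T) / n%:R)%R) => //.
  + by rewrite /x part0.
  + by rewrite (le_trans (part_ub _ _ _)).
  + by move=> k _; exact: part_le.
  + move=> k kJ; rewrite bcE /wt mulNr.
    have kj : (k %/ m.+1 <= j.-1)%N.
      have : (k %/ m.+1 < j)%N by rewrite ltn_divLR.
      by case: (j) => // j'; rewrite ltnS.
    apply: le_trans (expRN_lipschitz _ _) _.
    * by rewrite mulr_ge0// subr_ge0 part_ub.
    * by rewrite mulr_ge0// subr_ge0 grid_le.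
    rewrite -mulrBr normrM ger0_norm// -!mulrA mulrCA ler_wpM2l//.
    have xk : x k = (k%:R * T / N%:R)%R.
      rewrite /x /part min_r//; apply: (@le_trans _ _ (t j)) => //.
      have -> : t j = (J%:R * T / N%:R)%R.
        by rewrite /t /grid /J /N !natrM; field; rewrite !gt_eqF// ltr0n.
      by rewrite knot_le// ltnW.
    have xt1 : (t (k %/ m.+1) <= x k)%R.
      rewrite xk /t /grid /N natrM ler_pdivlMr ?mulr_gt0 ?ltr0n//.
      have -> : ((k %/ m.+1)%:R * T / n%:R * (n%:R * m.+1%:R) = (k %/ m.+1)%:R * m.+1%:R * T :> R)%R.
        by field; rewrite gt_eqF.
      by rewrite ler_wpM2r ?(ltW T_gt0)// -natrM ler_nat leq_divM.
    have xt2 : (x k <= t (k %/ m.+1) + T / n%:R)%R.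
      rewrite -gridS xk /grid /N natrM ler_pdivrMr ?mulr_gt0 ?ltr0n//.
      have -> : ((k %/ m.+1).+1%:R * T / n%:R * (n%:R * m.+1%:R) = (k %/ m.+1).+1%:R * m.+1%:R * T :> R)%R.
        by field; rewrite gt_eqF.
      by rewrite ler_wpM2r ?(ltW T_gt0)// -natrM ler_nat ltnW// ltn_ceil.
    have tjj : (t j.-1 <= s)%R by apply: le_trans tjs; apply: grid_le; exact: leq_pred.
    by rewrite ler_norml; lra.
  + rewrite xJ {1}/x part0// subr0.
    have h1 : (t j `^ (2 * H) <= KT)%R by apply: KT_mono; exact: grid_itv.
    have -> : ((3 * (alpha * T) / n%:R) ^+ 2 = 9 * (alpha * T) ^+ 2 * n%:R ^- 2)%R.
      by field; rewrite gt_eqF.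
    apply: (@le_trans _ _ (9 * (alpha * T) ^+ 2 * nu * KT)%R).
      have q9 : (0 <= 9 * (alpha * T) ^+ 2)%R by apply: mulr_ge0 => //; exact: sqr_ge0.
      apply: ler_pM; [|exact: powR_ge0|exact: ler_wpM2l|exact: h1].
      by apply: mulr_ge0 => //; rewrite invr_ge0 exprn_ge0.
    have := mulr_ge0 (sqr_ge0 Y0) (sqr_ge0 (alpha * T)%R).
    have := KT0; have := nu0.
    rewrite /K1; set q := ((alpha * T) ^+ 2)%R => nu_0 KT_0 Yq.
    have := mulr_gt0 KT_0 nu_0; have := mulr_ge0 Yq (ltW nu_0); lra.
- apply: (@fbm_incr_sum_subgaussian _ _ _ _ _ _ _ hB H12 _ _ _ _ _ _ 1%R) => //.
  + by rewrite addn0 xJ grid_ge0.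
  + by rewrite (le_trans (part_ub _ _ _)).
  + by move=> k _; apply: part_le; rewrite addnS.
  + by move=> k _; apply: wt_le1; exact: part_ub.
  + rewrite expr1n mul1r subnKC// addn0 xJ {1}/x part_last//.
    apply: (@le_trans _ _ ((T / n%:R) `^ (2 * H))%R).
      by apply: powR_le => //; rewrite subr_ge0.
    rewrite nu_powR ler_pM2r// /K1.
    have := sqr_ge0 (alpha * T)%R; set q := (_ ^+ 2)%R => q0.
    have := mulr_ge0 (sqr_ge0 Y0) q0; have := mulr_ge0 (ltW KT0) q0; lra.
Qed.

End fractional_OU.

(** Beyond [r] one has x^{2 - a} >= (l + 1) / e and the quadratic term wins; below [r] the constant
    suffices. *)
Lemma powR_le_quadratic (R : realType) (a l e : R) : 0 <= a < 2 -> 0 <= l -> 0 < e ->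
  exists2 C : R, 0 <= C & forall x : R, 0 <= x -> l * x `^ a <= e * x ^+ 2 + C.
Proof.
move=> /andP[a0 a2] l0 e0.
have a2' : 2 - a != 0 by lra.
have l1 : 0 < (l + 1) / e by rewrite divr_gt0//; lra.
pose r := ((l + 1) / e) `^ (2 - a)^-1.
have r0 : 0 < r by exact: powR_gt0.
exists (l * r `^ a) => [|x x0]; first by rewrite mulr_ge0// powR_ge0.
have [xr|rx] := leP x r.
  apply: (@le_trans _ _ (l * r `^ a)); last by rewrite lerDr mulr_ge0 ?sqr_ge0// ltW.
  by rewrite ler_wpM2l//; apply: ge0_ler_powR; rewrite ?nnegrE ?(ltW r0).
have xgt0 : 0 < x by lra.
have h : (l + 1) / e <= x `^ (2 - a).
  have -> : (l + 1) / e = r `^ (2 - a) by rewrite /r -powRrM mulVf// powRr1// ltW.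
  by apply: ge0_ler_powR; rewrite ?nnegrE ?(ltW r0) ?(ltW rx)//; lra.
rewrite ler_pdivrMr// in h.
have -> : x ^+ 2 = x `^ (2 - a) * x `^ a.
  rewrite -powRD; last by apply/implyP => _; rewrite gt_eqF.
  by rewrite subrK powR_mulrn.
have h1 := ler_wpM2r (powR_ge0 x a) h.
have h2 := powR_ge0 x a.
have h3 : 0 <= l * r `^ a by rewrite mulr_ge0// powR_ge0.
lra.
Qed.

Lemma sqr_le_expR (R : realType) (u : R) : 0 <= u -> u ^+ 2 <= 2 * expR u.
Proof.
move=> u0; have h : 1 + u ^+ 2 / 2 <= expR u by have := expR_ge1Dxn 1 u0.
lra.
Qed.

Section integral_tangent.
Local Open Scope ereal_scope.
Context {R : realType}.
Notation mu := (@lebesgue_measure R).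

(* Jensen's inequality, from a supporting line of slope [k] at the mean. *)
Lemma jensen_tangent (T k : R) (h psi : R -> R) : (0 < T)%R ->
  mu.-integrable `[0%R, T] (EFin \o h) -> measurable_fun [set: R] psi ->
  (forall x, 0 <= psi x)%R ->
  let a := (\int[mu]_(s in `[0%R, T]) h s / T)%R in
  (forall x, psi a + k * (x - a) <= psi x)%R ->
  (T * psi a)%:E <= \int[mu]_(s in `[0%R, T]) (psi (h s))%:E.
Proof.
move=> T0 ih mpsi psi0 a tan.
have mD : measurable (`[0%R, T]%classic : set (measurableTypeR R)) by exact: measurable_itv.
have mh : measurable_fun (`[0%R, T]%classic : set R) h.
  by apply/measurable_EFinP; exact: (measurable_int mu).
have mph : measurable_fun (`[0%R, T]%classic : set R) (fun s => (psi (h s))%:E).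
  apply/measurable_EFinP.
  by apply: (measurable_comp measurableT) => //.
have muD : mu (`[0%R, T]%classic : set (measurableTypeR R)) = T%:E.
  by rewrite lebesgue_measure_itv/= lte_fin T0 sube0.
(* A nonnegative function that is not integrable has integral +oo, so that case is immediate. *)
have [iph|] := boolP (`[< mu.-integrable `[0%R, T] (fun s => (psi (h s))%:E) >]); last first.
  move/asboolP => niph; suff -> : \int[mu]_(s in `[0%R, T]) (psi (h s))%:E = +oo by rewrite leey.
  apply/eqP; rewrite -leye_eq leNgt; apply/negP => fin; apply: niph.
  apply/integrableP; split => //.
  by under eq_integral do rewrite gee0_abs ?lee_fin//.
move/asboolP in iph.
have icstE (c : R) : \int[mu]_(_ in `[0%R, T]) c%:E = (c * T)%:E.
  apply: (etrans (integral_cst mu mD c%:E)); rewrite EFinM.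
  by congr (_ * _); exact: muD.
have icst (c : R) : mu.-integrable `[0%R, T] (EFin \o cst c).
  apply/integrableP; split; first by apply/measurable_EFinP; apply: measurable_cst.
  under eq_integral do rewrite /=.
  by rewrite icstE ltry.
have ilin : mu.-integrable `[0%R, T] (EFin \o (fun s => psi a - k * a + k * h s)%R).
  have -> : EFin \o (fun s => psi a - k * a + k * h s)%R =
      (fun s => (EFin \o cst (psi a - k * a)%R) s + (k%:E * (EFin \o h) s)).
    by apply/funext => s /=; rewrite EFinD EFinM.
  by apply: integrableD => //; apply: integrableZl.
have -> : (T * psi a)%:E = \int[mu]_(s in `[0%R, T]) (psi a - k * a + k * h s)%:E.
  under eq_integral do rewrite EFinD EFinM.
  rewrite integralD//; last first.
  - exact: integrableZl.
  - exact: icst.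
  rewrite integralZl// icstE.
  rewrite -(@fineK _ (\int[mu]_(x in `[0%R, T]) (h x)%:E)); last exact: integrable_fin_num.
  rewrite -EFinM -EFinD; congr (_%:E).
  have -> : fine (\int[mu]_(x in `[0%R, T]) (h x)%:E) = (a * T)%R by rewrite /a divfK// gt_eqF.
  ring.
apply: le_integral => //.
by move=> s _; rewrite lee_fin; have := tan (h s); lra.
Qed.

End integral_tangent.

(** * Pathwise comparison of the total variances *)

Section path_functional.
Local Open Scope ereal_scope.
Context {R : realType}.
Notation mu := (@lebesgue_measure R).
Variables (T N c smin2 : R) (u v : R -> R).
Hypotheses (T0 : (0 < T)%R) (N0 : (0 < N)%R) (c0 : (0 < c)%R) (s0 : (0 <= smin2)%R).
Hypotheses (mu_ : measurable_fun (`[0%R, T]%classic : set R) u)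
           (mv_ : measurable_fun (`[0%R, T]%classic : set R) v).
Hypotheses (us : forall x, (smin2 <= u x)%R) (vs : forall x, (smin2 <= v x)%R).

Definition path_weight (l : R) (s : R) : R :=
  ((N * (u s - v s)) ^+ 2 + expR (l * u s) + expR (l * v s))%R.

(** Jensen's inequality sees the average V / T, and l V / T = 2 c V. The 2 allows e^{c V} to be
    squared in Young's inequality. *)
Let l : R := (2 * c * T)%R.
Let l0 : (0 < l)%R. Proof. by rewrite !mulr_gt0. Qed.
Let Q := \int[mu]_(s in `[0%R, T]) (path_weight l s)%:E.
Let V := (\int[mu]_(s in `[0%R, T]) u s)%R.
Let W := (\int[mu]_(s in `[0%R, T]) v s)%R.

Let mD : measurable (`[0%R, T]%classic : set (measurableTypeR R)).
Proof. exact: measurable_itv. Qed.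

Let mexp (f : R -> R) : measurable_fun (`[0%R, T]%classic : set R) f ->
  measurable_fun (`[0%R, T]%classic : set R) (fun s => (expR (l * f s))%:E).
Proof.
move=> mf; apply/measurable_EFinP; apply: measurableT_comp => //.
exact: measurable_funM.
Qed.

Let mdiff : measurable_fun (`[0%R, T]%classic : set R) (fun s => ((N * (u s - v s)) ^+ 2)%:E).
Proof.
apply/measurable_EFinP; apply: measurable_funX; apply: measurable_funM => //.
exact: measurable_funB.
Qed.

Let mpw : measurable_fun (`[0%R, T]%classic : set R) (fun s => (path_weight l s)%:E).
Proof.
rewrite (_ : (fun s => (path_weight l s)%:E) = (fun s =>
  ((N * (u s - v s)) ^+ 2)%:E + (expR (l * u s))%:E + (expR (l * v s))%:E)); last first.
  by apply/funext => s; rewrite -!EFinD.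
by apply: emeasurable_funD; [apply: emeasurable_funD; [exact: mdiff|exact: mexp]|exact: mexp].
Qed.

Let pw_ge (s : R) : [/\ (0 <= path_weight l s)%R, ((N * (u s - v s)) ^+ 2 <= path_weight l s)%R,
  (expR (l * u s) <= path_weight l s)%R & (expR (l * v s) <= path_weight l s)%R].
Proof.
rewrite /path_weight; have := expR_ge0 (l * u s); have := expR_ge0 (l * v s).
have := sqr_ge0 (N * (u s - v s))%R; set x := (_ ^+ 2)%R => *; split; lra.
Qed.

Let sub_Q (f : R -> R) : (forall s, 0 <= f s <= path_weight l s)%R ->
  measurable_fun (`[0%R, T]%classic : set R) (fun s => (f s)%:E) ->
  \int[mu]_(s in `[0%R, T]) (f s)%:E <= Q.
Proof.
move=> fQ mf; apply: ge0_le_integral => //.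
- by move=> s _; rewrite lee_fin; have /andP[] := fQ s.
- by move=> s _; rewrite lee_fin; have /andP[] := fQ s.
Qed.

(** The factor 1 + 1/l makes room for u <= l^{-1} e^{l u}, which bounds the paths themselves by the
    weight. *)
Let fin_integrable (f : R -> R) : Q < +oo -> (forall s, 0 <= f s)%R ->
  (forall s, f s <= (1 + l^-1) * path_weight l s)%R ->
  measurable_fun (`[0%R, T]%classic : set R) f ->
  mu.-integrable `[0%R, T] (EFin \o f).
Proof.
move=> Qoo f0 fQ mf.
have l10 : (0 <= 1 + l^-1)%R by rewrite addr_ge0// invr_ge0 ltW.
apply/integrableP; split; first exact/measurable_EFinP.
apply: (@le_lt_trans _ _ (\int[mu]_(s in `[0%R, T]) ((1 + l^-1)%:E * (path_weight l s)%:E))).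
  apply: ge0_le_integral => //.
  - by apply: measurableT_comp => //; exact/measurable_EFinP.
  - by apply: emeasurable_funM => //; exact: mpw.
  - by move=> s _ /=; rewrite ger0_norm// -EFinM lee_fin.
rewrite ge0_integralZl//; last first.
- by move=> s _; rewrite lee_fin; have [] := pw_ge s.
by apply: lte_mul_pinfty => //; rewrite ?lee_fin.
Qed.

Let u_le s : (u s <= (1 + l^-1) * path_weight l s)%R.
Proof.
have [h0 _ h _] := pw_ge s; have := expR_ge1Dx (l * u s)%R => h1.
have h2 : (u s = l^-1 * (l * u s))%R by rewrite mulKf// gt_eqF.
have : (l^-1 * (l * u s) <= l^-1 * path_weight l s)%R.
  by rewrite ler_wpM2l// ?invr_ge0 ?(ltW l0)//; lra.
rewrite -h2; lra.
Qed.

Let v_le s : (v s <= (1 + l^-1) * path_weight l s)%R.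
Proof.
have [h0 _ _ h] := pw_ge s; have := expR_ge1Dx (l * v s)%R => h1.
have h2 : (v s = l^-1 * (l * v s))%R by rewrite mulKf// gt_eqF.
have : (l^-1 * (l * v s) <= l^-1 * path_weight l s)%R.
  by rewrite ler_wpM2l// ?invr_ge0 ?(ltW l0)//; lra.
rewrite -h2; lra.
Qed.

Let iu : Q < +oo -> mu.-integrable `[0%R, T] (EFin \o u).
Proof.
by move=> Qoo; apply: fin_integrable => //; move=> s; first [exact: u_le|exact: le_trans (us s)].
Qed.

Let iv : Q < +oo -> mu.-integrable `[0%R, T] (EFin \o v).
Proof.
by move=> Qoo; apply: fin_integrable => //; move=> s; first [exact: v_le|exact: le_trans (vs s)].
Qed.

Let lb (f : R -> R) : mu.-integrable `[0%R, T] (EFin \o f) -> (forall x, smin2 <= f x)%R ->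
  (smin2 * T <= \int[mu]_(s in `[0%R, T]) f s)%R.
Proof.
move=> if_ fs; rewrite -lee_fin /Rintegral fineK; last exact: integrable_fin_num.
have -> : (smin2 * T)%:E = \int[mu]_(s in `[0%R, T]) cst smin2%:E s.
  by rewrite integral_cst//= lebesgue_measure_itv/= lte_fin T0 sube0 EFinM.
apply: ge0_le_integral => //.
- exact: (measurable_int mu).
- by move=> s _; rewrite lee_fin.
Qed.

Lemma path_lower_bound : Q < +oo -> (smin2 * T <= V)%R /\ (smin2 * T <= W)%R.
Proof. by move=> Qoo; split; apply: lb => //; [exact: iu|exact: iv]. Qed.

Let exp_bound (f : R -> R) : mu.-integrable `[0%R, T] (EFin \o f) ->
  (T * expR (2 * c * \int[mu]_(s in `[0%R, T]) f s))%:E <=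
  \int[mu]_(s in `[0%R, T]) (expR (l * f s))%:E.
Proof.
move=> if_.
set a := (\int[mu]_(s in `[0%R, T]) f s / T)%R.
have -> : (2 * c * \int[mu]_(s in `[0%R, T]) f s = l * a)%R.
  by rewrite /l /a; field; rewrite gt_eqF.
apply: (@jensen_tangent _ T (l * expR (l * a)) f (fun x => expR (l * x))%R) => //.
  by apply: measurableT_comp => //; exact: measurable_funM.
move=> x; rewrite -/a.
have -> : (expR (l * x) = expR (l * a) * expR (l * (x - a)))%R.
  by rewrite -expRD; congr expR; ring.
have := ler_wpM2l (expR_ge0 (l * a)) (expR_ge1Dx (l * (x - a))%R); lra.
Qed.

Let sqr_bound : Q < +oo ->
  (T^-1 * (N * (V - W)) ^+ 2)%:E <= \int[mu]_(s in `[0%R, T]) ((N * (u s - v s)) ^+ 2)%:E.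
Proof.
move=> Qoo.
have iuv : mu.-integrable `[0%R, T] (EFin \o (fun s => N * (u s - v s))%R).
  have -> : EFin \o (fun s => N * (u s - v s))%R = (fun s => N%:E * ((EFin \o u) s - (EFin \o v) s)).
    by apply/funext => s.
  by apply: integrableZl => //; apply: integrableB => //; [exact: iu|exact: iv].
have VW : (\int[mu]_(s in `[0%R, T]) (N * (u s - v s)) = N * (V - W))%R.
  rewrite RintegralZl//; last first.
    have -> : EFin \o (fun s => (u s - v s))%R = (fun s => ((EFin \o u) s - (EFin \o v) s)).
      by apply/funext => s.
    by apply: integrableB => //; [exact: iu|exact: iv].
  by rewrite RintegralB//; [exact: iu|exact: iv].
set a := (\int[mu]_(s in `[0%R, T]) (N * (u s - v s)) / T)%R.
have -> : (T^-1 * (N * (V - W)) ^+ 2 = T * a ^+ 2)%R.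
  by rewrite /a VW; field; rewrite gt_eqF.
apply: (@jensen_tangent _ T (2 * a) _ (fun x => x ^+ 2)%R T0 iuv) => //.
  by move=> x; exact: sqr_ge0.
move=> x; rewrite -/a.
have := sqr_ge0 (x - a)%R; rewrite sqrrB; lra.
Qed.

Let KT : R := (T + T^-1)%R.

Let KT_l (x : R) (y : \bar R) : (0 <= x)%R -> (T * x)%:E <= y -> x%:E <= (T^-1)%:E * y.
Proof.
move=> x0 h; have -> : x%:E = (T^-1)%:E * (T * x)%:E by rewrite -EFinM mulKf// gt_eqF.
by apply: lee_wpmul2l => //; rewrite lee_fin invr_ge0 ltW.
Qed.

Let Q0 : 0 <= Q.
Proof. by apply: integral_ge0 => s _; rewrite lee_fin; have [] := pw_ge s. Qed.

Let Ti0 : (0 < T^-1)%R. Proof. by rewrite invr_gt0. Qed.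

Lemma path_exp_le : Q < +oo ->
  (expR (2 * c * V))%:E <= (T^-1)%:E * Q /\ (expR (2 * c * W))%:E <= (T^-1)%:E * Q.
Proof.
move=> Qoo; split; apply: KT_l; rewrite ?expR_ge0//.
  apply: le_trans (exp_bound (iu Qoo)) _; apply: sub_Q; last exact: mexp.
  by move=> s; rewrite expR_ge0/=; have [] := pw_ge s.
apply: le_trans (exp_bound (iv Qoo)) _; apply: sub_Q; last exact: mexp.
by move=> s; rewrite expR_ge0/=; have [] := pw_ge s.
Qed.

(** Young's inequality y e <= y^2 + e^2 with y = N |V - W| and e = e^{c V} or e^{c W}. By Jensen the
    squares are at most T Q and Q / T, whence the constant T + 1/T. *)
Lemma path_diff_le : Q < +oo ->
  (N * `|V - W| * expR (c * V))%:E <= KT%:E * Q /\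
  (N * `|V - W| * expR (c * W))%:E <= KT%:E * Q.
Proof.
move=> Qoo; have [hV hW] := path_exp_le Qoo.
have hS : ((N * (V - W)) ^+ 2)%:E <= T%:E * Q.
  have -> : ((N * (V - W)) ^+ 2)%:E = T%:E * (T^-1 * (N * (V - W)) ^+ 2)%:E.
    by rewrite -EFinM mulVKf// gt_eqF.
  apply: lee_wpmul2l; first by rewrite lee_fin ltW.
  apply: le_trans (sqr_bound Qoo) _; apply: sub_Q; last exact: mdiff.
  by move=> s; rewrite sqr_ge0/=; have [] := pw_ge s.
have key (x : R) : (expR (2 * c * x))%:E <= (T^-1)%:E * Q ->
    (N * `|V - W| * expR (c * x))%:E <= KT%:E * Q.
  move=> hx; rewrite /KT EFinD ge0_muleDl ?lee_fin ?(ltW T0) ?(ltW Ti0)//.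
  apply: le_trans (leeD hS hx); rewrite -EFinD lee_fin.
  have -> : (expR (2 * c * x) = expR (c * x) ^+ 2)%R.
    by rewrite -expRM_natl; congr expR; rewrite mulr_natl; ring.
  have -> : ((N * (V - W)) ^+ 2 = (N * `|V - W|) ^+ 2)%R.
    by rewrite !exprMn real_normK ?num_real.
  have y0 : (0 <= N * `|V - W|)%R by rewrite mulr_ge0// ltW.
  have e0 := expR_ge0 (c * x).
  set y := (N * `|V - W|)%R in y0 *; set e := expR _ in e0 *.
  have := sqr_ge0 (y - e)%R; rewrite sqrrB; have := sqr_ge0 y; have := sqr_ge0 e; lra.
by split; exact: key.
Qed.

End path_functional.

(** * Bounds on the squared volatility and its moments *)

Section volatility.
Context {R : realType}.
Variables (sigma : R -> R) (Csigma smin q r q' : R).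
Hypothesis hB : condition_B sigma Csigma smin q r q'.

Lemma vol_gt0 x : 0 < sigma x.
Proof. exact: lt_le_trans (condB_smin_gt0 hB) (condB_ge_smin hB x). Qed.

Lemma measurable_vol : measurable_fun [set: R] sigma.
Proof. by apply: continuous_measurable_fun; exact: condB_continuous hB. Qed.

(** The growth exponent of sigma^2 is 2q < 2, so any multiple of sigma^2 is absorbed by an
    arbitrarily small multiple of x^2; this is what makes all exponential moments finite. *)
Lemma vol_sqr_le l e : 0 <= l -> 0 < e ->
  exists2 C : R, 0 <= C & forall x, l * sigma x ^+ 2 <= e * x ^+ 2 + C.
Proof.
move=> l0 e0.
have /andP[q0 q1] := condB_q hB; have C0 := condB_C_gt0 hB.
have lC0 : 0 <= l * (2 * Csigma ^+ 2) by rewrite mulr_ge0// mulr_ge0// sqr_ge0.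
have q20 : 0 <= q * 2 < 2 by lra.
have [C C00 hC] := powR_le_quadratic q20 lC0 e0.
exists (C + l * (2 * Csigma ^+ 2)) => [|x]; first by rewrite addr_ge0.
have h1 := condB_growth hB x; have h2 := vol_gt0 x; have h3 := powR_ge0 `|x| q.
have h4 : sigma x ^+ 2 <= 2 * Csigma ^+ 2 * (1 + `|x| `^ (q * 2)).
  have -> : `|x| `^ (q * 2) = (`|x| `^ q) ^+ 2 by rewrite powRrM powR_mulrn.
  apply: (@le_trans _ _ ((Csigma * (1 + `|x| `^ q)) ^+ 2)).
    by rewrite lerXn2r// nnegrE; [exact: ltW|rewrite mulr_ge0 ?addr_ge0// ltW].
  set y := _ `^ q in h3 *; rewrite exprMn.
  have -> : 2 * Csigma ^+ 2 * (1 + y ^+ 2) = Csigma ^+ 2 * (2 * (1 + y ^+ 2)) by ring.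
  by rewrite ler_wpM2l ?sqr_ge0//; have := sqr_ge0 (y - 1); rewrite sqrrB; lra.
have := ler_wpM2l l0 h4; have := hC `|x| (normr_ge0 x); rewrite real_normK ?num_real//.
set t := _ `^ _; lra.
Qed.

(* With k = n^H one has N = n^{rH} = k^r, and k |y - y'| has Gaussian size when
   y, y' are the values of the Ornstein-Uhlenbeck process and of its discretization. *)
Lemma vol_sqr_diff_le (k K y y' : R) : 0 <= k -> 0 < K ->
  (k `^ r * (sigma y ^+ 2 - sigma y' ^+ 2)) ^+ 2 <=
  Csigma ^+ 2 * (4 + 128 * K ^+ 2 * expR ((k * (y - y')) ^+ 2 / (4 * K)) +
                 8 * (expR (sigma y ^+ 2) + expR (sigma y' ^+ 2))).
Proof.
move=> k0 K0.
have /andP[r0 r1] := condB_r hB; have C0 := condB_C_gt0 hB.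
set x := k * `|y - y'|; have x0 : 0 <= x by rewrite mulr_ge0.
have xr : x `^ r <= 1 + x.
  have [x1|x1] := leP x 1.
    apply: (@le_trans _ _ 1); last lra.
    apply: (@le_trans _ _ (1 `^ r)); last by rewrite powR1.
    apply: ge0_ler_powR => //; rewrite ?nnegrE//; lra.
  apply: (@le_trans _ _ x); last lra.
  rewrite -[leRHS]powRr1//; apply: ler_powR => //; lra.
have h1 : `|k `^ r * (sigma y - sigma y')| <= Csigma * (1 + x).
  rewrite normrM ger0_norm ?powR_ge0//.
  apply: (@le_trans _ _ (k `^ r * (Csigma * `|y - y'| `^ r))).
    by rewrite ler_wpM2l ?powR_ge0//; exact: (condB_holder hB).
  by rewrite mulrCA -powRM// ler_wpM2l// ltW.
set s := sigma y; set s' := sigma y'.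
have s0 : 0 < s := vol_gt0 y; have s'0 : 0 < s' := vol_gt0 y'.
have h2 : (k `^ r * (s ^+ 2 - s' ^+ 2)) ^+ 2 <= Csigma ^+ 2 * ((1 + x) ^+ 2 * (s + s') ^+ 2).
  have -> : (k `^ r * (s ^+ 2 - s' ^+ 2)) ^+ 2 =
    `|k `^ r * (s - s')| ^+ 2 * (s + s') ^+ 2 by rewrite real_normK ?num_real//; ring.
  rewrite mulrA ler_wpM2r ?sqr_ge0// -exprMn lerXn2r// nnegrE.
  by rewrite mulr_ge0// ?addr_ge0// ltW.
apply: (le_trans h2); rewrite ler_wpM2l ?sqr_ge0//.
have -> : (k * (y - y')) ^+ 2 = x ^+ 2 by rewrite /x !exprMn real_normK ?num_real.
set E := expR (x ^+ 2 / (4 * K)).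
have hE : x ^+ 4 <= 32 * K ^+ 2 * E.
  have u0 : 0 <= x ^+ 2 / (4 * K) by rewrite divr_ge0 ?sqr_ge0// mulr_ge0// ltW.
  have := ler_wpM2l (sqr_ge0 (4 * K)) (sqr_le_expR u0); rewrite -/E.
  have -> : (4 * K) ^+ 2 * (x ^+ 2 / (4 * K)) ^+ 2 = x ^+ 4 by field; rewrite gt_eqF.
  have -> : (4 * K) ^+ 2 * (2 * E) = 32 * K ^+ 2 * E by ring.
  by [].
have he := sqr_le_expR (sqr_ge0 s); have he' := sqr_le_expR (sqr_ge0 s').
(* Young's inequality separates x from the volatilities, and (a + b)^4 <= 8 (a^4 + b^4) follows.
   With x^4 <= 32 K^2 E and s^4 <= 2 e^{s^2} the constants are 8/2 = 4, 8 * 32 / 2 = 128 and 8 * 2 /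
   2 = 8. *)
have := sqr_ge0 ((1 + x) ^+ 2 - (s + s') ^+ 2); rewrite sqrrB => h3.
have h4 : ((1 + x) ^+ 2) ^+ 2 <= 8 * (1 + x ^+ 4).
  rewrite -subr_ge0; have -> : 8 * (1 + x ^+ 4) - ((1 + x) ^+ 2) ^+ 2 =
     (x - 1) ^+ 2 * (7 * x ^+ 2 + 10 * x + 7) by ring.
  by rewrite mulr_ge0 ?sqr_ge0//; have := sqr_ge0 x; lra.
have h5 : ((s + s') ^+ 2) ^+ 2 <= 8 * ((s ^+ 2) ^+ 2 + (s' ^+ 2) ^+ 2).
  rewrite -subr_ge0; have -> : 8 * ((s ^+ 2) ^+ 2 + (s' ^+ 2) ^+ 2) - ((s + s') ^+ 2) ^+ 2 =
     (s - s') ^+ 2 * (7 * s ^+ 2 + 10 * s * s' + 7 * s' ^+ 2) by ring.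
  rewrite mulr_ge0 ?sqr_ge0// !addr_ge0// ?mulr_ge0 ?sqr_ge0// ltW//.
lra.
Qed.

End volatility.

Section moment_bounds.
Local Open Scope ereal_scope.
Context {R : realType} {d : measure_display} {Omega : measurableType d}.
Variable P : probability Omega R.

(** Measurability and sign travel with the bound, so that moment bounds can be added and scaled
    without separate side conditions. *)
Definition moment_le (f : Omega -> R) (C : R) : Prop :=
  [/\ measurable_fun setT f, (forall w, (0 <= f w)%R) & \int[P]_w (f w)%:E <= C%:E].

Lemma moment_le_cst c : (0 <= c)%R -> moment_le (cst c) c.
Proof.
move=> c0; split=> //; suff -> : \int[P]_w (cst c w)%:E = c%:E by [].
apply: (etrans (integral_cst P measurableT c%:E)).
by rewrite -[RHS]mule1; congr (_ * _); exact: probability_setT.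
Qed.

Lemma moment_leD f g A B : moment_le f A -> moment_le g B -> moment_le (f \+ g)%R (A + B)%R.
Proof.
move=> [mf f0 fA] [mg g0 gB]; split; first exact: measurable_funD.
- by move=> w; rewrite addr_ge0.
under eq_integral do rewrite EFinD.
rewrite ge0_integralD//; try by [exact/measurable_EFinP|move=> w _; rewrite lee_fin].
by rewrite EFinD; exact: leeD.
Qed.

Lemma moment_leZ c f A : (0 <= c)%R -> moment_le f A -> moment_le (c \*o f)%R (c * A)%R.
Proof.
move=> c0 [mf f0 fA]; split; first exact: measurable_funM.
- by move=> w; rewrite mulr_ge0.
under eq_integral do rewrite EFinM.
rewrite ge0_integralZl//; try by [exact/measurable_EFinP|move=> *; rewrite lee_fin].
by rewrite EFinM; apply: lee_wpmul2l; rewrite ?lee_fin.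
Qed.

Lemma moment_le_trans (f g : Omega -> R) A : moment_le g A -> measurable_fun setT f ->
  (forall w, (0 <= f w <= g w)%R) -> moment_le f A.
Proof.
move=> [mg g0 gA] mf fg; split=> // [w|]; first by have /andP[] := fg w.
apply: le_trans gA; apply: ge0_le_integral => //.
- by move=> w _; rewrite lee_fin; have /andP[] := fg w.
- exact/measurable_EFinP.
- exact/measurable_EFinP.
- by move=> w _; rewrite lee_fin; have /andP[] := fg w.
Qed.

End moment_bounds.

Section volatility_moments.
Local Open Scope ereal_scope.
Context {R : realType} {d : measure_display} {Omega : measurableType d}.
Variable P : probability Omega R.
Variables (sigma : R -> R) (Csigma smin q r q' : R).
Hypothesis hB : condition_B sigma Csigma smin q r q'.

Let measurable_expvol l (Z : Omega -> R) : measurable_fun setT Z ->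
  measurable_fun setT (fun w => expR (l * sigma (Z w) ^+ 2)).
Proof.
move=> mZ; apply: measurableT_comp => //; apply: measurable_funM => //; apply: measurable_funX.
by apply: measurableT_comp => //; exact: measurable_vol hB.
Qed.

Lemma subgaussian_moment K Z : subgaussian P K Z ->
  moment_le P (fun w => expR (Z w ^+ 2 / (4 * K))) 2.
Proof.
move=> [mZ hZ]; split=> //.
by apply/measurable_EFinP; exact: measurable_expR_sqr.
Qed.

(** [vol_sqr_le] with e = 1 / (4K) bounds e^{l sigma^2(Z)} by a constant times e^{Z^2 / (4K)}; the
    constant is the same for all [Z] of parameter [K]. *)
Lemma subgaussian_expR_vol l K : (0 <= l)%R -> (0 < K)%R ->
  exists2 C : R, (0 <= C)%R & forall Z, subgaussian P K Z ->
    moment_le P (fun w => expR (l * sigma (Z w) ^+ 2)) C.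
Proof.
move=> l0 K0.
have e0 : (0 < (4 * K)^-1)%R by rewrite invr_gt0 mulr_gt0.
have [C C0 hC] := vol_sqr_le hB l0 e0.
exists (expR C * 2)%R; first by rewrite mulr_ge0 ?expR_ge0.
move=> Z hZ; apply: moment_le_trans (moment_leZ (expR_ge0 C) (subgaussian_moment hZ)) _ _.
  by apply: measurable_expvol; have [] := hZ.
move=> w; rewrite expR_ge0/= -expRD ler_expR.
by have := hC (Z w); rewrite [(_^-1 * _)%R]mulrC addrC.
Qed.

Lemma path_weight_expectation_le l H K1 K2 : (0 <= l)%R -> (0 < K1)%R -> (0 < K2)%R ->
  exists2 C : R, (0 <= C)%R & forall n Z Z', (0 < n)%N ->
    subgaussian P K1 Z -> subgaussian P K1 Z' ->
    subgaussian P (K2 * n%:R `^ (- (2 * H))) (fun w => Z w - Z' w)%R ->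
    \int[P]_w (((n%:R `^ (r * H) * (sigma (Z w) ^+ 2 - sigma (Z' w) ^+ 2)) ^+ 2 +
      expR (l * sigma (Z w) ^+ 2) + expR (l * sigma (Z' w) ^+ 2))%:E) <= C%:E.
Proof.
move=> l0 K10 K20.
have [Cl Cl0 hl] := subgaussian_expR_vol l0 K10.
have [C1 C10 h1] := subgaussian_expR_vol ler01 K10.
have S0 := sqr_ge0 Csigma; set S := (Csigma ^+ 2)%R in S0.
have K220 := sqr_ge0 K2.
have c0 : (0 <= S * (128 * K2 ^+ 2))%R by apply: mulr_ge0; lra.
have S40 : (0 <= S * 4)%R by lra.
have S80 : (0 <= S * 8)%R by lra.
exists (S * 4 + S * (128 * K2 ^+ 2) * 2 + S * 8 * (C1 + C1) + (Cl + Cl))%R.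
  by have := mulr_ge0 S80 C10; lra.
move=> n Z Z' n0 hZ hZ' hD.
have n0R : (0 < n%:R :> R)%R by rewrite ltr0n.
have mE := moment_leD (moment_leD (moment_leD (moment_le_cst P S40)
  (moment_leZ c0 (subgaussian_moment hD))) (moment_leZ S80 (moment_leD (h1 _ hZ) (h1 _ hZ'))))
  (moment_leD (hl _ hZ) (hl _ hZ')).
have [mZ _] := hZ; have [mZ' _] := hZ'.
have [] := moment_le_trans mE (f := fun w => ((n%:R `^ (r * H) *
  (sigma (Z w) ^+ 2 - sigma (Z' w) ^+ 2)) ^+ 2 +
  expR (l * sigma (Z w) ^+ 2) + expR (l * sigma (Z' w) ^+ 2))%R) _ _ => //.
  apply: measurable_funD; first apply: measurable_funD; try exact: measurable_expvol.
  apply: measurable_funX; apply: measurable_funM => //.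
  by apply: measurable_funB; apply: measurable_funX; apply: measurableT_comp => //;
    exact: measurable_vol hB.
move=> w; rewrite !addr_ge0 ?expR_ge0 ?sqr_ge0//= -addrA lerD2r !mul1r.
have := vol_sqr_diff_le hB (Z w) (Z' w) (powR_ge0 n%:R H) K20.
rewrite -powRrM [(H * r)%R]mulrC -/S.
(* Rescaling by n^H exactly cancels the n^{-2H} of the variance, so the final bound is free of n. *)
have -> : ((n%:R `^ H * (Z w - Z' w)) ^+ 2 / (4 * K2) =
   (Z w - Z' w) ^+ 2 / (4 * (K2 * n%:R `^ (- (2 * H)))))%R.
  have -> : (n%:R `^ (- (2 * H)) = (n%:R `^ H ^+ 2)^-1 :> R)%R.
    by rewrite powRN mulrC powRrM powR_mulrn// powR_ge0.
  have nH0 : (0 < n%:R `^ H :> R)%R by exact: powR_gt0.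
  by field; rewrite !gt_eqF.
by move=> h; apply: (le_trans h); rewrite le_eqVlt; apply/orP; left; apply/eqP; ring.
Qed.

End volatility_moments.

(** * The time grid and joint measurability in time and chance *)

Section grid_steps.
Context {R : realType} {d : measure_display} {Omega : measurableType d}.
Variables (T alpha Y0 : R) (B : R -> Omega -> R) (n : nat).
Hypotheses (T_gt0 : 0 < T) (n_gt0 : (0 < n)%N).

Let n0 : 0 < n%:R :> R. Proof. by rewrite ltr0n. Qed.

Lemma grid_le_index i s : (grid T n i <= s) = (i%:R <= s * n%:R / T).
Proof. by rewrite /grid ler_pdivrMr// ler_pdivlMr. Qed.

Lemma grid_gt_index i s : (s < grid T n i) = (s * n%:R / T < i%:R).
Proof. by rewrite ltNge grid_le_index -ltNge. Qed.

Let index_ge0 s : 0 <= s -> 0 <= s * n%:R / T.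
Proof. by move=> s0; rewrite divr_ge0 ?mulr_ge0// ltW. Qed.

Lemma grid_truncn s : 0 <= s ->
  grid T n (Num.truncn (s * n%:R / T)) <= s < grid T n (Num.truncn (s * n%:R / T)).+1.
Proof.
by move=> s0; rewrite grid_le_index grid_gt_index; exact: truncn_itv (index_ge0 s0).
Qed.

Lemma truncn_le_grid s : 0 <= s <= T -> (Num.truncn (s * n%:R / T) <= n)%N.
Proof.
move=> /andP[s0 sT]; rewrite -ltnS truncn_lt_nat ?index_ge0//.
by rewrite -grid_gt_index gridS grid_last//; have : 0 < T / n%:R; [exact: divr_gt0|lra].
Qed.

Lemma step_eval_Yn (g : R -> R) j s w : 0 <= s < grid T n j ->
  step_eval (Yn_step T alpha Y0 B n g j) s w = g (Yn T alpha Y0 B n s w).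
Proof.
move=> /andP[s0 sj]; rewrite /step_eval/= /Yn.
set i := Num.truncn _; have ij : (i < j)%N.
  by rewrite /i truncn_lt_nat ?index_ge0// -grid_gt_index.
rewrite (bigD1 (Ordinal ij))//= big1 ?addr0 => [|k ki].
  by rewrite indicE mem_set ?mulr1//= in_itv/=; exact: grid_truncn.
rewrite indicE memNset ?mulr0//= in_itv/=; apply/negP.
rewrite grid_le_index grid_gt_index -truncn_eq ?index_ge0// -/i.
by apply: contraNN ki => /eqP h; apply/eqP/val_inj.
Qed.

Lemma measurable_Yn (g : R -> R) : measurable_fun [set: R] g ->
  (forall j, (j <= n)%N -> measurable_fun setT (Yn_grid T alpha Y0 B n j)) ->
  measurable_fun (`[0%R, T] `*` [set: Omega])
    (fun z : R * Omega => g (Yn T alpha Y0 B n z.1 z.2)).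
Proof.
move=> mg mY.
have mD : measurable (`[0%R, T] `*` [set: Omega] : set (R * Omega)).
  by apply: measurableX => //; exact: measurable_itv.
(* With n + 1 steps the last interval starts at T, so the right-open intervals cover s = T as
   well. *)
apply: (@eq_measurable_fun _ _ _ _ _
    (fun z : R * Omega => step_eval (Yn_step T alpha Y0 B n g n.+1) z.1 z.2)).
  move=> [s w]; rewrite inE => -[/=]; rewrite in_itv/= => /andP[s0 sT] _.
  apply: step_eval_Yn; rewrite s0/= gridS grid_last//.
  by have : 0 < T / n%:R; [exact: divr_gt0|lra].
apply: measurable_sum => i; apply: measurable_funM.
  apply: measurable_funTS.
  apply: (measurableT_comp mg).
  by apply: measurableT_comp measurable_snd; apply: mY; rewrite -ltnS.
apply: measurable_funTS; apply: measurableT_comp measurable_fst.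
by apply: measurable_indic; exact: measurable_itv.
Qed.

End grid_steps.

Section volatility_paths.
Local Open Scope ereal_scope.
Context {R : realType} {d : measure_display} {Omega : measurableType d}.
Variable P : probability Omega R.
Notation mu := (@lebesgue_measure R).
Variable T : R.
Hypothesis T_gt0 : (0 < T)%R.

Let mD : measurable (`[0%R, T] : set (measurableTypeR R)).
Proof. exact: measurable_itv. Qed.

Let mDX : measurable (`[0%R, T] `*` [set: Omega] : set (measurableTypeR R * Omega)).
Proof. by apply: measurableX. Qed.

(** Functions measurable on [0, T] x Omega only are extended by 0, so that Tonelli's theorem applies
    on the whole product. *)
Lemma patch_itvX (f : R * Omega -> \bar R) s w :
  (f \_ (`[0%R, T] `*` setT)) (s, w) = ((fun s => f (s, w)) \_ `[0%R, T]) s.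
Proof.
rewrite /patch; congr (if _ then _ else _); apply/idP/idP; rewrite !inE; first by case.
by split.
Qed.

Lemma measurable_integral_itv (f : R * Omega -> \bar R) :
  measurable_fun (`[0%R, T] `*` setT) f -> (forall z, 0 <= f z) ->
  measurable_fun setT (fun w => \int[mu]_(s in `[0%R, T]) f (s, w)).
Proof.
move=> mf f0.
have -> : (fun w => \int[mu]_(s in `[0%R, T]) f (s, w)) =
    fubini_G mu (f \_ (`[0%R, T] `*` [set: Omega])).
  apply/funext => w; rewrite /fubini_G [LHS]integral_mkcond.
  by apply: eq_integral => s _; rewrite patch_itvX.
apply: (@measurable_fun_fubini_tonelli_G _ _ (measurableTypeR R) Omega R mu).
- by apply/(measurable_restrict _ mDX measurableT); rewrite setTI.
- by move=> z; rewrite /patch; case: ifP.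
Qed.

Lemma measurable_expectation_itv (f : R * Omega -> \bar R) :
  measurable_fun (`[0%R, T] `*` setT) f -> (forall z, 0 <= f z) ->
  measurable_fun (`[0%R, T] : set R) (fun s => \int[P]_w f (s, w)).
Proof.
move=> mf f0; rewrite -[X in measurable_fun X]setTI; apply/(measurable_restrict _ mD measurableT).
have -> : (fun s => \int[P]_w f (s, w)) \_ `[0%R, T] =
    fubini_F P (f \_ (`[0%R, T] `*` [set: Omega])).
  apply/funext => s; rewrite /fubini_F.
  under [RHS]eq_integral do rewrite patch_itvX.
  by rewrite /patch; case: ifP => // _; rewrite integral0.
apply: (@measurable_fun_fubini_tonelli_F _ _ (measurableTypeR R) Omega R P).
- by apply/(measurable_restrict _ mDX measurableT); rewrite setTI.
- by move=> z; rewrite /patch; case: ifP.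
Qed.

Lemma integral_itv_exchange (f : R * Omega -> \bar R) :
  measurable_fun (`[0%R, T] `*` setT) f -> (forall z, 0 <= f z) ->
  \int[P]_w \int[mu]_(s in `[0%R, T]) f (s, w) =
  \int[mu]_(s in `[0%R, T]) \int[P]_w f (s, w).
Proof.
move=> mf f0.
have := @fubini_tonelli _ _ (measurableTypeR R) Omega R mu P (f \_ (`[0%R, T] `*` setT)).
move=> h; under eq_integral do rewrite integral_mkcond.
under eq_integral do under eq_integral do rewrite -patch_itvX.
rewrite -h; last 2 first.
- by apply/(measurable_restrict _ mDX measurableT); rewrite setTI.
- by move=> z; rewrite /patch; case: ifP.
rewrite [RHS]integral_mkcond; apply: eq_integral => s _.
under eq_integral do rewrite patch_itvX.
by rewrite /patch; case: ifP => // _; rewrite integral0.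
Qed.

End volatility_paths.

Lemma measurable_smoothing (R : realType) (m : R) (h : R -> R) :
  measurable_fun [set: R] h -> (forall x, 0 <= h x) ->
  measurable_fun [set: R] (smoothing m h).
Proof.
move=> mh h0.
apply: (@measurable_fun_fubini_tonelli_F _ _ (measurableTypeR R) (measurableTypeR R) R
  (normal_prob 0 1) (fun p => (h (m - p.1 / 2 + Num.sqrt p.1 * p.2))%:E)).
  apply/measurable_EFinP; apply: measurableT_comp mh _.
  apply: measurable_funD.
    by apply: measurable_funB => //; apply: measurable_funM => //; exact: measurable_fst.
  apply: measurable_funM; last exact: measurable_snd.
  apply: measurableT_comp measurable_fst.
  by apply: continuous_measurable_fun; exact: sqrt_continuous.
by move=> p; rewrite lee_fin.
Qed.

(** * The error between the two smoothed prices *)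

Section weak_error.
Local Open Scope ereal_scope.
Context {R : realType} {d : measure_display} {Omega : measurableType d}.
Variable P : probability Omega R.
Notation mu := (@lebesgue_measure R).
Variables (T H alpha Y0 : R) (B Y : R -> Omega -> R).
Hypotheses (T_gt0 : (0 < T)%R) (H12 : (2^-1 < H < 1)%R) (alpha_gt0 : (0 < alpha)%R).
Hypotheses (hB : is_fbm P T H B) (hY : is_fractional_OU T alpha Y0 B Y).
Variables (sigma : R -> R) (Csigma smin q r q' : R).
Hypothesis hsigma : condition_B sigma Csigma smin q r q'.
(** Joint measurability will come from the Ito integral: [ito_integrand_measurable] provides it for
    sigma(Y). *)
Hypothesis mvolY : measurable_fun (`[0%R, T] `*` [set: Omega])
  (fun z : R * Omega => sigma (Y z.1 z.2)).

Let mD : measurable (`[0%R, T] : set (measurableTypeR R)).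
Proof. exact: measurable_itv. Qed.

Let mDX : measurable (`[0%R, T] `*` [set: Omega] : set (measurableTypeR R * Omega)).
Proof. by apply: measurableX. Qed.

Definition var_rate s w : R := (sigma (Y s w) ^+ 2)%R.
Definition varn_rate n s w : R := (sigma (Yn T alpha Y0 B n s w) ^+ 2)%R.
Definition total_var w : R := (\int[mu]_(s in `[0%R, T]) var_rate s w)%R.
Definition total_varn n w : R := (\int[mu]_(s in `[0%R, T]) varn_rate n s w)%R.
Definition weight_path l n w : \bar R :=
  \int[mu]_(s in `[0%R, T])
    (path_weight (n%:R `^ (r * H)) (var_rate ^~ w) (varn_rate n ^~ w) l s)%:E.

Let mvol : measurable_fun [set: R] sigma := measurable_vol hsigma.

Lemma measurable_Yn_grid n j : (0 < n)%N -> (j <= n)%N ->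
  measurable_fun setT (Yn_grid T alpha Y0 B n j).
Proof. by move=> n0 jn; have [] := Yn_grid_subgaussian Y0 T_gt0 H12 alpha_gt0 hB n0 jn. Qed.

Let mvar : measurable_fun (`[0%R, T] `*` [set: Omega])
  (fun z : R * Omega => var_rate z.1 z.2).
Proof. exact: measurable_funX. Qed.

Let mvarn n : (0 < n)%N -> measurable_fun (`[0%R, T] `*` [set: Omega])
  (fun z : R * Omega => varn_rate n z.1 z.2).
Proof.
move=> n0; apply: measurable_funX; apply: measurable_Yn => // j.
exact: measurable_Yn_grid.
Qed.

Lemma measurable_itv_slice (f : R -> Omega -> R) w :
  measurable_fun (`[0%R, T] `*` [set: Omega]) (fun z : R * Omega => f z.1 z.2) ->
  measurable_fun (`[0%R, T] : set R) (f ^~ w).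
Proof.
move=> mf; apply: (@measurable_comp _ _ _ _ _ _ (`[0%R, T] `*` [set: Omega])
  (fun z : R * Omega => f z.1 z.2) _ (fun s => (s, w))) => //.
- by move=> _ [s sT <-].
- by apply: measurable_funTS; exact: pair2_measurable.
Qed.

Let smin0 : (0 < smin)%R := condB_smin_gt0 hsigma.

Let sqr_vol_ge x : (smin ^+ 2 <= sigma x ^+ 2)%R.
Proof.
by rewrite lerXn2r// ?nnegrE ?(condB_ge_smin hsigma) ?ltW// (vol_gt0 hsigma).
Qed.

Let measurable_total (f : R -> Omega -> R) :
  measurable_fun (`[0%R, T] `*` [set: Omega]) (fun z : R * Omega => f z.1 z.2) ->
  (forall s w, (0 <= f s w)%R) ->
  measurable_fun setT (fun w => (\int[mu]_(s in `[0%R, T]) f s w)%R).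
Proof.
move=> mf f0; apply: measurableT_comp; first exact: (fine_measurable measurableT).
apply: (@measurable_integral_itv _ _ _ _ (fun z => (f z.1 z.2)%:E)).
  exact/measurable_EFinP.
by move=> z; rewrite lee_fin.
Qed.

Lemma measurable_total_var : measurable_fun setT total_var.
Proof. by apply: measurable_total => // s w; exact: sqr_ge0. Qed.

Lemma measurable_total_varn n : (0 < n)%N -> measurable_fun setT (total_varn n).
Proof. by move=> n0; apply: measurable_total => [|s w]; [exact: mvarn|exact: sqr_ge0]. Qed.

Let pw_ge0 l n s w : 0 <= (path_weight (n%:R `^ (r * H)) (var_rate ^~ w) (varn_rate n ^~ w) l s)%:E.
Proof. by rewrite lee_fin !addr_ge0 ?expR_ge0 ?sqr_ge0. Qed.

Let mpw l n : (0 < n)%N -> measurable_fun (`[0%R, T] `*` [set: Omega])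
  (fun z : R * Omega =>
     (path_weight (n%:R `^ (r * H)) (var_rate ^~ z.2) (varn_rate n ^~ z.2) l z.1)%:E).
Proof.
move=> n0; apply/measurable_EFinP; apply: measurable_funD; first apply: measurable_funD.
- apply: measurable_funX; apply: measurable_funM => //; apply: measurable_funB => //.
  exact: mvarn.
- by apply: measurableT_comp => //; apply: measurable_funM.
- by apply: measurableT_comp => //; apply: measurable_funM => //; exact: mvarn.
Qed.

Lemma measurable_weight_path l n : (0 < n)%N -> measurable_fun setT (weight_path l n).
Proof.
move=> n0; apply: (@measurable_integral_itv _ _ _ _ (fun z : R * Omega =>
  (path_weight (n%:R `^ (r * H)) (var_rate ^~ z.2) (varn_rate n ^~ z.2) l z.1)%:E)) => //.
exact: mpw.
Qed.

Lemma weight_path_ge0 l n w : 0 <= weight_path l n w.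
Proof. exact: integral_ge0. Qed.

(** Tonelli moves the expectation inside the time integral. At a fixed [s], with j the index of the
    grid interval containing it, the bounds for Y_s, for Y^n_{t_j} and for their difference have
    constants independent of [s] and n. *)
Lemma expectation_weight_path_le l : (0 <= l)%R ->
  exists2 C : R, (0 <= C)%R & forall n, (0 < n)%N -> \int[P]_w weight_path l n w <= C%:E.
Proof.
move=> l0.
have [C C0 hC] := @path_weight_expectation_le _ _ _ P _ _ _ _ _ _ hsigma l H _ _ l0
  (ou_var_gt0 H Y0 T_gt0) (ou_err_gt0 H alpha Y0 T_gt0).
exists (T * C)%R => [|n n0]; first by rewrite mulr_ge0// ltW.
rewrite (@integral_itv_exchange _ _ _ P T (fun z : R * Omega =>
  (path_weight (n%:R `^ (r * H)) (var_rate ^~ z.2) (varn_rate n ^~ z.2) l z.1)%:E)) => //; last first.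
  exact: mpw.
apply: (@le_trans _ _ (\int[mu]_(s in `[0%R, T]) cst C%:E s)).
  apply: ge0_le_integral => //.
  - by move=> s _; exact: integral_ge0.
  - apply: (@measurable_expectation_itv _ _ _ P T (fun z : R * Omega =>
      (path_weight (n%:R `^ (r * H)) (var_rate ^~ z.2) (varn_rate n ^~ z.2) l z.1)%:E)) => //.
    exact: mpw.
  move=> s; rewrite /= in_itv/= => /andP[s0 sT].
  have sT' : (0 <= s <= T)%R by rewrite s0.
  have jn := truncn_le_grid T_gt0 n0 sT'.
  have /andP[js sj] := grid_truncn T_gt0 n0 s0.
  have js' : (grid T n (Num.truncn (s * n%:R / T)) <= s <=
    grid T n (Num.truncn (s * n%:R / T)).+1)%R by rewrite js ltW.
  apply: hC => //.
  - exact: (OU_subgaussian T_gt0 H12 alpha_gt0 hB hY sT').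
  - exact: (Yn_grid_subgaussian Y0 T_gt0 H12 alpha_gt0 hB n0 jn).
  - exact: (OU_error_subgaussian T_gt0 H12 alpha_gt0 hB hY n0 sT' jn js').
apply: (@le_trans _ _ (C%:E * T%:E)); last by rewrite -EFinM mulrC.
rewrite (integral_cst mu mD) lee_wpmul2l ?lee_fin//.
by have := lebesgue_measure_itv `[0%R, T]; rewrite /= lte_fin T_gt0 sube0 => ->.
Qed.

Lemma variance_path_bounds c n w : (0 < c)%R -> (0 < n)%N ->
  let Q := weight_path (2 * c * T) n w in Q < +oo ->
  [/\ (smin ^+ 2 * T <= total_var w)%R, (smin ^+ 2 * T <= total_varn n w)%R,
      (expR (2 * c * total_var w))%:E <= (T^-1)%:E * Q &
      (expR (2 * c * total_varn n w))%:E <= (T^-1)%:E * Q].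
Proof.
move=> c0 n0 Q Qoo.
have N0 : (0 < n%:R `^ (r * H) :> R)%R by rewrite powR_gt0// ltr0n.
have s0 := sqr_ge0 smin.
have [] := path_lower_bound T_gt0 c0 s0 (measurable_itv_slice w mvar) (measurable_itv_slice w (mvarn n0)) (fun _ => sqr_vol_ge _)
  (fun _ => sqr_vol_ge _) Qoo.
have [] := path_exp_le T_gt0 c0 s0 (measurable_itv_slice w mvar) (measurable_itv_slice w (mvarn n0)) (fun _ => sqr_vol_ge _)
  (fun _ => sqr_vol_ge _) Qoo.
by move=> e1 e2 b1 b2; split; [exact: b1|exact: b2|exact: e1|exact: e2].
Qed.

Lemma variance_path_error c n w : (0 < c)%R -> (0 < n)%N ->
  let Q := weight_path (2 * c * T) n w in Q < +oo ->
  (n%:R `^ (r * H) * `|total_var w - total_varn n w| * expR (c * total_var w))%:E <=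
     (T + T^-1)%:E * Q /\
  (n%:R `^ (r * H) * `|total_var w - total_varn n w| * expR (c * total_varn n w))%:E <=
     (T + T^-1)%:E * Q.
Proof.
move=> c0 n0 Q Qoo.
have N0 : (0 < n%:R `^ (r * H) :> R)%R by rewrite powR_gt0// ltr0n.
exact: (path_diff_le T_gt0 N0 c0 (sqr_ge0 smin) (measurable_itv_slice w mvar) (measurable_itv_slice w (mvarn n0))
  (fun _ => sqr_vol_ge _) (fun _ => sqr_vol_ge _) Qoo).
Qed.

Definition smoothed_price m h := \int[P]_w smoothing m h (total_var w).
Definition smoothed_pricen n m h := \int[P]_w smoothing m h (total_varn n w).

(** The Lipschitz bound at each path is at most a constant times n^{-rH} [Q], and [Q] has bounded
    expectation. Finiteness is part of the conclusion: it supplies the exponential moment needed for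
    the integration by parts, and it permits the final subtraction. *)
Lemma smoothing_weak_error (m A c : R) (h : R -> R) : (0 <= A)%R -> (0 <= c)%R ->
  measurable_fun [set: R] h -> (forall x, 0 <= h x <= A * expR (c * `|x - m|))%R ->
  exists2 C : R, (0 <= C)%R & forall n, (0 < n)%N ->
    [/\ smoothed_price m h < +oo, smoothed_pricen n m h < +oo,
     smoothed_price m h <= smoothed_pricen n m h + (C * n%:R `^ (- (r * H)))%:E &
     smoothed_pricen n m h <= smoothed_price m h + (C * n%:R `^ (- (r * H)))%:E].
Proof.
move=> A0 c0 mh hA.
have h0 x : (0 <= h x)%R by have /andP[] := hA x.
have v00 : (0 < smin ^+ 2 * T)%R by rewrite mulr_gt0// exprn_gt0.
have [L [c' [L0 c'0 hL]]] := smoothing_lipschitz m v00 A0 c0.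
have [hbd hlip] := hL h mh hA.
(* The path estimates want a positive exponent, while [c'] is only nonnegative. *)
pose k := (c' + 1)%R; have k0 : (0 < k)%R by rewrite /k; lra.
have l0 : (0 <= 2 * k * T)%R by rewrite !mulr_ge0// ltW.
have [C C0 hC] := expectation_weight_path_le l0.
pose K := (T + T^-1)%R.
have Ti0 : (0 < T^-1)%R by rewrite invr_gt0.
have K0 : (0 < K)%R by rewrite addr_gt0.
have M0 : (0 < L + 1)%R by lra.
have MK0 : (0 < (L + 1) * K)%R by rewrite mulr_gt0.
exists ((L + 1) * K * C)%R => [|n n0]; first by rewrite mulr_ge0// ltW.
set Q := weight_path (2 * k * T) n.
have mQ : measurable_fun setT Q by exact: measurable_weight_path.
have Q0 w : 0 <= Q w by exact: weight_path_ge0.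
have mS := measurable_smoothing m mh h0.
have mSV : measurable_fun setT (fun w => smoothing m h (total_var w)).
  by apply: measurableT_comp mS _; exact: measurable_total_var.
have mSVn : measurable_fun setT (fun w => smoothing m h (total_varn n w)).
  by apply: measurableT_comp mS _; exact: measurable_total_varn.
have S0 v : 0 <= smoothing m h v.
  by apply: integral_ge0 => z _; rewrite lee_fin.
have N0 : (0 < n%:R `^ (- (r * H)) :> R)%R by rewrite powR_gt0// ltr0n.
set N := (n%:R `^ (- (r * H)) : R)%R in N0 *.
have NE : (n%:R `^ (r * H) = N^-1 :> R)%R by rewrite /N powRN invrK.
have a0 : (0 < (L + 1) * K * N)%R by rewrite mulr_gt0.
have b0 : (0 < (L + 1) * T^-1)%R by rewrite mulr_gt0.
have mle (v : R) : (0 <= v)%R -> (c' * v <= k * v)%R.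
  by move=> v0; rewrite ler_wpM2r// /k; lra.
(* The pathwise estimates are trivial on the null set where Q is infinite. *)
have Qcases w (t x : \bar R) (y : R) : (0 < y)%R -> 0 <= t ->
    (Q w < +oo -> x <= t + y%:E * Q w) ->  x <= t + y%:E * Q w.
  move=> y0 t0 hx; have [//|] := ltP (Q w) +oo.
  rewrite leye_eq => /eqP ->; rewrite gt0_muley ?lte_fin// addeC addye ?leey//.
  by rewrite gt_eqF// (lt_le_trans _ t0).
have EK (x y : R) (z : \bar R) : (0 <= x)%R -> (0 <= y)%R -> x%:E <= y%:E * z ->
    forall a b e : R, (0 <= b)%R -> (e <= b * x)%R -> (a = b * y)%R -> e%:E <= a%:E * z.
  move=> x0 y0 xz a b e bp ex ->; apply: (@le_trans _ _ (b * x)%:E); first by rewrite lee_fin.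
  by rewrite !EFinM -muleA; apply: lee_wpmul2l xz; rewrite lee_fin.
have step w : smoothing m h (total_var w) <=
      smoothing m h (total_varn n w) + ((L + 1) * K * N)%:E * Q w /\
    smoothing m h (total_varn n w) <=
      smoothing m h (total_var w) + ((L + 1) * K * N)%:E * Q w.
  split; apply: Qcases => // Qoo; have [vV vn _ _] := variance_path_bounds k0 n0 Qoo;
    have [hV hn] := variance_path_error k0 n0 Qoo.
    apply: (le_trans (hlip _ _ vV vn)); apply: leeD; first exact: lexx.
    apply: (EK _ _ _ _ _ hV _ ((L + 1) * N)%R); rewrite ?(ltW K0)//.
    - by rewrite mulr_ge0// ltW.
    - rewrite NE; have -> : ((L + 1) * N * (N^-1 * `|total_var w - total_varn n w| * expR (k * total_var w)) =
        (L + 1) * (`|total_var w - total_varn n w| * expR (k * total_var w)))%R.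
        by field; rewrite gt_eqF.
      rewrite -mulrA ler_pM ?mulr_ge0 ?expR_ge0//; first lra.
      rewrite ler_wpM2l// ler_expR; apply: mle; lra.
    - by rewrite mulrAC.
  apply: (le_trans (hlip _ _ vn vV)); apply: leeD; first exact: lexx.
  apply: (EK _ _ _ _ _ hn _ ((L + 1) * N)%R); rewrite ?(ltW K0)//.
  - by rewrite mulr_ge0// ltW.
  - rewrite NE; have -> : ((L + 1) * N * (N^-1 * `|total_var w - total_varn n w| * expR (k * total_varn n w)) =
      (L + 1) * (`|total_varn n w - total_var w| * expR (k * total_varn n w)))%R.
      by rewrite [in RHS]distrC; field; rewrite gt_eqF.
    rewrite -mulrA ler_pM ?mulr_ge0 ?expR_ge0//; first lra.
    rewrite ler_wpM2l// ler_expR; apply: mle; lra.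
  - by rewrite mulrAC.
(* Finiteness of both prices, from the growth bound and the exponential part of [Q]. *)
have bnd w : smoothing m h (total_var w) <= 0 + ((L + 1) * T^-1)%:E * Q w /\
    smoothing m h (total_varn n w) <= 0 + ((L + 1) * T^-1)%:E * Q w.
  split; apply: Qcases => // Qoo; have [vV vn eV en] := variance_path_bounds k0 n0 Qoo; rewrite add0e.
    apply: (le_trans (hbd _ vV)); apply: (EK _ _ _ _ _ eV _ (L + 1)%R); rewrite ?expR_ge0 ?(ltW Ti0)//.
    - lra.
    - apply: ler_pM; [exact: L0|exact: expR_ge0|lra|].
    by rewrite ler_expR; apply: ler_wpM2r; [lra|rewrite /k; lra].
  apply: (le_trans (hbd _ vn)); apply: (EK _ _ _ _ _ en _ (L + 1)%R); rewrite ?expR_ge0 ?(ltW Ti0)//.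
  - lra.
  - apply: ler_pM; [exact: L0|exact: expR_ge0|lra|].
    by rewrite ler_expR; apply: ler_wpM2r; [lra|rewrite /k; lra].
have intQ (a : R) : (0 < a)%R -> \int[P]_w (a%:E * Q w) <= (a * C)%:E.
  move=> ap; rewrite ge0_integralZl//; last by rewrite lee_fin ltW.
  by rewrite EFinM; apply: lee_wpmul2l; [rewrite lee_fin ltW|exact: hC].
have mZ (a : R) : measurable_fun setT (fun w => a%:E * Q w) by exact: emeasurable_funM.
have aQ0 (a : R) w : (0 < a)%R -> 0 <= a%:E * Q w by move=> a_; rewrite mule_ge0// lee_fin ltW.
have conc (f g : Omega -> \bar R) (a : R) : measurable_fun setT f -> measurable_fun setT g ->
    (forall w, 0 <= f w) -> (forall w, 0 <= g w) -> (0 < a)%R ->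
    (forall w, f w <= g w + a%:E * Q w) -> \int[P]_w f w <= \int[P]_w g w + (a * C)%:E.
  move=> mf mg f0 g0 ap fg.
  apply: (@le_trans _ _ (\int[P]_w (g w + a%:E * Q w))).
    apply: ge0_le_integral => //.
    by apply: emeasurable_funD.
  rewrite ge0_integralD//; last by move=> w _; exact: aQ0.
  by apply: leeD => //; exact: intQ.
have EC : ((L + 1) * K * C * N = (L + 1) * K * N * C)%R by ring.
split.
- apply: le_lt_trans (conc _ (cst 0) _ mSV _ _ _ b0 _) _ => //.
    by move=> w; exact: (proj1 (bnd w)).
  by rewrite integral0 add0e ltry.
- apply: le_lt_trans (conc _ (cst 0) _ mSVn _ _ _ b0 _) _ => //.
    by move=> w; exact: (proj2 (bnd w)).
  by rewrite integral0 add0e ltry.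
- rewrite EC; exact: (conc _ _ _ mSV mSVn (fun w => S0 _) (fun w => S0 _) a0 (fun w => proj1 (step w))).
- rewrite EC; exact: (conc _ _ _ mSVn mSV (fun w => S0 _) (fun w => S0 _) a0 (fun w => proj2 (step w))).
Qed.

(** The path estimate with c = 1, from which e^{V} >= 1 is dropped; it serves for the convergence in
    probability of the total variances. *)
Lemma total_var_dist n w : (0 < n)%N ->
  (`|total_varn n w - total_var w|)%:E <=
    ((T + T^-1) * n%:R `^ (- (r * H)))%:E * weight_path (2 * 1 * T) n w.
Proof.
move=> n0; have N0 : (0 < n%:R `^ (r * H) :> R)%R by rewrite powR_gt0// ltr0n.
have K0 : (0 < T + T^-1)%R by rewrite addr_gt0// invr_gt0.
have Ni0 : (0 < n%:R `^ (- (r * H)) :> R)%R by rewrite powR_gt0// ltr0n.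
have [Qoo|] := ltP (weight_path (2 * 1 * T) n w) +oo; last first.
  by rewrite leye_eq => /eqP ->; rewrite gt0_muley ?leey// lte_fin mulr_gt0.
have [hV _] := variance_path_error ltr01 n0 Qoo.
have [vV _ _ _] := variance_path_bounds ltr01 n0 Qoo.
rewrite mulrC EFinM -muleA.
have Ni1 : 0 <= (n%:R `^ (- (r * H)))%:E :> \bar R by rewrite lee_fin ltW.
apply: le_trans (lee_wpmul2l Ni1 hV); rewrite -EFinM lee_fin -mulrA powRN mulKf ?gt_eqF//.
rewrite distrC ler_peMr// mul1r; have := expR_ge1Dx (total_var w).
have : (0 <= total_var w)%R by apply: le_trans vV; rewrite mulr_ge0 ?sqr_ge0// ltW.
lra.
Qed.

Lemma measurable_vol_dist n : (0 < n)%N ->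
  measurable_fun (`[0%R, T] `*` [set: Omega]) (fun z : R * Omega =>
     ((sigma (Yn T alpha Y0 B n z.1 z.2) - sigma (Y z.1 z.2)) ^+ 2)%:E).
Proof.
move=> n0; apply/measurable_EFinP; apply: measurable_funX; apply: measurable_funB => //.
by apply: measurable_Yn => // j; exact: measurable_Yn_grid.
Qed.

(** The functional controls differences of sigma^2; since sigma >= sigma_min, (x^2 - y^2)^2 >= 4
    sigma_min^2 (x - y)^2 turns this into control of sigma itself, as the approximation of the Ito
    integrand requires. *)
Lemma vol_path_dist l n w : (0 < n)%N ->
  \int[mu]_(s in `[0%R, T]) ((sigma (Yn T alpha Y0 B n s w) - sigma (Y s w)) ^+ 2)%:E <=
    ((4 * smin ^+ 2)^-1 * n%:R `^ (- (2 * (r * H))))%:E * weight_path l n w.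
Proof.
move=> n0; have N0 : (0 < n%:R `^ (r * H) :> R)%R by rewrite powR_gt0// ltr0n.
have s20 : (0 < 4 * smin ^+ 2)%R by rewrite mulr_gt0// exprn_gt0.
have c0 : (0 < (4 * smin ^+ 2)^-1 * n%:R `^ (- (2 * (r * H))) :> R)%R.
  by rewrite mulr_gt0 ?invr_gt0// powR_gt0// ltr0n.
have mw : measurable_fun (`[0%R, T] : set R)
    (fun s => (path_weight (n%:R `^ (r * H)) (var_rate ^~ w) (varn_rate n ^~ w) l s)%:E).
  apply/measurable_EFinP; apply: (measurable_itv_slice (f := fun s w =>
    path_weight (n%:R `^ (r * H)) (var_rate ^~ w) (varn_rate n ^~ w) l s)).
  by apply/measurable_EFinP; exact: mpw.
rewrite /weight_path -ge0_integralZl//; last by rewrite lee_fin ltW.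
apply: ge0_le_integral => //.
- by move=> s _; rewrite lee_fin sqr_ge0.
- apply/measurable_EFinP; apply: (measurable_itv_slice (f := fun s w =>
    (sigma (Yn T alpha Y0 B n s w) - sigma (Y s w)) ^+ 2)%R).
  by apply/measurable_EFinP; exact: measurable_vol_dist.
- by apply: emeasurable_funM.
move=> s _; rewrite -EFinM lee_fin.
have -> : (n%:R `^ (- (2 * (r * H))) = ((n%:R `^ (r * H)) ^+ 2)^-1 :> R)%R.
  by rewrite powRN [(2 * _)%R]mulrC (powRrM n%:R (r * H)) powR_mulrn// powR_ge0.
set N := (n%:R `^ (r * H))%R in N0 *.
rewrite -mulrA ler_pdivlMl// ler_pdivlMl ?exprn_gt0//.
set x := sigma (Yn _ _ _ _ _ _ _); set y := sigma (Y s w).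
apply: (@le_trans _ _ ((N * (y ^+ 2 - x ^+ 2)) ^+ 2)%R); last first.
  by rewrite /path_weight -addrA lerDl addr_ge0 ?expR_ge0.
have -> : ((N * (y ^+ 2 - x ^+ 2)) ^+ 2 = N ^+ 2 * ((x + y) ^+ 2 * (x - y) ^+ 2))%R by ring.
rewrite ler_wpM2l ?sqr_ge0// ler_wpM2r ?sqr_ge0//.
have -> : (4 * smin ^+ 2 = (smin + smin) ^+ 2)%R by ring.
rewrite lerXn2r ?nnegrE ?addr_ge0 ?(ltW smin0) ?(ltW (vol_gt0 hsigma _))//.
by apply: lerD; exact: (condB_ge_smin hsigma).
Qed.

End weak_error.

Lemma natr_succ_gt_near (R : realType) (x : R) : \forall k \near \oo, x < k.+1%:R.
Proof.
by near=> k; apply: (@lt_trans _ _ k%:R); [near: k; exact: nbhs_infty_gtr|rewrite ltr_nat].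
Unshelve. all: end_near. Qed.

Lemma natr_powRN_cvg0 (R : realType) (c : R) : 0 < c ->
  (k.+1%:R `^ (- c) : R) @[k --> \oo] --> (0 : R).
Proof.
move=> c0; apply/cvgrPdist_lt => e e0; near=> k.
rewrite sub0r normrN ger0_norm ?powR_ge0// powRN.
rewrite -[ltRHS]invrK ltf_pV2 ?posrE ?powR_gt0 ?invr_gt0//.
have -> : e^-1 = (e^-1 `^ c^-1) `^ c.
  by rewrite -powRrM mulVf ?gt_eqF// powRr1// invr_ge0 ltW.
apply: gt0_ltr_powR => //; rewrite ?nnegrE ?powR_ge0//.
near: k; exact: natr_succ_gt_near.
Unshelve. all: end_near. Qed.

(** Markov's inequality: the probability is at most a_k C / e. *)
Lemma probability_tail_cvg0 (R : realType) d (Omega : measurableType d)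
    (P : probability Omega R) (A : nat -> set Omega) (Q : nat -> Omega -> \bar R)
    (a : nat -> R) (C e : R) :
  0 < e -> (forall k, measurable (A k)) -> (forall k, measurable_fun setT (Q k)) ->
  (forall k w, (0 <= Q k w)%E) -> (forall k, (\int[P]_w Q k w <= C%:E)%E) ->
  (forall k, 0 < a k) -> a k @[k --> \oo] --> (0 : R) ->
  (forall k w, A k w -> (e%:E <= (a k)%:E * Q k w)%E) ->
  P (A k) @[k --> \oo] --> 0%E.
Proof.
move=> e0 mA mQ Q0 hC a0 acvg AQ.
have bnd k : (P (A k) <= (a k * (C / e))%:E)%E.
  have ea0 : 0 <= a k / e by rewrite divr_ge0 ?ltW.
  apply: (@le_trans _ _ (\int[P]_w ((a k / e)%:E * Q k w))%E).
    have <- : (\int[P]_w (\1_(A k) w)%:E)%E = P (A k) by rewrite integral_indic// setIT.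
    apply: ge0_le_integral => //.
    - by apply/measurable_EFinP; exact: measurable_indic.
    - by apply: emeasurable_funM.
    move=> w _; rewrite indicE; case: (boolP (w \in A k)) => [|_].
      rewrite inE => /AQ h; rewrite mulrC EFinM -muleA.
      have -> : (true%:R%:E = (e^-1)%:E * e%:E :> \bar R)%E by rewrite -EFinM mulVf ?gt_eqF.
      by apply: lee_wpmul2l h; rewrite lee_fin invr_ge0 ltW.
    by rewrite mule_ge0// lee_fin.
  rewrite ge0_integralZl// mulrA mulrAC [leRHS]EFinM.
  by apply: lee_wpmul2l; rewrite ?lee_fin.
apply: (@squeeze_cvge _ _ _ _ (cst 0%E) _ (fun k => (a k * (C / e))%:E)).
- by apply: nearW => k; rewrite bnd measure_ge0.
- exact: cvg_cst.
- apply: cvg_EFin; first by apply: nearW.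
  by rewrite -[X in _ --> X](mul0r (C / e)); apply: cvgMl.
Qed.

(** * Conditioning on independent sigma-algebras *)

Section sub_probability.
Local Open Scope ereal_scope.
Context {R : realType} {d : measure_display} {Omega : measurableType d}.
Variables (P : probability Omega R) (G : set (set Omega)).
Hypothesis mG : G `<=` measurable.

Lemma sub_sigma_measurable : <<s G >> `<=` (@measurable _ Omega).
Proof. exact: smallest_sub (@sigma_algebra_measurable _ Omega) mG. Qed.

(** P on the sigma-algebra generated by [G], carried by a type of its own: independence of [G] and a
    variable can then be expressed by a product measure. *)
Definition sub_prob of G `<=` measurable : set (g_sigma_algebraType G) -> \bar R := P.

Let sub_prob0 : sub_prob mG set0 = 0. Proof. exact: measure0. Qed.

Let sub_prob_ge0 A : 0 <= sub_prob mG A. Proof. exact: measure_ge0. Qed.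

Let sub_prob_sigma_additive : semi_sigma_additive (sub_prob mG).
Proof.
move=> F mF tF mUF; apply: (@measure_semi_sigma_additive _ _ _ P F) => //.
- by move=> i; apply: sub_sigma_measurable; exact: mF.
- exact: sub_sigma_measurable.
Qed.

HB.instance Definition _ := isMeasure.Build _ (g_sigma_algebraType G) R
  (sub_prob mG) sub_prob0 sub_prob_ge0 sub_prob_sigma_additive.

Let sub_probT : sub_prob mG setT = 1. Proof. exact: probability_setT. Qed.

HB.instance Definition _ := Measure_isProbability.Build _ _ _ (sub_prob mG) sub_probT.

Lemma measurable_sub_id : measurable_fun [set: Omega] (id : Omega -> g_sigma_algebraType G).
Proof. by move=> _ A mA; rewrite setTI; exact: sub_sigma_measurable. Qed.

Lemma measurable_sub_fun d' (U : measurableType d') (h : g_sigma_algebraType G -> U) :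
  measurable_fun setT h -> measurable_fun [set: Omega] (h : Omega -> U).
Proof. by move=> mh; exact: measurableT_comp mh measurable_sub_id. Qed.

Lemma integral_sub_prob (h : g_sigma_algebraType G -> \bar R) :
  measurable_fun setT h -> (forall w, 0 <= h w) ->
  \int[sub_prob mG]_w h w = \int[P]_w h w.
Proof.
move=> mh h0.
rewrite (@eq_measure_integral _ _ _ _ (pushforward P (id : Omega -> g_sigma_algebraType G))) => [||A _ _ //].
  exact: measurable_sub_id.
by move=> ?; rewrite ge0_integral_pushforward.
Qed.

(** The freezing lemma. By independence the law of (w, X w), with w seen through the
    sub-sigma-algebra, is a product measure; Tonelli then integrates [X] out with w held fixed. *)
Lemma independent_integral (X : Omega -> R) (nu : probability (measurableTypeR R) R)
    (h : g_sigma_algebraType G * measurableTypeR R -> \bar R) :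
  setI_closed G -> G setT -> measurable_fun setT X ->
  (forall A U, G A -> measurable U -> P (A `&` X @^-1` U) = P A * nu U) ->
  measurable_fun setT h -> (forall z, 0 <= h z) ->
  \int[P]_w h (w, X w) = \int[P]_w \int[nu]_x h (w, x).
Proof.
move=> GI GT mX ind mh h0.
have mX' : measurable_fun [set: Omega] (X : Omega -> measurableTypeR R) by [].
have mpair : measurable_fun [set: Omega]
    (fun w => (w, X w) : g_sigma_algebraType G * measurableTypeR R).
  by apply: measurable_fun_pair; [exact: measurable_sub_id|exact: mX'].
have indG A U : <<s G >> A -> measurable U -> P (A `&` X @^-1` U) = P A * nu U.
  move=> sA mU.
  have mXU : measurable (X @^-1` U) by rewrite -[_ @^-1` _]setTI; exact: mX'.
  have [c c0 nuE] : exists2 c : R, (0 <= c)%R & nu U = c%:E.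
    by exists (fine (nu U)); [exact: fine_ge0|rewrite fineK// fin_num_measure].
  (* For fixed [U] both sides are finite measures in [A], and they agree on the pi-system [G]. *)
  have := @g_sigma_algebra_measure_unique _ R Omega G mG (fun _ => setT) (fun _ => GT) _
    (mrestr P mXU) (mscale (NngNum c0) P) GI _ _ A sA.
  move=> uniq; apply: (etrans (uniq _ _ _)).
  - by rewrite bigcup_const.
  - by move=> B GB; rewrite /mscale/= /mrestr/= ind// nuE muleC.
  - move=> k; change (P (setT `&` X @^-1` U) < +oo).
    rewrite setTI; exact: le_lt_trans (probability_le1 P mXU) (ltry _).
  - by rewrite /mscale/= nuE muleC.
transitivity (\int[pushforward P (fun w => (w, X w) : g_sigma_algebraType G * measurableTypeR R)]_z h z).
  by rewrite (ge0_integral_pushforward mpair).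
rewrite -(@eq_measure_integral _ _ _ _ _ (sub_prob mG \x nu)) => [|A mA _]; last first.
  by apply: product_measure_unique.
rewrite fubini_tonelli1//.
rewrite integral_sub_prob//.
- by apply: measurable_fun_fubini_tonelli_F.
- by move=> w; exact: integral_ge0.
Qed.

End sub_probability.

Section gaussian_increments.
Local Open Scope ereal_scope.
Context {R : realType} {d : measure_display} {Omega : measurableType d}.
Variables (P : probability Omega R) (F : set (set Omega)) (n : nat) (s : R).
Variable xi : nat -> Omega -> R.
Hypotheses (s0 : (0 < s)%R) (mF : F `<=` measurable).
Hypothesis mxi : forall i, (i < n)%N -> measurable_fun [set: Omega] (xi i).
Hypothesis indep : forall C (V : nat -> set R), <<s F >> C -> (forall j, measurable (V j)) ->
  P (C `&` \bigcap_(j in `I_n) xi j @^-1` V j) = P C * \prod_(j < n) normal_prob 0 s (V j).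

(* A pi-system generating the sigma-algebra of [F] and of all [xi j], j != i. *)
Definition others i : set (set Omega) := [set A | exists C V,
  [/\ <<s F >> C, (forall j, measurable (V j)), V i = [set: R] &
      A = C `&` \bigcap_(j in `I_n) xi j @^-1` V j]].

Lemma others_measurable i : others i `<=` measurable.
Proof.
move=> _ [C [V [FC mV _ ->]]]; apply: measurableI; first exact: (sub_sigma_measurable mF).
apply: bigcap_measurableType => j /= jn.
by rewrite -[_ @^-1` _]setTI; exact: mxi.
Qed.

Lemma others_setI i : setI_closed (others i).
Proof.
move=> _ _ [C [V [FC mV Vi ->]]] [C' [V' [FC' mV' Vi' ->]]].
exists (C `&` C'), (fun j => V j `&` V' j); split.
- exact: (@measurableI _ (g_sigma_algebraType F) C C').
- by move=> j; exact: measurableI.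
- by rewrite Vi Vi' setTI.
- rewrite setIACA; congr (_ `&` _).
  rewrite -bigcapI; apply: eq_bigcapr => j _; exact: preimage_setI.
Qed.

Lemma sub_others i C : <<s F >> C -> others i C.
Proof.
move=> FC; exists C, (fun _ => setT); split=> //.
by apply/seteqP; split => [w Cw|w []].
Qed.

Lemma othersT i : others i setT.
Proof. by apply: sub_others; exact: (@measurableT _ (g_sigma_algebraType F)). Qed.

Lemma others_indep i A U : (i < n)%N -> others i A -> measurable U ->
  P (A `&` xi i @^-1` U) = P A * normal_prob 0 s U.
Proof.
move=> ni [C [V [FC mV Vi ->]]] mU.
pose V' j := if j == i then U else V j.
have mV' j : measurable (V' j) by rewrite /V'; case: ifP.
have -> : C `&` \bigcap_(j in `I_n) xi j @^-1` V j `&` xi i @^-1` U =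
    C `&` \bigcap_(j in `I_n) xi j @^-1` V' j.
  rewrite -setIA; congr (_ `&` _); apply/seteqP; split => w.
    move=> [Vw Uw] j jn; rewrite /V' /=; case: eqP => [->//|_]; exact: Vw.
  move=> V'w; split.
    by move=> j jn; have := V'w j jn; rewrite /V'/=; case: eqP => [->|//]; rewrite Vi.
  by have := V'w i ni; rewrite /V' /= eqxx.
rewrite !indep// -muleA; congr (_ * _).
rewrite (bigD1 (Ordinal ni))//= [in RHS](bigD1 (Ordinal ni))//= {1}/V' eqxx Vi.
rewrite probability_setT mul1e muleC; congr (_ * _).
by apply: eq_bigr => j ji; rewrite /V' ifF//; apply: contraNF ji => /eqP e; apply/eqP/val_inj.
Qed.

Lemma measurable_others_sub i d' (U : measurableType d') (h : g_sigma_algebraType F -> U) :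
  measurable_fun setT h -> measurable_fun setT (h : g_sigma_algebraType (others i) -> U).
Proof.
move=> mh _ A mA; apply: sub_sigma_algebra; apply: sub_others; exact: mh.
Qed.

Lemma measurable_others_xi i j : (j < n)%N -> j != i ->
  measurable_fun setT (xi j : g_sigma_algebraType (others i) -> R).
Proof.
move=> jn ji _ A mA; apply: sub_sigma_algebra.
exists setT, (fun k => if k == j then A else setT); split.
- exact: (@measurableT _ (g_sigma_algebraType F)).
- by move=> k; case: ifP.
- by rewrite eq_sym (negbTE ji).
- rewrite !setTI; apply/seteqP; split => w.
    by move=> Aw k _ /=; case: eqP => [->|].
  by move/(_ j jn); rewrite /= eqxx.
Qed.

Lemma integral_xi i (h : g_sigma_algebraType (others i) * measurableTypeR R -> \bar R) :
  (i < n)%N -> measurable_fun setT h -> (forall z, 0 <= h z) ->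
  \int[P]_w h (w, xi i w) = \int[P]_w \int[normal_prob 0 s]_x h (w, x).
Proof.
move=> ni mh h0.
apply: (@independent_integral _ _ _ P _ (@others_measurable i) _ (normal_prob 0 s)) => //.
- exact: others_setI.
- exact: othersT.
- exact: mxi.
- by move=> A U oA mU; exact: others_indep.
Qed.

Variable a : nat -> Omega -> R.
Hypotheses (ma : forall i, (i < n)%N -> measurable_fun setT (a i : g_sigma_algebraType F -> R))
           (a0 : forall i w, (0 < a i w)%R).

Definition xi_sum k w : R := (\sum_(i < k) a i w * xi i w)%R.
Definition var_sum k w : R := (\sum_(i < k) a i w ^+ 2 * s ^+ 2)%R.

Let OF := g_sigma_algebraType F.

(** Conditionally on [F] the sum is Gaussian with variance [var_sum]; letting [h] depend on w in an
    [F]-measurable way expresses this without conditional laws. The induction freezes everything but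
    the last increment and merges it by [normal_convolution]. *)
Lemma integral_xi_sum k (h : OF * measurableTypeR R -> \bar R) : (k <= n)%N ->
  measurable_fun setT h -> (forall z, 0 <= h z) ->
  \int[P]_w h (w, xi_sum k w) =
  \int[P]_w \int[normal_prob 0 1]_z h (w, Num.sqrt (var_sum k w) * z)%R.
Proof.
elim: k h => [|k IH] h kn mh h0.
  apply: eq_integral => w _; rewrite /xi_sum /var_sum !big_ord0 sqrtr0.
  under eq_integral do rewrite mul0r.
  apply: esym; apply: (etrans (integral_cst _ measurableT _)).
  by rewrite -[RHS]mule1; congr (_ * _); exact: probability_setT.
pose Ok := g_sigma_algebraType (others k).
have mOk i : (i < k)%N -> measurable_fun setT (fun w : Ok => a i w * xi i w)%R.
  move=> ik; apply: measurable_funM.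
    by apply: measurable_others_sub; apply: ma; exact: ltn_trans ik kn.
  by apply: measurable_others_xi; [exact: ltn_trans ik kn|rewrite ltn_eqF].
have msum : measurable_fun setT (xi_sum k : Ok -> R).
  by apply: measurable_sum => i; exact: mOk.
have mak : measurable_fun setT (a k : Ok -> R) by apply: measurable_others_sub; exact: ma.
have mid : measurable_fun setT (id : Ok -> OF).
  by apply: (@measurable_others_sub k _ OF id); exact: measurable_id.
pose g (z : Ok * measurableTypeR R) := h (z.1 : OF, xi_sum k z.1 + a k z.1 * z.2)%R.
have mg : measurable_fun setT g.
  apply: (measurableT_comp mh); apply: measurable_fun_pair.
    exact: measurableT_comp mid measurable_fst.
  apply: measurable_funD; first exact: measurableT_comp msum measurable_fst.
  apply: measurable_funM; last exact: measurable_snd.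
  exact: measurableT_comp mak measurable_fst.
under eq_integral do rewrite /xi_sum big_ord_recr/=.
rewrite (@integral_xi k g kn mg (fun z => h0 _)) /g/=.
(* Averaging over the last increment leaves a function of the [F]-part and of the shorter sum, to
   which the induction hypothesis applies. *)
pose h' (z : OF * measurableTypeR R) :=
  \int[normal_prob 0 s]_x h (z.1, z.2 + a k z.1 * x)%R.
have mh' : measurable_fun setT h'.
  apply: (@measurable_fun_fubini_tonelli_F _ _ (OF * measurableTypeR R)%type (measurableTypeR R) R
    (normal_prob 0 s) (fun p => h (p.1.1, p.1.2 + a k p.1.1 * p.2)%R)) => //.
  apply: (measurableT_comp mh); apply: measurable_fun_pair.
    exact: measurableT_comp measurable_fst measurable_fst.
  apply: measurable_funD; first exact: measurableT_comp measurable_snd measurable_fst.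
  apply: measurable_funM; last exact: measurable_snd.
  apply: measurableT_comp; first exact: ma.
  exact: measurableT_comp measurable_fst measurable_fst.
have h'0 z : 0 <= h' z by exact: integral_ge0.
transitivity (\int[P]_w h' (w, xi_sum k w)); first by [].
apply: (etrans (IH h' (ltnW kn) mh' h'0)).
apply: eq_integral => w _; rewrite /h'/=.
rewrite (@normal_convolution _ (var_sum k w) (a k w) s (fun y => h (w, y)))//.
- by rewrite /var_sum big_ord_recr.
- by apply: sumr_ge0 => i _; rewrite mulr_ge0// sqr_ge0.
- exact: (@measurable_fun_pair2 _ _ _ OF (measurableTypeR R) _ h w mh).
Qed.

(** With all other increments and [F] frozen, X = r + a_i xi_i with r and a_i fixed, and
    [gaussian_ibp] applies for each w. The values 1 and -1 of [u] select the positive and negative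
    parts of the weight. *)
Lemma integral_xi_ibp (m : Omega -> R) (f : R -> R) i : (i < n)%N ->
  measurable_fun setT (m : OF -> R) -> measurable_fun [set: R] f -> (forall x, (0 <= f x)%R) ->
  let X w := (m w + xi_sum n w)%R in
  let weight (u : R) w :=
    iprimitive f (expR (X w)) * (expR (- X w) * Num.max (u * (xi i w / a i w + s ^+ 2)) 0)%:E in
  \int[P]_w weight 1%R w = \int[P]_w weight (-1)%R w + (s ^+ 2)%:E * \int[P]_w (f (expR (X w)))%:E.
Proof.
move=> ni mm mf f0 X weight.
pose Oi := g_sigma_algebraType (others i).
pose r w : R := (m w + \sum_(j < n) (if j == i :> nat then 0 else a j w * xi j w))%R.
have mr : measurable_fun setT (r : Oi -> R).
  apply: measurable_funD; first exact: measurable_others_sub.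
  apply: measurable_sum => j; have [_|ji] := eqVneq (j : nat) i; first exact: measurable_cst.
  apply: measurable_funM; last exact: measurable_others_xi.
  by apply: measurable_others_sub; exact: ma.
have mai : measurable_fun setT (a i : Oi -> R) by apply: measurable_others_sub; exact: ma.
have XE w : X w = (r w + a i w * xi i w)%R.
  rewrite /X /xi_sum (bigD1 (Ordinal ni))//= /r [in RHS](bigD1 (Ordinal ni))//= eqxx add0r.
  rewrite -[RHS]addrA [X in _ = (_ + X)%R]addrC; congr (_ + (_ + _))%R.
  apply: eq_bigr => j ji; rewrite ifF//.
  by apply: contraNF ji => /eqP e; apply/eqP/val_inj.
pose g (u : R) (z : Oi * measurableTypeR R) := iprimitive f (expR (r z.1 + a i z.1 * z.2)) *
   (expR (- (r z.1 + a i z.1 * z.2)) * Num.max (u * (z.2 / a i z.1 + s ^+ 2)) 0)%:E.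
pose gf (z : Oi * measurableTypeR R) := (f (expR (r z.1 + a i z.1 * z.2)))%:E.
have mlin : measurable_fun setT (fun z : Oi * measurableTypeR R => r z.1 + a i z.1 * z.2)%R.
  apply: measurable_funD; first exact: measurableT_comp mr measurable_fst.
  apply: measurable_funM; last exact: measurable_snd.
  exact: measurableT_comp mai measurable_fst.
have mgf : measurable_fun setT gf.
  by apply/measurable_EFinP; apply: measurableT_comp mf _; exact: measurableT_comp.
have gf0 z : 0 <= gf z by rewrite lee_fin.
have mg u : measurable_fun setT (g u).
  apply: emeasurable_funM.
    apply: measurableT_comp (measurable_iprimitive mf f0) _.
    exact: measurableT_comp.
  apply/measurable_EFinP; apply: measurable_funM.
    by apply: measurableT_comp => //; exact: measurableT_comp.
  apply: measurable_maxr => //; apply: measurable_funM => //; apply: measurable_funD => //.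
  apply: measurable_funM; first exact: measurable_snd.
  apply: (measurable_inv_gt0 (g := fun z : Oi * measurableTypeR R => a i z.1)) => //.
  exact: measurableT_comp mai measurable_fst.
have g0 u z : 0 <= g u z.
  rewrite mule_ge0// ?iprimitive_ge0// lee_fin mulr_ge0 ?expR_ge0//.
  by rewrite le_max lexx orbT.
have gE u : \int[P]_w weight u w = \int[P]_w \int[normal_prob 0 s]_x g u (w, x).
  rewrite -(integral_xi ni (mg u) (g0 u)); apply: eq_integral => w _.
  by rewrite /weight /g/= XE.
have gfE : \int[P]_w (f (expR (X w)))%:E = \int[P]_w \int[normal_prob 0 s]_x gf (w, x).
  rewrite -(integral_xi ni mgf gf0); apply: eq_integral => w _.
  by rewrite /gf/= XE.
have mint (h : Oi * measurableTypeR R -> \bar R) : measurable_fun setT h -> (forall z, 0 <= h z) ->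
    measurable_fun [set: Omega] (fun w => \int[normal_prob 0 s]_x h (w, x)).
  move=> mh h0; apply: (measurable_sub_fun (@others_measurable i)).
  by apply: measurable_fun_fubini_tonelli_F.
rewrite !gE gfE -ge0_integralZl//; last 3 first.
- exact: mint.
- by move=> w _; exact: integral_ge0.
- by rewrite lee_fin sqr_ge0.
rewrite -ge0_integralD//; last 4 first.
- by move=> w _; exact: integral_ge0.
- exact: mint.
- by move=> w _; rewrite mule_ge0 ?lee_fin ?sqr_ge0//; exact: integral_ge0.
- by apply: emeasurable_funM => //; exact: mint.
apply: eq_integral => w _.
have := @gaussian_ibp R (r w) (a i w) s (a0 i w) s0 f mf f0.
rewrite /g /gf/=; under [X in _ -> X = _]eq_integral do rewrite mul1r.
by under [X in _ -> _ = X + _]eq_integral do rewrite mulN1r.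
Qed.

End gaussian_increments.

(** * The discretized price *)

Section discretized_price.
Local Open Scope ereal_scope.
Context {R : realType} {d : measure_display} {Omega : measurableType d}.
Variable P : probability Omega R.
Notation mu := (@lebesgue_measure R).
Variables (T H b alpha S0 Y0 : R) (W B : R -> Omega -> R).
Hypotheses (T_gt0 : (0 < T)%R) (H12 : (2^-1 < H < 1)%R) (alpha_gt0 : (0 < alpha)%R).
Hypotheses (hW : is_wiener P T W) (hB : is_fbm P T H B) (hWB : independent_processes P T W B).
Variables (sigma : R -> R) (Csigma smin q r q' : R).
Hypothesis hsigma : condition_B sigma Csigma smin q r q'.
Variable n : nat.
Hypothesis n0 : (0 < n)%N.

(** The generators in [sigma_upto], named so that the type carrying the generated sigma-algebra can
    be formed. *)
Definition upto_events (X : R -> Omega -> R) t : set (set Omega) :=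
  [set A | exists (s : R) (U : set R), [/\ (0 <= s <= t)%R, measurable U & A = X s @^-1` U]].

Lemma upto_events_measurable (X : R -> Omega -> R) :
  (forall t, (0 <= t <= T)%R -> measurable_fun setT (X t)) ->
  upto_events X T `<=` measurable.
Proof.
by move=> mX _ [s [U [sT mU ->]]]; rewrite -[_ @^-1` _]setTI; exact: mX.
Qed.

Lemma measurable_upto (X : R -> Omega -> R) t s : (0 <= s <= t)%R ->
  measurable_fun setT (X s : g_sigma_algebraType (upto_events X t) -> R).
Proof.
by move=> st _ U mU; rewrite setTI; apply: sub_sigma_algebra; exists s, U.
Qed.

Let F := upto_events B T.
Let s : R := Num.sqrt (T / n%:R).
Let xi i := increment W (grid T n i) (grid T n i.+1).
Let a i w := sigma (Yn_grid T alpha Y0 B n i w).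

Let mF : F `<=` measurable.
Proof. by apply: upto_events_measurable; exact: fbm_measurable hB. Qed.

Let dt0 : (0 < T / n%:R)%R. Proof. by rewrite divr_gt0// ltr0n. Qed.

Let s0 : (0 < s)%R. Proof. by rewrite sqrtr_gt0. Qed.

Let s2 : (s ^+ 2 = T / n%:R)%R. Proof. by rewrite sqr_sqrtr// ltW. Qed.

Let mxi i : (i < n)%N -> measurable_fun [set: Omega] (xi i).
Proof.
move=> ni; apply: measurable_funB; apply: (wiener_measurable hW); apply: grid_itv => //.
exact: ltnW.
Qed.

Let xi_law i : (i < n)%N -> has_law P (xi i) (normal_prob 0 s).
Proof.
move=> ni; rewrite /s -[(T / _)%R](addKr (grid T n i)) addrC -gridS.
apply: (wiener_increment hW).
- exact: grid_ge0.
- by rewrite gridS ltrDl.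
- by have /andP[] := grid_itv T_gt0 n0 ni.
Qed.

Let sigma_upto_xi (V : nat -> set R) : (forall j, measurable (V j)) ->
  sigma_upto W T (\bigcap_(j in `I_n) xi j @^-1` V j).
Proof.
move=> mV.
apply: (@bigcap_measurableType _ (g_sigma_algebraType (upto_events W T))) => j jn.
have mxi' : measurable_fun setT (xi j : g_sigma_algebraType (upto_events W T) -> R).
  by apply: measurable_funB; apply: measurable_upto; apply: grid_itv => //; exact: ltnW.
by rewrite -[X in measurable X]setTI; exact: mxi'.
Qed.

(** Independence of [W] and [B] splits off [C]; independence of the increments of [W] and their
    common law give the product. *)
Let indep C (V : nat -> set R) : <<s F >> C -> (forall j, measurable (V j)) ->
  P (C `&` \bigcap_(j in `I_n) xi j @^-1` V j) = P C * \prod_(j < n) normal_prob 0 s (V j).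
Proof.
move=> FC mV; rewrite setIC (hWB (sigma_upto_xi mV) FC) muleC; congr (_ * _).
rewrite (wiener_independent_increments hW)//.
- by apply: eq_bigr => j _; exact: xi_law.
- exact: grid_ge0.
- by rewrite grid_last.
- by move=> i _; apply: grid_le.
Qed.

Lemma measurable_upto_Yn_grid i t : (grid T n i <= t)%R ->
  measurable_fun setT (Yn_grid T alpha Y0 B n i : g_sigma_algebraType (upto_events B t) -> R).
Proof.
move=> it; apply: measurable_funD => //; apply: measurable_funM => //.
apply: measurable_sum => j; apply: measurable_funM => //.
apply: measurable_funB; apply: measurable_upto; rewrite grid_ge0//=.
  by apply: le_trans it; apply: grid_le.
by apply: le_trans it; apply: grid_le => //; exact: ltnW.
Qed.

Let ma i : (i < n)%N -> measurable_fun setT (a i : g_sigma_algebraType F -> R).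
Proof.
move=> ni; apply: measurableT_comp; first exact: measurable_vol hsigma.
apply: measurable_upto_Yn_grid.
by have /andP[] := grid_itv T_gt0 n0 (ltnW ni).
Qed.

Let a0 i w : (0 < a i w)%R. Proof. exact: (vol_gt0 hsigma). Qed.

Let mu0 : R := (ln S0 + b * T)%R.

Lemma total_varn_sum w : total_varn T alpha Y0 B sigma n w = var_sum s a n w.
Proof.
rewrite /total_varn /Rintegral.
suff -> : \int[mu]_(t in `[0%R, T]) (varn_rate T alpha Y0 B sigma n t w)%:E =
    (var_sum s a n w)%:E by [].
pose I i : set (measurableTypeR R) := `[grid T n i, grid T n i.+1[%classic.
have mI i : measurable (I i) by exact: measurable_itv.
pose v i := (a i w ^+ 2)%R.
have mD : measurable (`[0%R, T] : set (measurableTypeR R)) by exact: measurable_itv.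
have mf i : measurable_fun (`[0%R, T] : set (measurableTypeR R)) (fun t => (\1_(I i) t)%:E).
  by apply/measurable_EFinP; apply: measurable_funTS; exact: measurable_indic.
transitivity (\int[mu]_(t in `[0%R, T]) (\sum_(i < n.+1) (v i)%:E * (\1_(I i) t)%:E)).
  apply: eq_integral => t; rewrite inE/= in_itv/= => /andP[t0 tT].
  rewrite /varn_rate -(@step_eval_Yn _ _ _ T alpha Y0 B n T_gt0 n0 (fun y => sigma y ^+ 2)%R n.+1).
    by rewrite /step_eval/= -sumEFin; apply: eq_bigr => i _; rewrite EFinM.
  by rewrite t0/= gridS grid_last//; have := dt0; lra.
rewrite ge0_integral_sum//; last 2 first.
- by move=> i; apply: emeasurable_funM => //; exact: mf.
- by move=> i t _; rewrite -EFinM lee_fin mulr_ge0// sqr_ge0.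
transitivity (\sum_(i < n.+1) (v i)%:E * mu (I i `&` `[0%R, T])).
  apply: eq_bigr => i _; rewrite ge0_integralZl//.
  - by rewrite integral_indic.
  - by rewrite lee_fin sqr_ge0.
(* The extra interval, added to represent the value at T, meets [0, T] in the single point T and
   contributes nothing. *)
rewrite big_ord_recr/= [X in _ + X](_ : _ = 0) ?adde0; last first.
  apply/eqP; rewrite mule_eq0; apply/orP; right; apply/eqP.
  have -> : I n `&` `[0%R, T] = [set T].
    apply/seteqP; split => t; rewrite /I/= !in_itv/= grid_last//.
      by move=> [/andP[Tt _] /andP[_ tT]]; apply/eqP; rewrite eq_le tT.
    by move=> ->; rewrite lexx (ltW T_gt0) gridS grid_last// ltrDl dt0.
  exact: lebesgue_measure_set1.
rewrite /var_sum -sumEFin; apply: eq_bigr => i _.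
rewrite setIidl; last first.
  move=> t; rewrite /I/= !in_itv/= => /andP[ht ht'].
  rewrite (le_trans (grid_ge0 _ _ _) ht)//= (le_trans (ltW ht'))//.
  by have /andP[] := grid_itv T_gt0 n0 (ltn_ord i).
rewrite s2 [RHS]EFinM; congr (_ * _).
have := lebesgue_measure_itv `[grid T n i, grid T n i.+1[.
rewrite /= lte_fin gridS ltrDl dt0 -EFinB addrAC subrr add0r => e; rewrite -e /I gridS.
by [].
Qed.

Let m w : R := (mu0 - 2^-1 * var_sum s a n w)%R.

Lemma Xn_sum w : Xn T alpha S0 Y0 b sigma W B n n w = (m w + xi_sum xi a n w)%R.
Proof.
rewrite /Xn grid_last// /m -total_varn_sum /total_varn.
by congr (_ + _)%R.
Qed.

Let mvar : measurable_fun setT (var_sum s a n : g_sigma_algebraType F -> R).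
Proof.
by apply: measurable_sum => j; apply: measurable_funM => //; apply: measurable_funX; exact: ma.
Qed.

Lemma expectation_Xn (h : R -> R) : measurable_fun [set: R] h -> (forall x, (0 <= h x)%R) ->
  \int[P]_w (h (Xn T alpha S0 Y0 b sigma W B n n w))%:E =
  smoothed_pricen P T alpha Y0 B sigma n mu0 h.
Proof.
move=> mh h0.
pose g (z : g_sigma_algebraType F * measurableTypeR R) := (h (m z.1 + z.2)%R)%:E.
have mg : measurable_fun setT g.
  apply/measurable_EFinP; apply: measurableT_comp mh _; apply: measurable_funD; last exact: measurable_snd.
  apply: measurable_funB => //; apply: measurable_funM => //.
  exact: measurableT_comp mvar measurable_fst.
have g0 z : 0 <= g z by rewrite lee_fin.
have := integral_xi_sum s0 mF mxi indep ma a0 (leqnn n) mg g0.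
rewrite /g/= => e; under eq_integral do rewrite Xn_sum.
apply: (etrans e); apply: eq_integral => w _.
by rewrite total_varn_sum /smoothing; apply: eq_integral => z _; rewrite /m [(2^-1 * _)%R]mulrC.
Qed.

Variables (f : R -> R) (Cf p : R).
Hypotheses (mf : measurable_fun [set: R] f) (f0 : forall x, (0 <= f x)%R).
Hypotheses (Cf0 : (0 < Cf)%R) (p0 : (0 < p)%R).
Hypothesis f_le : forall x, (0 <= x)%R -> (f x <= Cf * (1 + x `^ p))%R.

Let iprimitive_le y : (0 < y)%R -> iprimitive f y <= (Cf * (1 + y `^ p) * y)%:E.
Proof.
move=> y0; have mD : measurable (`]0%R, y] : set (measurableTypeR R)) by exact: measurable_itv.
apply: (@le_trans _ _ (\int[mu]_(x in `]0%R, y]) cst (Cf * (1 + y `^ p))%:E x)).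
  apply: ge0_le_integral => //.
  - by move=> x _; rewrite lee_fin.
  - by apply: measurable_funTS; exact/measurable_EFinP.
  move=> x; rewrite /= in_itv/= lee_fin => /andP[x0 xy].
  apply: (le_trans (f_le (ltW x0))); rewrite ler_wpM2l ?(ltW Cf0)// lerD2l.
  by apply: ge0_ler_powR; rewrite ?nnegrE ?(ltW p0) ?(ltW x0) ?(ltW y0).
suff -> : \int[mu]_(x in `]0%R, y]) cst (Cf * (1 + y `^ p))%:E x = (Cf * (1 + y `^ p) * y)%:E by [].
apply: (etrans (integral_cst mu mD _)); rewrite [RHS]EFinM; congr (_ * _).
by have := lebesgue_measure_itv `]0%R, y]; rewrite /= lte_fin y0 sube0.
Qed.

Lemma primitiveE y : (0 < y)%R -> iprimitive f y = (primitive f y)%:E.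
Proof.
move=> y0; rewrite /primitive /Rintegral -integral_itv_obnd_cbnd; last first.
  by apply: measurable_funTS; exact/measurable_EFinP.
rewrite fineK// ge0_fin_numE; last exact: iprimitive_ge0.
exact: le_lt_trans (iprimitive_le y0) (ltry _).
Qed.

Let X w := Xn T alpha S0 Y0 b sigma W B n n w.
Let G w : R := (primitive f (expR (X w)) / expR (X w))%R.
Let u i w : R := (xi i w / a i w + s ^+ 2)%R.

(** The exponent is 2p because [G] grows like e^{p X} and is squared in the integrability bound
    below. *)
Hypothesis exp_moment : smoothed_pricen P T alpha Y0 B sigma n mu0 (fun x => expR (2 * p * x)%R) < +oo.

Let G_bounds w : (0 <= G w <= Cf * (1 + expR (p * X w)))%R.
Proof.
have e0 := expR_gt0 (X w); apply/andP; split.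
  rewrite divr_ge0// -lee_fin -primitiveE//; exact: iprimitive_ge0.
rewrite ler_pdivrMr// -lee_fin -primitiveE//; apply: (le_trans (iprimitive_le e0)).
by rewrite lee_fin /powR gt_eqF// expRK.
Qed.

Let mX : measurable_fun setT X.
Proof.
rewrite (_ : X = fun w => m w + xi_sum xi a n w)%R; last by apply/funext => w; exact: Xn_sum.
apply: measurable_funD.
  apply: measurable_funB => //; apply: measurable_funM => //.
  exact: (measurable_sub_fun mF (h := var_sum s a n) mvar).
apply: measurable_sum => i; apply: measurable_funM; last exact: mxi.
exact: (measurable_sub_fun mF (h := a i) (ma (ltn_ord i))).
Qed.

Let mG : measurable_fun setT G.
Proof.
rewrite (_ : G = fun w => fine (iprimitive f (expR (X w))) * expR (- X w))%R.
  apply: measurable_funM.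
    apply: measurableT_comp; first exact: (fine_measurable measurableT).
    apply: measurableT_comp; first exact: measurable_iprimitive.
    exact: measurableT_comp.
  by apply: measurableT_comp => //; exact: measurableT_comp.
by apply/funext => w; rewrite primitiveE ?expR_gt0//= /G expRN.
Qed.

Let mai i : (i < n)%N -> measurable_fun [set: Omega] (a i).
Proof. by move=> ni; exact: (measurable_sub_fun mF (h := a i) (ma ni)). Qed.

Let mu_ i : (i < n)%N -> measurable_fun [set: Omega] (u i).
Proof.
move=> ni; apply: measurable_funD => //; apply: measurable_funM; first exact: mxi.
by apply: measurable_inv_gt0 => //; exact: mai.
Qed.

(** |G v| <= G^2 + u^2. Here G^2 is bounded through the moment of order 2p of the price, and u^2
    through xi^2 <= 4 s^2 e^{xi^2 / (4 s^2)}, a Gaussian moment with D = 1/2. [v] stands for [u i]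
    and for its two parts. *)
Let integrable_Gu (i : nat) (v : Omega -> R) : (i < n)%N -> measurable_fun setT v ->
  (forall w, (`|v w| <= `|u i w|)%R) -> P.-integrable setT (fun w => (G w * v w)%:E).
Proof.
move=> ni mv vu; apply/integrableP; split.
  by apply/measurable_EFinP; exact: measurable_funM.
pose c1 : R := (2 * Cf ^+ 2 + 2 * (s ^+ 2) ^+ 2)%R.
pose c3 : R := (2 * (smin ^+ 2)^-1 * (4 * s ^+ 2))%R.
pose e2 w : R := expR (2 * p * X w).
pose e3 w : R := expR (xi i w ^+ 2 / (4 * s ^+ 2)).
have smin0 := condB_smin_gt0 hsigma.
have Cf2 := sqr_ge0 Cf.
have s4 := sqr_ge0 (s ^+ 2)%R.
have c30 : (0 <= c3)%R.
  apply: mulr_ge0; first by apply: mulr_ge0 => //; rewrite invr_ge0 sqr_ge0.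
  by apply: mulr_ge0 => //; exact: sqr_ge0.
have bnd w : (`|G w * v w| <= c1 + 2 * Cf ^+ 2 * e2 w + c3 * e3 w)%R.
  have /andP[G0 GC] := G_bounds w.
  rewrite normrM (ger0_norm G0).
  apply: (@le_trans _ _ (G w ^+ 2 + `|u i w| ^+ 2)%R).
    have := ler_wpM2l G0 (vu w); have := sqr_ge0 (G w - `|u i w|)%R; rewrite sqrrB.
    by have := sqr_ge0 (G w); have := sqr_ge0 `|u i w|; lra.
  have h1 : (G w ^+ 2 <= 2 * Cf ^+ 2 + 2 * Cf ^+ 2 * e2 w)%R.
    have -> : (e2 w = expR (p * X w) ^+ 2)%R.
      by rewrite /e2 -expRM_natl; congr expR; rewrite mulr_natl; ring.
    apply: (@le_trans _ _ ((Cf * (1 + expR (p * X w))) ^+ 2)%R).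
      by rewrite lerXn2r// nnegrE (le_trans G0).
    set x := expR _; rewrite exprMn.
    have -> : (2 * Cf ^+ 2 + 2 * Cf ^+ 2 * x ^+ 2 = Cf ^+ 2 * (2 + 2 * x ^+ 2))%R by ring.
    by apply: ler_wpM2l => //; have := sqr_ge0 (x - 1)%R; rewrite sqrrB; lra.
  have h2 : (`|u i w| ^+ 2 <= 2 * (s ^+ 2) ^+ 2 + c3 * e3 w)%R.
    rewrite real_normK ?num_real// /u.
    have k1 : ((xi i w / a i w) ^+ 2 <= (smin ^+ 2)^-1 * xi i w ^+ 2)%R.
      rewrite exprMn mulrC exprVn ler_wpM2r ?sqr_ge0// lef_pV2 ?posrE ?exprn_gt0//.
      by rewrite lerXn2r// ?nnegrE ?(ltW smin0) ?(ltW (a0 i w))//; exact: (condB_ge_smin hsigma).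
    have k2 : (xi i w ^+ 2 <= 4 * s ^+ 2 * e3 w)%R.
      have s20 : (0 < 4 * s ^+ 2)%R by rewrite mulr_gt0// exprn_gt0.
      rewrite mulrC -ler_pdivrMr//; have := expR_ge1Dx (xi i w ^+ 2 / (4 * s ^+ 2))%R.
      by rewrite /e3; lra.
    have k3 : ((smin ^+ 2)^-1 * xi i w ^+ 2 <= (smin ^+ 2)^-1 * (4 * s ^+ 2 * e3 w))%R.
      by rewrite ler_wpM2l// invr_ge0 sqr_ge0.
    have -> : (c3 * e3 w = 2 * ((smin ^+ 2)^-1 * (4 * s ^+ 2 * e3 w)))%R by rewrite /c3; ring.
    have := sqr_ge0 (xi i w / a i w - s ^+ 2)%R; rewrite sqrrB sqrrD.
    move: k1 k3; set k := (_ / a i w)%R; set l := (_ * xi i w ^+ 2)%R; set o := (_ * (4 * _ * _))%R.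
    lra.
  by rewrite /c1; lra.
have me2 : measurable_fun setT (fun w => (e2 w)%:E).
  apply/measurable_EFinP; apply: measurableT_comp => //.
  by apply: measurable_funM.
have me3 : measurable_fun setT (fun w => (e3 w)%:E).
  by apply: measurable_expR_sqr; exact: mxi.
have ie2 : \int[P]_w (e2 w)%:E < +oo.
  rewrite /e2 /X (@expectation_Xn (fun x => expR (2 * p * x))%R)//.
  by apply: measurableT_comp => //; exact: measurable_funM.
have ie3 : \int[P]_w (e3 w)%:E < +oo.
  rewrite (@ge0_integral_has_law _ _ _ P (xi i) (normal_prob 0 s)
    (fun y => (expR (y ^+ 2 / (4 * s ^+ 2)))%:E))//.
  - have s20 : (0 < s ^+ 2)%R by rewrite exprn_gt0.
    pose l := (- (4 * s ^+ 2)^-1)%R.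
    have D0 : (0 < 1 + 2 * l * s ^+ 2)%R.
      by rewrite (_ : 1 + _ = 1 / 2)%R ?divr_gt0// /l; field; rewrite gt_eqF.
    have := normal_expR_quad 0 s0 D0; rewrite /l.
    under eq_integral do rewrite mulNr opprK [(_^-1 * _)%R]mulrC.
    by move=> ->; rewrite ltry.
  - exact: mxi.
  - exact: xi_law.
  - apply/measurable_EFinP; apply: measurableT_comp => //; apply: measurable_funM => //.
have c10 : (0 <= c1)%R by rewrite /c1; lra.
have c20 : (0 <= 2 * Cf ^+ 2)%R by lra.
apply: (@le_lt_trans _ _ (\int[P]_w (c1%:E + (2 * Cf ^+ 2)%:E * (e2 w)%:E + c3%:E * (e3 w)%:E))).
  apply: ge0_le_integral => //.
  - by apply: measurableT_comp => //; apply/measurable_EFinP; exact: measurable_funM.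
  - by apply: emeasurable_funD; [apply: emeasurable_funD => //|]; exact: emeasurable_funM.
  by move=> w _; rewrite -!EFinM -!EFinD lee_fin.
have p2 w : 0 <= (2 * Cf ^+ 2)%:E * (e2 w)%:E by rewrite -EFinM lee_fin mulr_ge0 ?expR_ge0.
have p3 w : 0 <= c3%:E * (e3 w)%:E by rewrite -EFinM lee_fin mulr_ge0 ?expR_ge0.
have q2 : measurable_fun setT (fun w => (2 * Cf ^+ 2)%:E * (e2 w)%:E) by exact: emeasurable_funM.
have q3 : measurable_fun setT (fun w => c3%:E * (e3 w)%:E) by exact: emeasurable_funM.
rewrite ge0_integralD//; last 2 first.
- by move=> w _; rewrite adde_ge0.
- exact: emeasurable_funD.
rewrite ge0_integralD//.
rewrite !ge0_integralZl//; last 2 first.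
- by move=> w _; rewrite lee_fin expR_ge0.
- by move=> w _; rewrite lee_fin expR_ge0.
apply: lte_add_pinfty; first apply: lte_add_pinfty.
- apply: (@le_lt_trans _ _ (c1%:E * P setT)); first by rewrite integral_cst.
  by rewrite lte_mul_pinfty// ?lee_fin//; exact: le_lt_trans (probability_le1 P measurableT) (ltry _).
- by rewrite lte_mul_pinfty// lee_fin.
- by rewrite lte_mul_pinfty// lee_fin.
Qed.

Lemma expectation_weighted_price :
  \int[P]_w ((primitive f (expR (X w)) / expR (X w) *
     (1 + Zn T alpha Y0 sigma W B n w / T))%R)%:E = \int[P]_w (f (expR (X w)))%:E.
Proof.
have pos_le (x : R) : (`|Num.max x 0| <= `|x|)%R.
  by have [x0|x0] := leP x 0%R; rewrite ?normr0.
have int1 i (ni : (i < n)%N) : P.-integrable setT (fun w => (G w * Num.max (1 * u i w) 0)%:E).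
  apply: (integrable_Gu ni) => [|w]; last by rewrite mul1r.
  by apply: measurable_maxr => //; apply: measurable_funM => //; exact: mu_.
have intN i (ni : (i < n)%N) : P.-integrable setT (fun w => (G w * Num.max (-1 * u i w) 0)%:E).
  apply: (integrable_Gu ni) => [|w]; last by rewrite (le_trans (pos_le _))// mulN1r normrN.
  by apply: measurable_maxr => //; apply: measurable_funM => //; exact: mu_.
set L := \int[P]_w (f (expR (X w)))%:E.
have ibp i (ni : (i < n)%N) : \int[P]_w (G w * Num.max (1 * u i w) 0)%:E =
    \int[P]_w (G w * Num.max (-1 * u i w) 0)%:E + (s ^+ 2)%:E * L.
  have mm : measurable_fun setT (m : g_sigma_algebraType F -> R).
    by apply: measurable_funB => //; apply: measurable_funM.
  have := @integral_xi_ibp _ _ _ P F n s xi s0 mF mxi indep a ma a0 m f i ni mm mf f0.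
  rewrite /= => e.
  have wE (c : R) : \int[P]_w (G w * Num.max (c * u i w) 0)%:E =
      \int[P]_w (iprimitive f (expR (m w + xi_sum xi a n w)) *
        (expR (- (m w + xi_sum xi a n w)) * Num.max (c * (xi i w / a i w + s ^+ 2)) 0)%:E).
    apply: eq_integral => w _; rewrite -Xn_sum primitiveE ?expR_gt0// -EFinM; congr (_%:E).
    by rewrite /G mulrA -expRN.
  have LX : L = \int[P]_w (f (expR (m w + xi_sum xi a n w)))%:E.
    by apply: eq_integral => w _; rewrite /X Xn_sum.
  by rewrite (wE 1%R) (wE (-1)%R) LX; exact: e.
have ni0 : (0 < T / n%:R)%R := dt0.
(* Finiteness of the expectation of f(S^n_T) comes out of the integration by parts: for i = 0 the
   two weighted integrals are finite and differ by s^2 times it. *)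
have [l LE] : exists l, L = l%:E.
  have L0 : 0 <= L by apply: integral_ge0 => w _; rewrite lee_fin.
  have fin1 := integrable_fin_num measurableT (int1 0%N n0).
  have finN := integrable_fin_num measurableT (intN 0%N n0).
  exists (fine L); rewrite fineK// ge0_fin_numE// ltNge leye_eq; apply/negP => /eqP Loo.
  have := ibp 0%N n0; rewrite Loo gt0_muley ?lte_fin ?exprn_gt0//.
  by move: fin1 finN; move: (\int[P]_w _) (\int[P]_w _) => [x| |] [y| |].
have E i (ni : (i < n)%N) : P.-integrable setT (fun w => (G w * u i w)%:E) /\
    \int[P]_w (G w * u i w)%:E = (T / n%:R * l)%:E.
  split; first by apply: (integrable_Gu ni) => //; exact: mu_.
  have -> : (fun w => (G w * u i w)%:E) = (fun w => (G w * Num.max (1 * u i w) 0)%:E -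
      (G w * Num.max (-1 * u i w) 0)%:E).
    apply/funext => w; rewrite -EFinB -mulrBr; congr ((_ * _)%:E).
    rewrite mul1r mulN1r; have [x0|x0] := leP (u i w) 0%R.
      by rewrite max_l ?oppr_ge0// sub0r opprK.
    by rewrite max_r ?oppr_le0 ?(ltW x0)// subr0.
  rewrite integralB//; [|exact: int1|exact: intN].
  have := integrable_fin_num measurableT (intN i ni).
  rewrite ibp// LE s2 EFinM; move: (\int[P]_w _) => A finA.
  by rewrite addeAC subee// add0e.
(* As s^2 = T / n, the weights [u i] add up to Z^n_T + T. Each of the n terms yields T / n times the
   expectation, which the factor 1 / T compensates. *)
transitivity (\int[P]_w (\sum_(i < n) (T^-1)%:E * (G w * u i w)%:E)).
  apply: eq_integral => w _; rewrite -/(G w).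
  under [RHS]eq_bigr do rewrite -EFinM.
  rewrite sumEFin -mulr_sumr -mulr_sumr mulrCA; congr ((_ * _)%:E).
  rewrite big_split/= sumr_const card_ord s2 -[(_ *+ n)%R]mulr_natr divfK ?pnatr_eq0 -?lt0n//.
  have -> : Zn T alpha Y0 sigma W B n w = (\sum_(i < n) xi i w / a i w)%R.
    by rewrite /Zn /step_integral/=; apply: eq_bigr => i _; rewrite mulrC.
  by rewrite [in RHS]mulrDr mulVf ?gt_eqF// [LHS]addrC [(_ / T)%R]mulrC.
rewrite integral_sum//; last first.
  by move=> i; apply: integrableZl => //; have [] := E i (ltn_ord i).
rewrite (eq_bigr (fun _ => (T^-1 * (T / n%:R * l))%:E)); last first.
  move=> i _; have [iG EG] := E i (ltn_ord i).
  by rewrite integralZl// EG.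
rewrite sumEFin sumr_const card_ord LE; congr (_%:E); rewrite -[LHS]mulr_natr.
by field; rewrite pnatr_eq0 -lt0n n0 gt_eqF.
Qed.

End discretized_price.

(** * The law of the limit price *)

Lemma measurable_ray d (X : measurableType d) (R : realType) (Z : X -> R) a :
  measurable_fun setT Z -> measurable [set x | a < Z x].
Proof.
move=> mZ; rewrite -[X in measurable X]setTI.
have := mZ measurableT `]a, +oo[%classic (measurable_itv _).
by congr (measurable (_ `&` _)); apply/seteqP; split => x; rewrite /= in_itv/= andbT.
Qed.

Section laws_on_rays.
Local Open Scope ereal_scope.
Context {R : realType}.

Lemma le_adde_cvg0 (x y : \bar R) (z : nat -> \bar R) :
  (forall k, x <= y + z k) -> z k @[k --> \oo] --> 0 -> x <= y.
Proof.
move=> xyz z0.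
have yz : (y + z k) @[k --> \oo] --> y + 0 by apply: cvgeD => //; [exact: fin_num_adde_defl|exact: cvg_cst].
rewrite -[y]adde0 -(cvg_lim _ yz)//; apply: lime_ge; last by apply: nearW.
by apply/cvg_ex; exists (y + 0).
Qed.

(** ]a, +oo[ is the increasing union of the rays ]a + 1/(k + 1), +oo[, so the slack [e] disappears
    by continuity from below. *)
Lemma measure_rays_le (m1 m2 : {measure set (measurableTypeR R) -> \bar R}) :
  (forall a e : R, (0 < e)%R -> m1 `](a + e)%R, +oo[%classic <= m2 `]a, +oo[%classic) ->
  forall a : R, m1 `]a, +oo[%classic <= m2 `]a, +oo[%classic.
Proof.
move=> h a.
pose F (k : nat) : set (measurableTypeR R) := `](a + k.+1%:R^-1)%R, +oo[%classic.
have UF : \bigcup_k F k = `]a, +oo[%classic.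
  apply/seteqP; split => x.
    move=> [k _]; rewrite /F/= !in_itv/= !andbT; apply: le_lt_trans.
    by rewrite lerDl invr_ge0.
  rewrite /= in_itv/= andbT => ax.
  have xa : (0 < x - a)%R by rewrite subr_gt0.
  exists (Num.truncn (x - a)^-1) => //; rewrite /F/= in_itv/= andbT -ltrBrDl.
  rewrite -[ltRHS]invrK ltf_pV2 ?posrE ?invr_gt0//.
  by have /andP[] := truncn_itv (ltW (etrans (invr_gt0 _) xa)).
have mF k : measurable (F k) by exact: measurable_itv.
have cF : (m1 \o F) k @[k --> \oo] --> m1 (\bigcup_k F k).
  apply: nondecreasing_cvg_mu => //; first by rewrite UF; exact: measurable_itv.
  move=> i j ij; apply/subsetPset => x; rewrite /F/= !in_itv/= !andbT; apply: le_lt_trans.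
  by rewrite lerD2l lef_pV2 ?posrE// ler_nat.
rewrite -UF -(cvg_lim _ cF)//; apply: lime_le; first by apply/cvg_ex; eexists; exact: cF.
by apply: nearW => k /=; rewrite UF; apply: h; rewrite invr_gt0.
Qed.

Lemma eq_measure_rays (m1 m2 : {measure set (measurableTypeR R) -> \bar R}) :
  m1 setT < +oo -> (forall a : R, m1 `]a, +oo[%classic = m2 `]a, +oo[%classic) ->
  forall A, measurable A -> m1 A = m2 A.
Proof.
move=> m1oo h A mA.
apply: (@g_sigma_algebra_measure_unique _ R (measurableTypeR R) (@RGenOInfty.G R) _
  (fun k : nat => `](- k%:R)%R, +oo[%classic)).
- by move=> _ [x ->]; exact: measurable_itv.
- by move=> k; eexists.
- apply/seteqP; split => // x _; exists (Num.truncn `|x|) .+1 => //=.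
  rewrite in_itv/= andbT ltrNl; apply: le_lt_trans (ler_norm _) _; rewrite normrN.
  by have /andP[] := truncn_itv (normr_ge0 x).
- move=> _ _ [x ->] [y ->]; exists (Num.max x y); apply/seteqP; split => z;
    rewrite /= !in_itv/= !andbT gt_max.
    by move=> [-> ->].
  by move=> /andP[].
- by move=> _ [x ->]; exact: h.
- move=> k; apply: le_lt_trans m1oo; apply: le_measure; rewrite ?inE//; exact: measurable_itv.
- by have := mA; rewrite RGenOInfty.measurableE.
Qed.

(** Rays are stable under intersection and generate the Borel sets, so the two image laws coincide.
    The slack [e] is what convergence in probability leaves in a comparison of rays. *)
Lemma eq_integral_rays d1 d2 (X1 : measurableType d1) (X2 : measurableType d2)
    (P1 : {measure set X1 -> \bar R}) (P2 : {measure set X2 -> \bar R})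
    (Z1 : X1 -> R) (Z2 : X2 -> R) (h : R -> R) :
  P1 setT < +oo -> measurable_fun setT Z1 -> measurable_fun setT Z2 ->
  measurable_fun [set: R] h -> (forall x, (0 <= h x)%R) ->
  (forall a e : R, (0 < e)%R -> P1 [set x | (a + e < Z1 x)%R] <= P2 [set x | (a < Z2 x)%R]) ->
  (forall a e : R, (0 < e)%R -> P2 [set x | (a + e < Z2 x)%R] <= P1 [set x | (a < Z1 x)%R]) ->
  \int[P1]_x (h (Z1 x))%:E = \int[P2]_x (h (Z2 x))%:E.
Proof.
move=> P1oo mZ1 mZ2 mh h0 h12 h21.
have mZ1' : measurable_fun setT (Z1 : X1 -> measurableTypeR R) by [].
have mZ2' : measurable_fun setT (Z2 : X2 -> measurableTypeR R) by [].
have rayE d' (X' : measurableType d') (Z : X' -> R) a :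
    Z @^-1` `]a, +oo[%classic = [set x | (a < Z x)%R].
  by apply/seteqP; split => x; rewrite /= in_itv/= andbT.
have meh : measurable_fun [set: measurableTypeR R] (EFin \o h) by exact/measurable_EFinP.
have E1 := @ge0_integral_pushforward _ _ _ _ R (Z1 : X1 -> measurableTypeR R) mZ1' P1 setT
  (EFin \o h) measurableT meh _.
have E2 := @ge0_integral_pushforward _ _ _ _ R (Z2 : X2 -> measurableTypeR R) mZ2' P2 setT
  (EFin \o h) measurableT meh _.
rewrite preimage_setT in E1; rewrite preimage_setT in E2.
rewrite -E1; last by move=> y _; rewrite lee_fin.
rewrite -E2; last by move=> y _; rewrite lee_fin.
apply: eq_measure_integral => A mA _.
apply: eq_measure_rays => //.
move=> a; apply/eqP; rewrite eq_le; apply/andP; split.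
  by apply: measure_rays_le => b e e0; rewrite /= /pushforward !rayE; exact: h12.
by apply: measure_rays_le => b e e0; rewrite /= /pushforward !rayE; exact: h21.
Qed.

End laws_on_rays.

Section limit_price.
Local Open Scope ereal_scope.
Context {R : realType} {d : measure_display} {Omega : measurableType d}.
Variable P : probability Omega R.
Notation mu := (@lebesgue_measure R).
Variables (T H b alpha S0 Y0 : R) (W B Y : R -> Omega -> R).
Hypotheses (T_gt0 : (0 < T)%R) (H12 : (2^-1 < H < 1)%R) (alpha_gt0 : (0 < alpha)%R).
Hypotheses (hW : is_wiener P T W) (hB : is_fbm P T H B) (hWB : independent_processes P T W B).
Hypothesis hY : is_fractional_OU T alpha Y0 B Y.
Variables (sigma : R -> R) (Csigma smin q r q' : R).
Hypothesis hsigma : condition_B sigma Csigma smin q r q'.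
Variable I : Omega -> R.
Hypothesis hI : is_ito_integral P (joint_filtration W B) W (fun s w => sigma (Y s w)) T I.

Let mvolY := ito_integrand_measurable hI.
Let mI := ito_measurable hI.
Let rH0 : (0 < r * H)%R.
Proof.
have /andP[r0 _] := condB_r hsigma; have /andP[h1 _] := H12.
by apply: mulr_gt0 => //; apply: lt_trans h1; rewrite invr_gt0.
Qed.

Let h k := Yn_step T alpha Y0 B k.+1 sigma k.+1.

Let tail_C := expectation_weight_path_le T_gt0 H12 alpha_gt0 hB hY hsigma mvolY.

Let l0 : (0 <= 2 * 1 * T)%R. Proof. by rewrite !mulr_ge0// ltW. Qed.

Let Q k := weight_path T H alpha Y0 B Y sigma r (2 * 1 * T) k.+1.

Let mQ k : measurable_fun setT (Q k).
Proof. exact: (measurable_weight_path Y0 T_gt0 H12 alpha_gt0 hB hsigma mvolY). Qed.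

(** The integrands may differ at s = T, where the right-open step function is 0; a single point does
    not change the integral. *)
Let step_eval_dist k w : \int[mu]_(s in `[0%R, T]) ((step_eval (h k) s w - sigma (Y s w)) ^+ 2)%:E =
  \int[mu]_(s in `[0%R, T]) ((sigma (Yn T alpha Y0 B k.+1 s w) - sigma (Y s w)) ^+ 2)%:E.
Proof.
set g := fun s => ((sigma (Yn T alpha Y0 B k.+1 s w) - sigma (Y s w)) ^+ 2)%:E.
have sub : (`[0%R, T[ : set R) `<=` `[0%R, T] by apply: subset_itvl; rewrite bnd_simp.
have mg : measurable_fun (`[0%R, T[ : set R) g.
  apply: (measurable_funS _ sub); first exact: measurable_itv.
  apply/measurable_EFinP; apply: (measurable_itv_slice (f := fun s w =>
    (sigma (Yn T alpha Y0 B k.+1 s w) - sigma (Y s w)) ^+ 2)%R).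
  by apply/measurable_EFinP; exact: (measurable_vol_dist Y0 T_gt0 H12 alpha_gt0 hB hsigma mvolY).
have gE : {in `[0%R, T[%classic, g =1 (fun s => ((step_eval (h k) s w - sigma (Y s w)) ^+ 2)%:E)}.
  move=> s; rewrite inE/= in_itv/= => sT; rewrite /h step_eval_Yn//.
  by rewrite grid_last.
rewrite -!integral_itv_bndo_bndc//; last exact: (eq_measurable_fun _ gE mg).
by apply: eq_integral => s sT; rewrite -gE.
Qed.

Lemma Yn_step_approximation :
  step_approximation P (joint_filtration W B) (fun s w => sigma (Y s w)) T h.
Proof.
split=> [k|e e0].
  split=> /=.
  - by rewrite /grid mul0r mul0r.
  - exact: grid_last.
  - by move=> i _; apply: grid_le.
  move=> i ik U mU; apply: sub_sigma_algebra; right.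
  have mYi : measurable_fun setT (Yn_grid T alpha Y0 B k.+1 i :
      g_sigma_algebraType (upto_events B (grid T k.+1 i)) -> R).
    exact: measurable_upto_Yn_grid.
  have : measurable_fun setT ((fun w => sigma (Yn_grid T alpha Y0 B k.+1 i w)) :
      g_sigma_algebraType (upto_events B (grid T k.+1 i)) -> R).
    by apply: measurableT_comp mYi; exact: measurable_vol hsigma.
  by move=> mV; have := mV measurableT _ mU; rewrite setTI.
have [C C0 hC] := tail_C l0.
have smin0 := condB_smin_gt0 hsigma.
have c0 : (0 < (4 * smin ^+ 2)^-1)%R by rewrite invr_gt0 mulr_gt0// exprn_gt0.
apply: (@probability_tail_cvg0 _ _ _ P _ Q
  (fun k => (4 * smin ^+ 2)^-1 * k.+1%:R `^ (- (2 * (r * H))))%R C e) => //.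
- move=> k; rewrite (_ : [set w | _] = [set w | (e%:E <= \int[mu]_(s in `[0%R, T])
     ((sigma (Yn T alpha Y0 B k.+1 s w) - sigma (Y s w)) ^+ 2)%:E)%E]); last first.
    by apply/seteqP; split => w; rewrite /= step_eval_dist.
  rewrite -[X in measurable X]setTI.
  have mF := @measurable_integral_itv R _ Omega T (fun z => ((sigma (Yn T alpha Y0 B k.+1 z.1 z.2)
    - sigma (Y z.1 z.2)) ^+ 2)%:E) (measurable_vol_dist Y0 T_gt0 H12 alpha_gt0 hB hsigma mvolY
    (ltn0Sn k)) (fun z => sqr_ge0 _).
  have := mF measurableT `[e%:E, +oo[%classic (emeasurable_itv _).
  by congr (measurable (_ `&` _)); apply/seteqP; split => w; rewrite /= in_itv/= andbT.
- by move=> k w; exact: weight_path_ge0.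
- by move=> k; exact: hC.
- by move=> k; rewrite mulr_gt0// powR_gt0.
- rewrite -[X in _ --> X](mulr0 (4 * smin ^+ 2)^-1%R); apply: cvgMr.
  by apply: natr_powRN_cvg0; rewrite mulr_gt0.
- move=> k w /= ek; apply: (le_trans ek); rewrite step_eval_dist.
  exact: (vol_path_dist Y0 T_gt0 H12 alpha_gt0 hB hsigma mvolY).
Qed.

Let mu0 : R := (ln S0 + b * T)%R.
Let V := total_var T Y sigma.
Let mV : measurable_fun setT V.
Proof. exact: measurable_total_var. Qed.
Let X w : R := (mu0 - 2^-1 * V w + I w)%R.
Let Xk k := Xn T alpha S0 Y0 b sigma W B k.+1 k.+1.
Let Vk k := total_varn T alpha Y0 B sigma k.+1.
Let mVk k : measurable_fun setT (Vk k).
Proof. exact: (measurable_total_varn Y0 T_gt0 H12 alpha_gt0 hB hsigma). Qed.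

Let mstep k : measurable_fun setT (step_integral W (h k)).
Proof.
apply: measurable_sum => i; apply: measurable_funM.
  apply: measurableT_comp; first exact: measurable_vol hsigma.
  by apply: (measurable_Yn_grid Y0 T_gt0 H12 alpha_gt0 hB) => //; exact: ltnW.
by apply: measurable_funB; apply: (wiener_measurable hW); apply: grid_itv => //; exact: ltnW.
Qed.

Let XkE k w : Xk k w = (mu0 - 2^-1 * Vk k w + step_integral W (h k) w)%R.
Proof. by rewrite /Xk /Xn grid_last. Qed.

Let mX : measurable_fun setT X.
Proof. by apply: measurable_funD => //; apply: measurable_funB => //; exact: measurable_funM. Qed.

Let mXk k : measurable_fun setT (Xk k).
Proof.
rewrite (_ : Xk k = fun w => mu0 - 2^-1 * Vk k w + step_integral W (h k) w)%R.
  by apply: measurable_funD => //; apply: measurable_funB => //; exact: measurable_funM.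
by apply/funext => w; exact: XkE.
Qed.

Let mdist (Z Z' : Omega -> R) e : measurable_fun setT Z -> measurable_fun setT Z' ->
  measurable [set w | (e <= `|Z w - Z' w|)%R].
Proof.
move=> mZ mZ'.
have mD : measurable_fun setT (fun w => `|Z w - Z' w|)%R.
  by apply: measurableT_comp => //; exact: measurable_funB.
rewrite -[X in measurable X]setTI.
have := mD measurableT `[e, +oo[%classic (measurable_itv _).
by congr (measurable (_ `&` _)); apply/seteqP; split => w; rewrite /= in_itv/= andbT.
Qed.

Let dist_le k w e : (e <= `|Xk k w - X w|)%R ->
  (e / 2 <= `|step_integral W (h k) w - I w|)%R \/ (e <= `|Vk k w - V w|)%R.
Proof.
move=> he; have [?|h1] := leP (e / 2)%R `|step_integral W (h k) w - I w|%R; first by left.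
right; move: he; rewrite XkE /X.
set x := step_integral _ _ _ in h1 *; set y := Vk k w; set z := V w; set t := I w in h1 *.
have -> : (mu0 - 2^-1 * y + x - (mu0 - 2^-1 * z + t) = (x - t) - 2^-1 * (y - z))%R by ring.
have := ler_normB (x - t)%R (2^-1 * (y - z))%R; rewrite normrM (ger0_norm (_ : 0 <= 2^-1)%R)//.
lra.
Qed.

Lemma Xn_cvg_in_probability e : (0 < e)%R ->
  P [set w | (e <= `|Xk k w - X w|)%R] @[k --> \oo] --> 0.
Proof.
move=> e0; have e20 : (0 < e / 2)%R by rewrite divr_gt0.
have cI := ito_limit hI Yn_step_approximation e20.
have [C C0 hC] := tail_C l0.
have K0 : (0 < T + T^-1)%R by rewrite addr_gt0// invr_gt0.
have cV : P [set w | (e <= `|Vk k w - V w|)%R] @[k --> \oo] --> 0.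
  apply: (@probability_tail_cvg0 _ _ _ P _ Q
    (fun k => (T + T^-1) * k.+1%:R `^ (- (r * H)))%R C e) => //.
  - by move=> k; exact: mdist.
  - by move=> k w; exact: weight_path_ge0.
  - by move=> k; exact: hC.
  - by move=> k; rewrite mulr_gt0// powR_gt0.
  - rewrite -[X in _ --> X](mulr0 (T + T^-1)%R); apply: cvgMr.
    exact: natr_powRN_cvg0.
  - move=> k w /= ek; apply: le_trans (total_var_dist Y0 T_gt0 H12 alpha_gt0 hB hsigma mvolY _ _) => //.
have cS : P [set w | (e / 2 <= `|step_integral W (h k) w - I w|)%R] +
    P [set w | (e <= `|Vk k w - V w|)%R] @[k --> \oo] --> 0.
  by rewrite -[X in _ --> X](adde0 0); apply: cvgeD.
apply: (@squeeze_cvge _ _ _ _ (cst 0) _ (fun k => P [set w | (e / 2 <= `|step_integral W (h k) w - I w|)%R] +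
    P [set w | (e <= `|Vk k w - V w|)%R])); [|exact: cvg_cst|exact: cS].
apply: nearW => k; rewrite measure_ge0/=.
apply: (@le_trans _ _ (P ([set w | (e / 2 <= `|step_integral W (h k) w - I w|)%R] `|`
   [set w | (e <= `|Vk k w - V w|)%R]))).
  apply: le_measure; rewrite ?inE.
  - exact: mdist.
  - by apply: measurableU; exact: mdist.
  - by move=> w /= /dist_le[?|?]; [left|right].
by apply: measureU2; exact: mdist.
Qed.

(** On Omega x R, with an independent standard Gaussian as second coordinate, a variable having the
    law claimed for [X]; the claim becomes an equality of two laws on the line. *)
Let gz (p : Omega * measurableTypeR R) : R := (mu0 - V p.1 / 2 + Num.sqrt (V p.1) * p.2)%R.

Let mgz : measurable_fun setT gz.
Proof.
apply: measurable_funD.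
  apply: measurable_funB => //; apply: measurable_funM => //.
  exact: measurableT_comp mV measurable_fst.
apply: measurable_funM; last exact: measurable_snd.
apply: measurableT_comp; first by apply: continuous_measurable_fun; exact: sqrt_continuous.
exact: measurableT_comp mV measurable_fst.
Qed.

Let smoothedE (f : R -> R) : measurable_fun [set: R] f -> (forall x, (0 <= f x)%R) ->
  \int[P \x normal_prob 0 1]_p (f (gz p))%:E = smoothed_price P T Y sigma mu0 f.
Proof.
move=> mf f0; rewrite (@fubini_tonelli1 _ _ _ (measurableTypeR R) R P (normal_prob 0 1)
  (fun p => (f (gz p))%:E))//.
  by apply/measurable_EFinP; exact: measurableT_comp.
by move=> p; rewrite lee_fin.
Qed.

Let ray_integral d' (X' : measurableType d') (m : {measure set X' -> \bar R}) (Z : X' -> R) a :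
  measurable_fun setT Z ->
  \int[m]_x (\1_(`]a, +oo[%classic : set R) (Z x))%:E = m [set x | (a < Z x)%R].
Proof.
move=> mZ.
have := integral_indic m measurableT (measurable_ray a mZ); rewrite setIT => <-.
apply: eq_integral => x _; rewrite !indicE.
suff -> : (Z x \in `]a, +oo[%classic) = (x \in [set x | (a < Z x)%R]) :> bool by [].
by apply/idP/idP; rewrite !inE /= in_itv/= andbT.
Qed.

(** The weak error estimate for the indicator of a ray, with the envelope A = 1, c = 0: here it
    matters that the estimate holds for discontinuous functions. *)
Let ray_error a : exists2 C : R, (0 <= C)%R & forall k,
  [/\ P [set w | (a < Xk k w)%R] <= (P \x normal_prob 0 1) [set p | (a < gz p)%R] +
      (C * k.+1%:R `^ (- (r * H)))%:E &
     (P \x normal_prob 0 1) [set p | (a < gz p)%R] <= P [set w | (a < Xk k w)%R] +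
      (C * k.+1%:R `^ (- (r * H)))%:E].
Proof.
have mh : measurable_fun [set: R] (\1_(`]a, +oo[%classic : set R) : R -> R).
  by apply: measurable_indic; exact: measurable_itv.
have h0 x : (0 <= \1_(`]a, +oo[%classic : set R) x :> R)%R by rewrite indicE.
have hA x : (0 <= (\1_(`]a, +oo[%classic : set R) x : R) <= 1 * expR (0 * `|x - mu0|))%R.
  by rewrite h0/= mul0r expR0 mulr1 indicE lern1 leq_b1.
have [C C0 hC] := smoothing_weak_error T_gt0 H12 alpha_gt0 hB hY hsigma mvolY ler01 (lexx 0%R) mh hA.
exists C => // k; have [_ _ h1 h2] := hC k.+1 (ltn0Sn k).
have r1 := etrans (esym (ray_integral (P \x normal_prob 0 1) a mgz)) (smoothedE mh h0).
have r2 := etrans (esym (ray_integral P a (mXk k)))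
  (expectation_Xn b alpha S0 Y0 T_gt0 hW hB hWB hsigma (ltn0Sn k) mh h0).
by rewrite r1 r2; split; [exact: h2|exact: h1].
Qed.

Let rate_cvg0 (C : R) (p : nat -> \bar R) : p k @[k --> \oo] --> 0 ->
  ((C * k.+1%:R `^ (- (r * H)))%:E + p k) @[k --> \oo] --> 0.
Proof.
move=> p0; rewrite -[X in _ --> X](adde0 0); apply: cvgeD => //.
apply: cvg_EFin; first by apply: nearW.
by rewrite -[X in _ --> X](mulr0 C); apply: cvgMr; exact: natr_powRN_cvg0.
Qed.

Lemma expectation_limit_price (f : R -> R) : measurable_fun [set: R] f -> (forall x, (0 <= f x)%R) ->
  \int[P]_w (f (X w))%:E = smoothed_price P T Y sigma mu0 f.
Proof.
move=> mf f0; rewrite -smoothedE//.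
(* If [Z] exceeds a + e while [Z'] does not exceed a, the two are at distance at least [e]; that
   probability tends to 0 and only the slack remains. *)
have split2 (Z Z' : Omega -> R) a e : measurable_fun setT Z -> measurable_fun setT Z' ->
    P [set w | (a + e < Z w)%R] <= P [set w | (a < Z' w)%R] + P [set w | (e <= `|Z' w - Z w|)%R].
  move=> mZ mZ'.
  apply: (@le_trans _ _ (P ([set w | (a < Z' w)%R] `|` [set w | (e <= `|Z' w - Z w|)%R]))).
    apply: le_measure; rewrite ?inE.
    - exact: measurable_ray.
    - by apply: measurableU; [exact: measurable_ray|exact: mdist].
    move=> w /= aZ; have [?|aZ'] := ltP a (Z' w); first by left.
    by right; rewrite distrC (le_trans _ (ler_norm _))//; lra.
  by apply: measureU2; [exact: measurable_ray|exact: mdist].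
apply: eq_integral_rays => //.
- exact: le_lt_trans (probability_le1 P measurableT) (ltry _).
- move=> a e e0; have [C C0 hC] := ray_error a.
  apply: (le_adde_cvg0 _ (rate_cvg0 C (Xn_cvg_in_probability e0))) => k.
  apply: (le_trans (split2 X (Xk k) a e mX (mXk k))).
  by rewrite addeA; apply: leeD => //; have [] := hC k.
- move=> a e e0; have [C C0 hC] := ray_error (a + e)%R.
  apply: (le_adde_cvg0 _ (rate_cvg0 C (Xn_cvg_in_probability e0))) => k.
  have [_ h1] := hC k; apply: (le_trans h1).
  rewrite [X in _ <= _ + X]addeC addeA; apply: leeD => //.
  apply: (le_trans (split2 (Xk k) X a e (mXk k) mX)); apply: leeD => //.
  by apply: le_measure; rewrite ?inE; [exact: mdist|exact: mdist|move=> w /=; rewrite distrC].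
Qed.

End limit_price.

(** * The weak rate for the weighted price *)

Unset Implicit Arguments.

Theorem theorem4p5 (R : realType) (d : measure_display)
    (Omega : measurableType d) (P : probability Omega R)
    (T H b alpha S0 Y0 : R)
    (T_gt0 : 0 < T) (H_itv : 2^-1 < H < 1) (alpha_gt0 : 0 < alpha)
    (S0_gt0 : 0 < S0)
    (f : R -> R) (Cf p : R) (hA : condition_A f Cf p)
    (sigma : R -> R) (Csigma smin q r q' : R)
    (hB : condition_B sigma Csigma smin q r q')
    (W B : R -> Omega -> R)
    (hW : is_wiener P T W) (hBH : is_fbm P T H B)
    (hWB : independent_processes P T W B)
    (Y S : R -> Omega -> R)
    (hY : is_fractional_OU T alpha Y0 B Y)
    (hS : is_price P T S0 b sigma W B Y S) :
  exists C : R, forall n : nat, (1 <= n)%N ->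
    (`| 'E_P[fun w => f (S T w)] -
        'E_P[fun w =>
          (let SnT := Sn T alpha S0 Y0 b sigma W B n n w in
           primitive f SnT / SnT *
             (1 + Zn T alpha Y0 sigma W B n w / T))%R] |
     <= (C * n%:R `^ (- (r * H)))%:E)%E.
Proof.
have [I /(_ T) hI] := hS.
have TT : 0 <= T <= T by rewrite lexx ltW.
have {hI} [hI SE] := hI TT.
have mvolY := ito_integrand_measurable hI.
have Cf0 := condA_Cf_gt0 hA; have p0 := condA_p_gt0 hA.
(* The values of [f] at negative arguments are arbitrary; extension by 0 gives a nonnegative
   measurable function on the line. *)
pose g : R -> R := f \_ (`[0, +oo[%classic).
have gE x : 0 <= x -> g x = f x.
  by move=> x0; rewrite /g patchE mem_set//= in_itv/= x0.
have g0 x : 0 <= g x.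
  rewrite /g patchE; case: ifP => //; rewrite inE/= in_itv/= andbT.
  exact: (condA_ge0 hA).
have mg : measurable_fun [set: R] g.
  apply/(measurable_restrict f (measurable_itv _) measurableT); rewrite setTI.
  exact: condA_measurable hA.
have g_le x : 0 <= x -> g x <= Cf * (1 + x `^ p).
  by move=> x0; rewrite gE//; exact: (condA_growth hA).
pose m := ln S0 + b * T.
pose h : R -> R := g \o expR.
have mh : measurable_fun [set: R] h by exact: measurableT_comp.
have h0 x : 0 <= h x by exact: g0.
(* From x <= |m| + |x - m|: recentres polynomial growth in the price as an exponential envelope
   around [m]. *)
have expk k x : 0 < k -> 1 + expR (k * x) <= 2 * expR (k * `|m|) * expR (k * `|x - m|).
  move=> k0; rewrite -mulrA -expRD -mulrDr.
  have h1 : 0 <= `|m| + `|x - m| by rewrite addr_ge0.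
  have h2 : x <= `|m| + `|x - m| by have := ler_norm m; have := ler_norm (x - m); lra.
  have : expR (k * x) <= expR (k * (`|m| + `|x - m|)) by rewrite ler_expR ler_wpM2l// ltW.
  have : 1 <= expR (k * (`|m| + `|x - m|)) by rewrite -expR0 ler_expR mulr_ge0// ltW.
  lra.
have h_le x : 0 <= h x <= Cf * (2 * expR (p * `|m|)) * expR (p * `|x - m|).
  rewrite h0/= -mulrA; apply: (le_trans (g_le _ (expR_ge0 x))).
  rewrite ler_wpM2l ?(ltW Cf0)// /powR gt_eqF ?expR_gt0// expRK.
  exact: expk.
have A0 : 0 <= Cf * (2 * expR (p * `|m|)) by rewrite mulr_ge0 ?(ltW Cf0)// mulr_ge0 ?expR_ge0.
have [C C0 hC] := smoothing_weak_error T_gt0 H_itv alpha_gt0 hBH hY hB mvolY A0 (ltW p0) mh h_le.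
(* The weak error estimate for [h2] is applied for its finiteness clause, the exponential moment
   required by the integration by parts. *)
pose h2 x := expR (2 * p * x).
have mh2 : measurable_fun [set: R] h2.
  by apply: measurableT_comp => //; exact: measurable_funM.
have p20 : 0 < 2 * p by rewrite mulr_gt0.
have h2_le x : 0 <= h2 x <= 2 * expR (2 * p * `|m|) * expR (2 * p * `|x - m|).
  by rewrite expR_ge0/=; have := expk _ x p20; rewrite /h2; lra.
have A20 : 0 <= 2 * expR (2 * p * `|m|) by rewrite mulr_ge0 ?expR_ge0.
have [C2 _ hC2] := smoothing_weak_error T_gt0 H_itv alpha_gt0 hBH hY hB mvolY A20 (ltW p20) mh2 h2_le.
exists C => n n1.
have [_ exp_moment _ _] := hC2 n n1.
have [Joo Jnoo J1 J2] := hC n n1.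
have EJ : ('E_P[fun w => f (S T w)] = smoothed_price P T Y sigma m h)%E.
  rewrite unlock -(expectation_limit_price b S0 T_gt0 H_itv alpha_gt0 hW hBH hWB hY hB hI mh h0).
  apply: eq_integral => w _; congr (_%:E); rewrite /h/= SE gE ?expR_ge0//.
  rewrite -{1}(@lnK _ S0) ?posrE// -expRD; congr (f (expR _)).
  by rewrite /m -/(total_var T Y sigma w); ring.
have EJn : ('E_P[fun w => (let SnT := Sn T alpha S0 Y0 b sigma W B n n w in
           primitive f SnT / SnT * (1 + Zn T alpha Y0 sigma W B n w / T))%R] =
   smoothed_pricen P T alpha Y0 B sigma n m h)%E.
  rewrite -(expectation_Xn b alpha S0 Y0 T_gt0 hW hBH hWB hB n1 mh h0) unlock.
  rewrite -(expectation_weighted_price T_gt0 hW hBH hWB hB n1 mg g0 Cf0 p0 g_le exp_moment).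
  apply: eq_integral => w _; congr ((_ / _ * _)%:E).
  apply: eq_Rintegral => z; rewrite inE/= in_itv/= => /andP[z0 _].
  by rewrite gE.
(* Both prices are finite and nonnegative, so the two one-sided estimates become inequalities
   between real numbers. *)
rewrite EJ EJn; move: Joo Jnoo J1 J2.
have: (0 <= smoothed_price P T Y sigma m h)%E.
  by do 2 (apply: integral_ge0 => ? _); rewrite lee_fin.
have: (0 <= smoothed_pricen P T alpha Y0 B sigma n m h)%E.
  by do 2 (apply: integral_ge0 => ? _); rewrite lee_fin.
case: (smoothed_price _ _ _ _ _ _) => // x; case: (smoothed_pricen _ _ _ _ _ _ _ _ _) => // y.
move=> _ _ _ _; rewrite -!EFinD !lee_fin => J1 J2.
rewrite ler_norml; apply/andP; split; lra.
Qed.
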